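(* Let $(t,J)$ be a skew local region. Let $$\tilde H^{(t,J)}=\mathbb C\text{-span}\{v_w\mid w\in\mathcal F^{(t,J)}\}$$ be the complex vector space with basis the symbols $v_w$, $w\in\mathcal F^{(t,J)}$. Then the following formulas make $\tilde H^{(t,J)}$ into an irreducible $\tilde H$-module: for each $w\in\mathcal F^{(t,J)}$, $$X^\lambda v_w=(wt)(X^\lambda)\,v_w\qquad\text{for }X^\lambda\in X,$$ $$T_iv_w=(T_i)_{ww}v_w+\bigl(q^{-1}+(T_i)_{ww}\bigr)v_{s_iw}\qquad\text{for }1\le i\le n,$$ where $\displaystyle (T_i)_{ww}=\frac{q-q^{-1}}{1-(wt)(X^{-\alpha_i})}$, and where $v_{s_iw}$ is set equal to $0$ if $s_iw\notin\mathcal F^{(t,J)}$.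
   Context: Let $R$ be a reduced crystallographic root system spanning a real vector space $\mathfrak h_{\mathbb R}^*\cong\mathbb R^n$ with Weyl group $W$ and $W$-invariant inner product $\langle\,,\rangle$, positive roots $R^+$, negative roots $R^-=-R^+$, simple roots $\alpha_1,\dots,\alpha_n$, and simple reflections $s_1,\dots,s_n$. Let $\alpha_i^\vee=2\alpha_i/\langle\alpha_i,\alpha_i\rangle$, let $\omega_1,\dots,\omega_n$ be the fundamental weights, $\langle\omega_i,\alpha_j^\vee\rangle=\delta_{ij}$, and let $P=\sum_i\mathbb Z\omega_i$ be the weight lattice. Let $X=\{X^\lambda\mid\lambda\in P\}$ be the group with $X^\lambda X^\mu=X^{\lambda+\mu}$, with $W$-action $wX^\lambda=X^{w\lambda}$, and let $\mathbb C[X]$ be its group algebra. Fix $q\in\mathbb C^*$ with $q^2\ne\pm1$. The affine Hecke algebra $\tilde H$ is the $\mathbb C$-algebra generated by $T_1,\dots,T_n$ and $X^\lambda$ ($\lambda\in P$), with relations: $T_i^2=(q-q^{-1})T_i+1$; the braid relations $T_iT_jT_i\cdots=T_jT_iT_j\cdots$ ($m_{ij}$ factors on each side, $m_{ij}$ the order of $s_is_j$ in $W$) for $i\neq j$; $X^\lambda X^\mu=X^{\lambda+\mu}$; and $$X^\lambda T_i=T_iX^{s_i\lambda}+(q-q^{-1})\frac{X^\lambda-X^{s_i\lambda}}{1-X^{-\alpha_i}}.$$ Let $T=\mathrm{Hom}(X,\mathbb C^* )$ be the set of group homomorphisms $X\to\mathbb C^*$, with $W$-action $(wt)(X^\lambda)=t(X^{w^{-1}\lambda})$.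 For a finite dimensional module $M$ over $\tilde H$ (or over a subalgebra containing $\mathbb C[X]$) and $t\in T$, $$M_t=\{m\in M\mid X^\lambda m=t(X^\lambda)m\ \forall X^\lambda\in X\},$$ $$M_t^{\rm gen}=\{m\in M\mid\text{for each }X^\lambda\in X,\ (X^\lambda-t(X^\lambda))^km=0\text{ for some }k\in\mathbb Z_{>0}\}.$$ $t$ is a weight of $M$ if $M_t\neq0$, and $M$ is calibrated if $M_t^{\rm gen}=M_t$ for all $t\in T$. For $w\in W$ let $R(w)=\{\alpha\in R^+\mid w\alpha\in R^-\}$. For $t\in T$, $$Z(t)=\{\alpha\in R^+\mid t(X^\alpha)=1\},\qquad P(t)=\{\alpha\in R^+\mid t(X^\alpha)=q^{2}\text{ or }q^{-2}\},$$ and for $J\subseteq P(t)$, $\mathcal F^{(t,J)}=\{w\in W\mid R(w)\cap Z(t)=\emptyset,\ R(w)\cap P(t)=J\}$ (this set indexes the chambers in the local region). A local region is a pair $(t,J)$ with $t\in T$, $J\subseteq P(t)$ and $\mathcal F^{(t,J)}\ne\emptyset$. An element $t\in T$ is calibratable if for all $i,j\in\{1,\dots,n\}$ (with $i=j$ allowed), $t$ is a weight of some finite dimensional calibrated module for the subalgebra of $\tilde H$ generated by $T_i$, $T_j$ and $\mathbb C[X]$. A local region $(t,J)$ is skew if $wt$ is calibratable for all $w\in\mathcal F^{(t,J)}$. (Then $(wt)(X^{-\alpha_i})\neq1$ for all $w\in\mathcal F^{(t,J)}$ and all $i$, so the coefficients $(T_i)_{ww}$ are defined.) *)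

(* Defs.v *)
From HB Require Import structures.
From mathcomp Require Import all_boot all_order all_algebra.
From mathcomp Require Import generic_quotient ring_quotient sesquilinear.
From mathcomp Require Import boolp classical_sets reals.
From mathcomp Require Import complex finmap monalg.

Set Implicit Arguments.
Unset Strict Implicit.
Unset Printing Implicit Defensive.

Import Order.TTheory GRing.Theory Num.Theory.

Local Open Scope classical_set_scope.
Local Open Scope ring_scope.

Section PresentedAlgebra.

(* [presented rel] is the quotient of the algebra [A] by the two-sided ideal
   generated by the differences [x - y] with [rel x y].  It is registered as a
   possibly trivial ring ([pzRingType]), because 1 <> 0 depends on [rel]. *)
Variables (K : nzRingType) (A : lalgType K) (rel : A -> A -> Prop).

Inductive ideal_of : A -> Prop :=
| ideal0 : ideal_of 0
| ideal_add a x y b z :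
    rel x y -> ideal_of z -> ideal_of (a * (x - y) * b + z).

Definition ideal_pred : {pred A} := fun x => `[< ideal_of x >].

Lemma ideal_predP x : reflect (ideal_of x) (x \in ideal_pred).
Proof. exact: asboolP. Qed.

Lemma ideal_ofD x y : ideal_of x -> ideal_of y -> ideal_of (x + y).
Proof.
elim=> [|a u v b z uv _ IH] Iy; first by rewrite add0r.
by rewrite -addrA; apply: ideal_add => //; apply: IH.
Qed.

Lemma ideal_ofMl c x : ideal_of x -> ideal_of (c * x).
Proof.
elim=> [|a u v b z uv _ IH]; first by rewrite mulr0; exact: ideal0.
by rewrite mulrDr !mulrA -(mulrA _ _ b) mulrA; apply: ideal_add.
Qed.

Lemma ideal_ofMr c x : ideal_of x -> ideal_of (x * c).
Proof.
elim=> [|a u v b z uv _ IH]; first by rewrite mul0r; exact: ideal0.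
by rewrite mulrDl -(mulrA _ b c); apply: ideal_add.
Qed.

Lemma ideal_zmod_closed : zmod_closed ideal_pred.
Proof.
split=> [|x y /ideal_predP Ix /ideal_predP Iy]; apply/ideal_predP.
  exact: ideal0.
by apply: ideal_ofD => //; rewrite -mulN1r; apply: ideal_ofMl.
Qed.

HB.instance Definition _ := GRing.isZmodClosed.Build A ideal_pred
  ideal_zmod_closed.

Definition presented := {ideal_quot ideal_pred}.

HB.instance Definition _ := GRing.Zmodule.on presented.

Definition presented_pi (x : A) : presented := (\pi_presented x)%qT.

Lemma presented_eqP x y :
  reflect (presented_pi x = presented_pi y) (x - y \in ideal_pred).
Proof. by rewrite Quotient.idealrBE; apply: eqP. Qed.

Lemma presented_piK (u : presented) : presented_pi (repr u) = u.
Proof. exact: reprK. Qed.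

Lemma presented_piD : {morph presented_pi : x y / x + y}.
Proof. by move=> x y; rewrite /presented_pi !piE. Qed.

Lemma presented_piB : {morph presented_pi : x y / x - y}.
Proof. by move=> x y; rewrite /presented_pi !piE. Qed.

Definition presented_one : presented := presented_pi 1.
Definition presented_mul (u v : presented) : presented :=
  presented_pi (repr u * repr v).
Definition presented_scale (c : K) (u : presented) : presented :=
  presented_pi (c *: repr u).

Lemma presented_piM x y :
  presented_mul (presented_pi x) (presented_pi y) = presented_pi (x * y).
Proof.
set x' := repr (presented_pi x); set y' := repr (presented_pi y).
apply/presented_eqP.
have -> : x' * y' - x * y = (x' - x) * y' + x * (y' - y).
  by rewrite mulrBl mulrBr addrA subrK.
apply/ideal_predP/ideal_ofD.
  by apply/ideal_ofMr/ideal_predP/presented_eqP/presented_piK.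
by apply/ideal_ofMl/ideal_predP/presented_eqP/presented_piK.
Qed.

Lemma presented_piZ c x :
  presented_scale c (presented_pi x) = presented_pi (c *: x).
Proof.
apply/presented_eqP; rewrite -scalerBr -mulr_algl.
by apply/ideal_predP/ideal_ofMl/ideal_predP/presented_eqP/presented_piK.
Qed.

Lemma presented_mulA : associative presented_mul.
Proof.
move=> u v w; rewrite -[u]presented_piK -[v]presented_piK -[w]presented_piK.
by rewrite !presented_piM mulrA.
Qed.

Lemma presented_mul1l : left_id presented_one presented_mul.
Proof. by move=> u; rewrite -[u]presented_piK presented_piM mul1r. Qed.

Lemma presented_mul1r : right_id presented_one presented_mul.
Proof. by move=> u; rewrite -[u]presented_piK presented_piM mulr1. Qed.

Lemma presented_mulDl : left_distributive presented_mul +%R.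
Proof.
move=> u v w; rewrite -[u]presented_piK -[v]presented_piK -[w]presented_piK.
by rewrite -presented_piD !presented_piM mulrDl presented_piD.
Qed.

Lemma presented_mulDr : right_distributive presented_mul +%R.
Proof.
move=> u v w; rewrite -[u]presented_piK -[v]presented_piK -[w]presented_piK.
by rewrite -presented_piD !presented_piM mulrDr presented_piD.
Qed.

HB.instance Definition _ := GRing.Zmodule_isPzRing.Build presented
  presented_mulA presented_mul1l presented_mul1r
  presented_mulDl presented_mulDr.

Lemma presented_scaleA c d u :
  presented_scale c (presented_scale d u) = presented_scale (c * d) u.
Proof. by rewrite -[u]presented_piK !presented_piZ scalerA. Qed.

Lemma presented_scale1 : left_id 1 presented_scale.
Proof. by move=> u; rewrite -[u]presented_piK presented_piZ scale1r. Qed.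

Lemma presented_scaleDr : right_distributive presented_scale +%R.
Proof.
move=> c u v; rewrite -[u]presented_piK -[v]presented_piK.
by rewrite -presented_piD !presented_piZ scalerDr presented_piD.
Qed.

Lemma presented_scaleDl u : {morph presented_scale^~ u : c d / c + d}.
Proof.
move=> c d; rewrite -[u]presented_piK !presented_piZ.
by rewrite scalerDl presented_piD.
Qed.

HB.instance Definition _ := GRing.Zmodule_isLmodule.Build K presented
  presented_scaleA presented_scale1 presented_scaleDr presented_scaleDl.

Lemma presented_scaleAl (c : K) (u v : presented) : c *: (u * v) = c *: u * v.
Proof.
rewrite -[u]presented_piK -[v]presented_piK.
rewrite [_ * _ in LHS]presented_piM [LHS]presented_piZ scalerAl.
by rewrite -presented_piM -presented_piZ.
Qed.

End PresentedAlgebra.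

Section RootSystem.

Variables (R : realType) (V : vectType R).

(* Symmetry and positive definiteness are part of [{dot V for idfun}]. *)
Variable ip : {dot V for idfun}.

Definition coroot (a : V) : V := (2 / ip a a) *: a.

Definition reflection_fun (a x : V) : V := x - ip x (coroot a) *: a.

Lemma reflection_fun_linear a : linear (reflection_fun a).
Proof.
move=> c x y; rewrite /reflection_fun linearDl linearZl_LR /= scalerDl.
by rewrite scalerBr scalerA opprD addrACA.
Qed.

HB.instance Definition _ a := GRing.isLinear.Build R V V *:%R
  (reflection_fun a) (reflection_fun_linear a).

Definition reflection (a : V) : 'End(V) := linfun (reflection_fun a).

Lemma reflectionE a x : reflection a x = x - ip x (coroot a) *: a.
Proof. by rewrite lfunE. Qed.

Record is_root_system (roots : seq V) : Prop := IsRootSystem {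
  _ : 0 \notin roots;
  _ : <<roots>>%VS = fullv;
  _ : forall a b, a \in roots -> b \in roots -> reflection a b \in roots;
  _ : forall a b, a \in roots -> b \in roots -> ip b (coroot a) \is a Num.int;
  (* reducedness *)
  _ : forall a c, a \in roots -> c *: a \in roots -> c = 1 \/ c = -1
}.

Definition nonneg_comb n (simple : n.-tuple V) (a : V) : Prop :=
  exists m : 'I_n -> nat, a = \sum_i tnth simple i *+ m i.

Record is_base n (roots : seq V) (simple : n.-tuple V) : Prop := IsBase {
  _ : {subset simple <= roots};
  _ : basis_of fullv simple;
  _ : forall a, a \in roots -> nonneg_comb simple a \/ nonneg_comb simple (- a)
}.

End RootSystem.

(* No separate field states that the inner product is W-invariant: W is
   generated by reflections, which are orthogonal for [ip]. *)
Record root_datum (R : realType) (V : vectType R) (n : nat) := RootDatum {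
  ip : {dot V for idfun};
  roots : seq V;
  simple : n.-tuple V;
  fund : n.-tuple V;
  roots_is_root_system : is_root_system ip roots;
  simple_is_base : is_base roots simple;
  fund_dual : forall i j,
    ip (tnth fund i) (coroot ip (tnth simple j)) = (i == j)%:R
}.

Section AffineHecke.

Variables (R : realType) (V : vectType R) (n : nat) (D : root_datum V n).
Variable q : R[i].

Local Notation alpha := (tnth (simple D)).

Definition pos_root : set V :=
  [set a | a \in roots D /\ nonneg_comb (simple D) a].
Definition neg_root : set V := [set a | pos_root (- a)].

Inductive weyl : 'End(V) -> Prop :=
| weyl1 : weyl \1%VF
| weylM a w : a \in roots D -> weyl w -> weyl (reflection (ip D) a \o w)%VF.

Definition srefl (i : 'I_n) : 'End(V) := reflection (ip D) (alpha i).

Definition cox_order (i j : 'I_n) (m : nat) : Prop :=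
  [/\ (0 < m)%N, iter m (srefl i \o srefl j) =1 id &
    forall k, (0 < k < m)%N -> ~ iter k (srefl i \o srefl j) =1 id].

Definition weight_pred : {pred V} :=
  fun x => `[< inIntSpan (fund D) x >].

Lemma weight_zmod_closed : zmod_closed weight_pred.
Proof.
split=> [|x y /asboolP[a ->] /asboolP[b ->]]; apply/asboolP.
  by exists [ffun=> 0]; rewrite big1 // => i _; rewrite ffunE mulr0z.
exists [ffun i => a i - b i]; rewrite -sumrB; apply: eq_bigr => i _.
by rewrite ffunE mulrzBr.
Qed.

HB.instance Definition _ := GRing.isZmodClosed.Build V weight_pred
  weight_zmod_closed.

Record weight := Weight { weight_val :> V; _ : weight_val \in weight_pred }.

HB.instance Definition _ := [isSub for weight_val].
HB.instance Definition _ := [Choice of weight by <:].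
HB.instance Definition _ := [SubChoice_isSubZmodule of weight by <:].

(* The default value 0 is never met below: roots are integral combinations of
   the fundamental weights, and W preserves the weight lattice. *)
Definition to_weight (x : V) : weight := insubd 0 x.

Definition wact (w : 'End(V)) (l : weight) : weight := to_weight (w (val l)).

Definition simple_wt (i : 'I_n) : weight := to_weight (alpha i).

(* The group algebra C[X]: its elements are the finite formal combinations
   {malg R[i][weight]}, [<< l >>] standing for X^l.  The product has to be
   given here because the library multiplies {malg _[_]} only over monoids
   without nontrivial units. *)
Definition ga_mul (f g : {malg R[i][weight]}) : {malg R[i][weight]} :=
  \sum_(k <- msupp f) \sum_(l <- msupp g) << f@_k * g@_l *g k + l >>.

Definition hecke_gen : choiceType := ('I_n + weight)%type.

Definition free_hecke := {malg R[i][{fmonom hecke_gen}]}.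

Definition fT (i : 'I_n) : free_hecke := << fmu (inl i : hecke_gen) >>.
Definition fX (l : weight) : free_hecke := << fmu (inr l : hecke_gen) >>.

Definition braid_word (i j : 'I_n) (m : nat) : free_hecke :=
  \prod_(k < m) fT (if odd k then j else i).

(* In [rel_bernstein], [f] is the quotient
   (X^l - X^(s_i l)) / (1 - X^(- alpha_i)): as C[X] is a domain and
   1 - X^(- alpha_i) divides the numerator, there is exactly one such [f]. *)
Inductive hecke_rel : free_hecke -> free_hecke -> Prop :=
| rel_quadratic i :
    hecke_rel (fT i ^+ 2) ((q - q^-1) *: fT i + 1)
| rel_braid i j m : i != j -> cox_order i j m ->
    hecke_rel (braid_word i j m) (braid_word j i m)
| rel_X0 : hecke_rel (fX 0) 1
| rel_XD l k : hecke_rel (fX l * fX k) (fX (l + k))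
| rel_bernstein l i f :
    ga_mul f (<< 0 >> - << - simple_wt i >>) =
      << l >> - << wact (srefl i) l >> ->
    hecke_rel (fX l * fT i)
      (fT i * fX (wact (srefl i) l) +
       (q - q^-1) *: \sum_(k <- msupp f) f@_k *: fX k).

Definition hecke := presented hecke_rel.

HB.instance Definition _ := GRing.PzRing.on hecke.
HB.instance Definition _ := GRing.Lmodule.on hecke.

Definition hT (i : 'I_n) : hecke := presented_pi hecke_rel (fT i).
Definition hX (l : weight) : hecke := presented_pi hecke_rel (fX l).

Definition is_subalgebra (A : set hecke) : Prop :=
  [/\ A 1, forall a b, A a -> A b -> A (a + b),
      forall (c : R[i]) a, A a -> A (c *: a) &
      forall a b, A a -> A b -> A (a * b)].

Definition gen_subalgebra (S : set hecke) : set hecke :=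
  [set h | forall A, is_subalgebra A -> S `<=` A -> A h].

Definition rank2_subalgebra (i j : 'I_n) : set hecke :=
  gen_subalgebra ([set hT i; hT j] `|` range hX).

(* [act] makes [M] a module over the subalgebra [A]; the values of [act]
   outside [A] are irrelevant. *)
Definition is_module (A : set hecke) (M : lmodType R[i])
    (act : hecke -> M -> M) : Prop :=
  [/\ forall a, A a -> linear (act a),
      forall m, act 1 m = m,
      forall a b m, A a -> A b -> act (a + b) m = act a m + act b m,
      forall (c : R[i]) a m, A a -> act (c *: a) m = c *: act a m &
      forall a b m, A a -> A b -> act (a * b) m = act a (act b m)].

Definition irreducible (M : lmodType R[i]) (act : hecke -> M -> M) : Prop :=
  (exists m : M, m != 0) /\
  forall N : set M,
    N 0 -> (forall x y, N x -> N y -> N (x + y)) ->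
    (forall (c : R[i]) x, N x -> N (c *: x)) ->
    (forall h x, N x -> N (act h x)) ->
    N = [set 0] \/ N = setT.

(* T = Hom(X, C^* ); the character [t] is given by l |-> t(X^l). *)
Definition torus : set (weight -> R[i]) :=
  [set t | (forall l, t l != 0) /\ forall l k, t (l + k) = t l * t k].

Definition torus_act (w : 'End(V)) (t : weight -> R[i]) : weight -> R[i] :=
  fun l => t (wact (w^-1)%VF l).

Definition weight_space (M : lmodType R[i]) (act : hecke -> M -> M)
    (t : weight -> R[i]) : set M :=
  [set m | forall l, act (hX l) m = t l *: m].

Definition gen_weight_space (M : lmodType R[i]) (act : hecke -> M -> M)
    (t : weight -> R[i]) : set M :=
  [set m | forall l, exists2 k, (0 < k)%N &
    act ((hX l - t l *: (1 : hecke)) ^+ k) m = 0].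

Definition is_weight (M : lmodType R[i]) (act : hecke -> M -> M)
    (t : weight -> R[i]) : Prop :=
  exists2 m, weight_space act t m & m != 0.

Definition calibrated (M : lmodType R[i]) (act : hecke -> M -> M) : Prop :=
  forall t, torus t -> gen_weight_space act t = weight_space act t.

Definition calibratable (t : weight -> R[i]) : Prop :=
  forall i j, exists (M : vectType R[i]) (act : hecke -> M -> M),
    [/\ is_module (rank2_subalgebra i j) act, calibrated act &
        is_weight act t].

Definition inversions (w : 'End(V)) : set V :=
  [set a | pos_root a /\ neg_root (w a)].

Definition Zset (t : weight -> R[i]) : set V :=
  [set a | pos_root a /\ t (to_weight a) = 1].

Definition Pset (t : weight -> R[i]) : set V :=
  [set a | pos_root a /\
    (t (to_weight a) = q ^+ 2 \/ t (to_weight a) = q ^- 2)].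

Definition chambers (t : weight -> R[i]) (J : set V) : set 'End(V) :=
  [set w | [/\ weyl w, inversions w `&` Zset t = set0 &
               inversions w `&` Pset t = J]].

Definition local_region (t : weight -> R[i]) (J : set V) : Prop :=
  [/\ torus t, J `<=` Pset t & chambers t J !=set0].

Definition skew_region (t : weight -> R[i]) (J : set V) : Prop :=
  forall w, chambers t J w -> calibratable (torus_act w t).

(* The vector space with basis the symbols v_w, w ranging over the subtype of
   'End(V) attached to the set [chambers t J]. *)
Definition calib_space (t : weight -> R[i]) (J : set V) : lmodType R[i] :=
  {malg R[i][chambers t J]}.

Definition vsym (t : weight -> R[i]) (J : set V) (w : 'End(V)) :
    calib_space t J :=
  if insub w is Some x then << x >> else 0.

Definition Tcoef (t : weight -> R[i]) (w : 'End(V)) (i : 'I_n) : R[i] :=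
  (q - q^-1) / (1 - torus_act w t (- simple_wt i)).

End AffineHecke.

(* Main.v *)
(* Every relation except the braid relation is checked directly on the v_w.
   For the braid relation of T_i and T_j on v_w, let M be a calibrated module
   over the rank two subalgebra with a vector y of weight wt.  It satisfies
   (wt)(X^alpha_i) <> 1, since otherwise X would act on y and T_i y by a
   nontrivial Jordan block.  Hence the intertwiners T_i - (T_i)_ww are defined
   along both alternating walks that lead from w once around the rank two Weyl
   group, and, suitably normalized, they carry y to vectors of M on which T_i
   and T_j act by the formulas for the v's as long as the walk stays in the
   local region.  The weights met on the way are distinct by Steinberg's theorem
   on stabilizers, so the braid relation in M forces an identity of coefficients
   which gives the braid relation on v_w.

   For irreducibility, the weights wt with w in F^(t,J) are distinct, again by
   Steinberg's theorem, so a nonzero submodule contains some v_w; the chambers of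
   a local region are connected through simple reflections, and the coefficient
   of v_(s_i w) in T_i v_w is nonzero whenever s_i w belongs to the region. *)

Require Import Defs.
From HB Require Import structures.
From mathcomp Require Import all_boot all_order all_algebra.
From mathcomp Require Import boolp classical_sets reals.
From mathcomp Require Import complex.
From mathcomp Require Import sesquilinear sequences exp trigo ring lra zify.
From mathcomp Require Import finmap monalg.

Set Implicit Arguments.
Unset Strict Implicit.
Unset Printing Implicit Defensive.

Import Order.TTheory GRing.Theory Num.Theory.

Local Open Scope classical_set_scope.
Local Open Scope ring_scope.

(** * Weyl group and weights *)

(** The obstacle in the braid relation is that no natural map connects M with the space of the v_w.
    Beyond a wall the intertwiners may still give nonzero vectors of M where the v's are 0, and in M
    the ends of the two walks are not known to agree. Both spaces are therefore compared with a
    third one, freely spanned by the nodes of the two walks, whose formal T_i, T_j map equivariantly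
    to either side. A relation that holds in M can be pulled back only node by node, through
    distinct weights. This fails exactly for the two end nodes, which carry the same weight; there a
    symmetry helps: the two walks meet the same values of t in opposite orders, so the end nodes get
    equal coefficients. Distinctness of weights rests on working with the full weight lattice: s
    omega = omega - alpha for a fundamental weight, so a character fixed by s is 1 on alpha. In rank
    two this becomes a finite computation, one case per Cartan pair and rotation, valid over every
    field. For W it becomes a statement on real points, reached by a logarithm of t. The condition
    q^2 <> 1 is what makes the Jordan block nontrivial. *)

Section InnerProduct.

Variables (R : realType) (V : vectType R) (f : {dot V for idfun}).

Lemma ipC x y : f x y = f y x.
Proof. by rewrite hermC expr0 mul1r. Qed.

Lemma ipDl x y z : f (x + y) z = f x z + f y z.
Proof. by rewrite linearDl. Qed.

Lemma ipDr x y z : f z (x + y) = f z x + f z y.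
Proof. by rewrite ipC ipDl !(ipC _ z). Qed.

Lemma ipZl c x y : f (c *: x) y = c * f x y.
Proof. by rewrite linearZl_LR. Qed.

Lemma ipZr c x y : f x (c *: y) = c * f x y.
Proof. by rewrite ipC ipZl (ipC x). Qed.

Lemma ipNl x y : f (- x) y = - f x y.
Proof. by rewrite -scaleN1r ipZl mulN1r. Qed.

Lemma ipNr x y : f x (- y) = - f x y.
Proof. by rewrite ipC ipNl (ipC x). Qed.

Lemma ipBl x y z : f (x - y) z = f x z - f y z.
Proof. by rewrite ipDl ipNl. Qed.

Lemma ipBr x y z : f z (x - y) = f z x - f z y.
Proof. by rewrite ipDr ipNr. Qed.

Lemma ip0l x : f 0 x = 0.
Proof. by rewrite -(scale0r x) ipZl mul0r. Qed.

Lemma ip0r x : f x 0 = 0.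
Proof. by rewrite ipC ip0l. Qed.

Lemma ip_suml I (r : seq I) (P : pred I) (F : I -> V) y :
  f (\sum_(i <- r | P i) F i) y = \sum_(i <- r | P i) f (F i) y.
Proof. by elim/big_rec2: _ => [|i a b _ <-]; rewrite ?ip0l ?ipDl. Qed.

Lemma ip_sumr I (r : seq I) (P : pred I) (F : I -> V) y :
  f y (\sum_(i <- r | P i) F i) = \sum_(i <- r | P i) f y (F i).
Proof. by rewrite ipC ip_suml; apply: eq_bigr => i _; rewrite ipC. Qed.

Lemma ip_gt0 x : x != 0 -> 0 < f x x.
Proof. exact: neq0_dnorm_gt0. Qed.

Lemma ip_ge0 x : 0 <= f x x.
Proof. by have [->|/ip_gt0/ltW//] := eqVneq x 0; rewrite ip0l. Qed.

Lemma ip_eq0 x : (f x x == 0) = (x == 0).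
Proof.
have [->|x0] := eqVneq x 0; first by rewrite ip0l eqxx.
by rewrite gt_eqF ?ip_gt0.
Qed.

Lemma ip_coroot x a : f x (coroot f a) = 2 / f a a * f x a.
Proof. by rewrite /coroot ipZr. Qed.

Lemma ip_coroot_self a : a != 0 -> f a (coroot f a) = 2.
Proof. by move=> a0; rewrite ip_coroot divfK ?gt_eqF ?ip_gt0. Qed.

Lemma corootN a : coroot f (- a) = - coroot f a.
Proof. by rewrite /coroot ipNl ipNr opprK scalerN. Qed.

Lemma reflectionN a : reflection f (- a) = reflection f a.
Proof.
by apply/lfunP => x; rewrite !reflectionE corootN ipNr scalerN scaleNr opprK.
Qed.

Lemma reflectionK a : a != 0 -> involutive (reflection f a).
Proof.
move=> a0 x; rewrite reflectionE reflectionE ipBl ipZl ip_coroot_self //.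
set k := f x _; have -> : k - k * 2 = - k by ring.
by rewrite scaleNr opprK subrK.
Qed.

Lemma reflection_self a : a != 0 -> reflection f a a = - a.
Proof.
move=> a0; rewrite reflectionE ip_coroot_self // -[X in X - _]scale1r -scalerBl.
by rewrite opprD addrA subrr add0r scaleN1r.
Qed.

Lemma ip_reflection a x y : a != 0 ->
  f (reflection f a x) y = f x (reflection f a y).
Proof.
move=> a0; rewrite !reflectionE ipBl ipBr !ip_coroot ipZl ipZr (ipC y a).
by congr (_ - _); ring.
Qed.

Lemma reflection_isometry a x y : a != 0 ->
  f (reflection f a x) (reflection f a y) = f x y.
Proof. by move=> a0; rewrite ip_reflection // reflectionK. Qed.

Lemma coroot_isometry (g : 'End(V)) a :
  (forall x y, f (g x) (g y) = f x y) -> coroot f (g a) = g (coroot f a).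
Proof. by move=> gi; rewrite /coroot gi linearZ /=. Qed.

Lemma reflection_conj (g : 'End(V)) a :
  (forall x y, f (g x) (g y) = f x y) ->
  (reflection f (g a) \o g = g \o reflection f a)%VF.
Proof.
move=> gi; apply/lfunP => x; rewrite !comp_lfunE !reflectionE.
rewrite coroot_isometry // gi [RHS]linearB /=; congr (_ - _).
by rewrite [RHS]linearZ.
Qed.

Lemma cauchy_schwarz_lt x y : (forall c, x - c *: y != 0) -> y != 0 ->
  f x y * f x y < f x x * f y y.
Proof.
move=> indep y0; have yy := ip_gt0 y0.
have := ip_gt0 (indep (f x y / f y y)).
rewrite ipBl !ipBr !ipZl !ipZr (ipC y x).
set u := f x y; set v := f x x; set w := f y y in yy *.
have -> : v - u / w * u - (u / w * u - u / w * (u / w * w)) = (v * w - u * u) / w.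
  by field; rewrite gt_eqF.
by rewrite pmulr_lgt0 ?invr_gt0 // subr_gt0.
Qed.

End InnerProduct.

Section RootData.

Variables (R : realType) (V : vectType R) (n : nat) (D : root_datum V n).

Local Notation f := (ip D).
Local Notation rts := (Defs.roots D).
Local Notation alpha := (tnth (simple D)).
Local Notation omega := (tnth (fund D)).
Local Notation rf := (reflection (ip D)).
Local Notation sr := (srefl D).
Local Notation cor := (coroot (ip D)).

Lemma root_neq0 a : a \in rts -> a != 0.
Proof.
by case: (roots_is_root_system D) => r0 _ _ _ _; apply: contraTneq => ->.
Qed.

Lemma root_refl a b : a \in rts -> b \in rts -> rf a b \in rts.
Proof. by case: (roots_is_root_system D) => _ _ + _ _; apply. Qed.

Lemma root_opp a : a \in rts -> - a \in rts.
Proof.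
by move=> ra; rewrite -(reflection_self f (root_neq0 ra)) root_refl.
Qed.

Lemma root_cartan_int a b : a \in rts -> b \in rts ->
  f b (cor a) \is a Num.int.
Proof. by case: (roots_is_root_system D) => _ _ _ + _; apply. Qed.

Lemma root_reduced a c : a \in rts -> c *: a \in rts -> c = 1 \/ c = -1.
Proof. by case: (roots_is_root_system D) => _ _ _ _; apply. Qed.

Lemma simple_root i : alpha i \in rts.
Proof.
by case: (simple_is_base D) => s _ _; apply: s; rewrite mem_tnth.
Qed.

Lemma simple_neq0 i : alpha i != 0. Proof. exact/root_neq0/simple_root. Qed.

Lemma span_simple : <<simple D>>%VS = fullv.
Proof. by case: (simple_is_base D) => _ b _; exact: span_basis. Qed.

Lemma ip_fund i j : f (omega i) (alpha j) = f (alpha j) (alpha j) / 2 * (i == j)%:R.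
Proof.
rewrite -(fund_dual D) ip_coroot; have := ip_gt0 f (simple_neq0 j).
by move=> h; field; rewrite gt_eqF.
Qed.

Lemma eq_ip_simple x y : (forall i, f x (alpha i) = f y (alpha i)) -> x = y.
Proof.
move=> h; apply/eqP; rewrite -subr_eq0 -(ip_eq0 f); apply/eqP.
set z := x - y; have hz i : f z (alpha i) = 0 by rewrite ipBl h subrr.
have : z \in <<simple D>>%VS by rewrite span_simple memvf.
move=> /coord_span zE; rewrite [X in f _ X]zE ip_sumr big1 // => i _.
by rewrite ipZr -tnth_nth hz mulr0.
Qed.

Lemma fund_expansion x : x = \sum_i f x (cor (alpha i)) *: omega i.
Proof.
apply: eq_ip_simple => j; rewrite ip_suml (bigD1 j) //= big1.
  rewrite ip_coroot ipZl ip_fund eqxx mulr1 addr0.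
  have := ip_gt0 f (simple_neq0 j).
  by move=> h; field; rewrite gt_eqF.
by move=> i ij; rewrite ipZl ip_fund (negPf ij) !mulr0.
Qed.

Lemma eq_ip_fund x y : (forall i, f x (omega i) = f y (omega i)) -> x = y.
Proof.
move=> h; apply/eqP; rewrite -subr_eq0 -(ip_eq0 f); apply/eqP.
set z := x - y; have hz i : f z (omega i) = 0 by rewrite ipBl h subrr.
rewrite [X in f _ X](fund_expansion z) ip_sumr big1 // => i _.
by rewrite ipZr hz mulr0.
Qed.

Lemma coroot_expansion x : x = \sum_i f (omega i) x *: cor (alpha i).
Proof.
apply: eq_ip_fund => j; rewrite ip_suml (bigD1 j) //= big1.
  by rewrite ipZl (ipC f (cor _)) fund_dual eqxx mulr1 addr0 ipC.
by move=> i ij; rewrite ipZl (ipC f (cor _)) fund_dual eq_sym (negPf ij) mulr0.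
Qed.

Definition rho : V := \sum_i omega i.

Lemma ip_rho_simple i : 0 < f rho (alpha i).
Proof.
rewrite /rho ip_suml (bigD1 i) //= big1; last first.
  by move=> j ji; rewrite ip_fund (negPf ji) mulr0.
by rewrite addr0 ip_fund eqxx mulr1 divr_gt0 ?ip_gt0 ?simple_neq0.
Qed.

(** [rho] pairs positively with every simple root, so a nonnegative combination pairs to 0 with it
    only if it is 0. From here on the sign of [f rho a] stands for the sign of the root. *)
Lemma pos_rootE a : pos_root D a <-> a \in rts /\ 0 < f rho a.
Proof.
have nc x : nonneg_comb (simple D) x -> 0 <= f rho x ?= iff (x == 0).
  case=> m ->; split.
    by rewrite ip_sumr sumr_ge0 // => i _; rewrite -scaler_nat ipZr mulr_ge0 //
      ltW // ip_rho_simple.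
  apply/eqP/eqP => [|->]; last by rewrite ip0r.
  rewrite ip_sumr => /esym/eqP.
  rewrite psumr_eq0 => [/allP h|i _]; last first.
    by rewrite -scaler_nat ipZr mulr_ge0 // ltW // ip_rho_simple.
  apply: big1 => i _; have := h i; rewrite mem_index_enum => /(_ isT).
  rewrite /= -scaler_nat ipZr mulf_eq0 (gt_eqF (ip_rho_simple i)) orbF.
  by move=> /eqP ->; rewrite scale0r.
split=> [[ra /nc[h e]]|[ra h]].
  by split=> //; rewrite lt_neqAle h e root_neq0.
split=> //; case: (simple_is_base D) => _ _ /(_ _ ra)[//|/nc[+ _]].
by rewrite ipNr oppr_ge0 leNgt h.
Qed.

Lemma pos_simple i : 0 < f rho (alpha i).
Proof. exact: ip_rho_simple. Qed.

Lemma root_sign a : a \in rts -> f rho a != 0.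
Proof.
move=> ra; case: (simple_is_base D) => _ _ /(_ _ ra) h.
have [h'|h'] : pos_root D a \/ pos_root D (- a).
- by case: h; [left|right] => //; split=> //; exact: root_opp.
- by move/pos_rootE: h' => [_ /gt_eqF ->].
- by move/pos_rootE: h' => [_]; rewrite ipNr oppr_gt0 => /lt_eqF ->.
Qed.

Lemma neg_rootE a : neg_root D a <-> a \in rts /\ f rho a < 0.
Proof.
rewrite /neg_root /= pos_rootE ipNr oppr_gt0; split=> -[ra ?]; split=> //.
  by rewrite -(opprK a) root_opp.
exact: root_opp.
Qed.

Lemma pos_root_fund a i : a \in rts -> 0 < f rho a -> 0 <= f (omega i) a.
Proof.
move=> ra pa; have /pos_rootE : a \in rts /\ 0 < f rho a by [].
case=> _ [m ->]; rewrite ip_sumr sumr_ge0 // => j _.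
by rewrite -scaler_nat ipZr ip_fund !mulr_ge0 // ?invr_ge0 // ip_ge0.
Qed.

Lemma root_fund_pos a i : a \in rts -> 0 < f (omega i) a -> 0 < f rho a.
Proof.
move=> ra h; rewrite lt_neqAle eq_sym root_sign //= leNgt; apply/negP => ha.
have := @pos_root_fund (- a) i (root_opp ra); rewrite !ipNr oppr_gt0 oppr_ge0.
by move=> /(_ ha); rewrite leNgt h.
Qed.

(** Reducedness forces a to involve some simple root other than alpha_i. The reflection keeps that
    coefficient, and one positive coefficient decides the sign of a root. *)
Lemma srefl_pos i a : a \in rts -> 0 < f rho a -> a != alpha i ->
  0 < f rho (sr i a).
Proof.
move=> ra pa ai; have sra : sr i a \in rts by rewrite root_refl ?simple_root.
have [j ji fa] : exists2 j, j != i & 0 < f (omega j) a.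
  case: (pselect (exists2 j, j != i & 0 < f (omega j) a)) => // h; exfalso.
  have aE : a = \sum_j f (omega j) a *: cor (alpha j) := coroot_expansion a.
  have h0 j : j != i -> f (omega j) a = 0.
    move=> ji; apply/eqP; rewrite eq_le pos_root_fund // andbT leNgt.
    by apply/negP => hj; apply: h; exists j.
  rewrite (bigD1 i) //= big1 ?addr0 in aE; last by move=> j /h0 ->; rewrite scale0r.
  rewrite scalerA in aE; set c := _ * _ in aE.
  have [c1|cN] : c = 1 \/ c = -1.
    by apply: (@root_reduced (alpha i)); rewrite ?simple_root // -aE.
    by rewrite aE c1 scale1r eqxx in ai.
  rewrite aE cN scaleN1r ipNr oppr_gt0 in pa.
  by have := lt_trans pa (pos_simple i); rewrite ltxx.
apply: (@root_fund_pos _ j) => //.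
by rewrite reflectionE ipBr ipZr ip_fund (negPf ji) !mulr0 subr0.
Qed.

Lemma sreflK i : involutive (sr i).
Proof. exact/reflectionK/simple_neq0. Qed.

Lemma sreflE i x : sr i x = x - f x (cor (alpha i)) *: alpha i.
Proof. exact: reflectionE. Qed.

(** The sum of the coefficients in the simple roots: the factors turn the fundamental weights into
    the basis dual to the simple roots. *)
Definition height x : R := f (\sum_j (2 / f (alpha j) (alpha j)) *: omega j) x.

Lemma height_simple i : height (alpha i) = 1.
Proof.
rewrite /height ip_suml (bigD1 i) //= big1; last first.
  by move=> j ji; rewrite ipZl ip_fund (negPf ji) !mulr0.
rewrite ipZl ip_fund eqxx mulr1 addr0; have := ip_gt0 f (simple_neq0 i).
by move=> h; field; rewrite gt_eqF.
Qed.

(** Induction on height. Since <a,a> > 0 and a has nonnegative coefficients, a pairs positively with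
    some simple coroot, and reflecting there lowers the height by a positive integer. *)
Lemma pos_root_ind (P : V -> Prop) :
    (forall i, P (alpha i)) ->
    (forall i a, a \in rts -> 0 < f rho a -> 0 < f rho (sr i a) ->
       P (sr i a) -> P a) ->
  forall a, a \in rts -> 0 < f rho a -> P a.
Proof.
move=> Ps Pi a ra pa.
have [N hN] : exists N : nat, height a < N%:R.
  exists (Num.bound `|height a|); apply: le_lt_trans (ler_norm _) _.
  exact: archi_boundP.
elim: N => [|N IHN] in a ra pa hN *.
  exfalso; move: hN; apply/negP; rewrite -leNgt /height ip_suml sumr_ge0 // => i _.
  by rewrite ipZl mulr_ge0 ?pos_root_fund // divr_ge0 ?ip_ge0.
have [[i ->]//|ns] := pselect (exists i, a = alpha i).
have [i ai] : exists i, 0 < f a (cor (alpha i)).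
  case: (pselect (exists i, 0 < f a (cor (alpha i)))) => // h; exfalso.
  suff : f a a <= 0 by rewrite leNgt ip_gt0 // root_neq0.
  rewrite [X in f _ X](coroot_expansion a) ip_sumr sumr_le0 // => i _.
  rewrite ipZr mulr_ge0_le0 ?pos_root_fund // leNgt.
  by apply/negP => hi; apply: h; exists i.
have psa : 0 < f rho (sr i a).
  by apply: srefl_pos => //; apply/eqP => aE; apply: ns; exists i.
apply: (Pi i) => //; apply: IHN => //; first by rewrite root_refl ?simple_root.
rewrite sreflE /height ipBr ipZr -/(height _) -/(height _) height_simple mulr1.
have : 1 <= f a (cor (alpha i)).
  have /intrP[m mE] := root_cartan_int (simple_root i) ra.
  by rewrite mE ler1z -gtz0_ge1 -(ltr0z R) -mE.
by move: hN; rewrite -natr1; lra.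
Qed.

Lemma weyl_root w a : weyl D w -> a \in rts -> w a \in rts.
Proof.
move=> W ra; elim: W => [|b u rb _ IH]; first by rewrite id_lfunE.
by rewrite comp_lfunE root_refl.
Qed.

Lemma weyl_isometry w x y : weyl D w -> f (w x) (w y) = f x y.
Proof.
elim=> [|b u rb _ IH]; first by rewrite !id_lfunE.
by rewrite !comp_lfunE reflection_isometry ?root_neq0.
Qed.

Lemma weyl_comp u w : weyl D u -> weyl D w -> weyl D (u \o w)%VF.
Proof.
move=> Wu Ww; elim: Wu => [|b v rb _ IH]; first by rewrite comp_lfun1l.
by rewrite -comp_lfunA; constructor.
Qed.

Lemma weyl_refl a : a \in rts -> weyl D (rf a).
Proof. by move=> ra; rewrite -[rf a]comp_lfun1r; constructor=> //; constructor. Qed.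

Lemma weyl_srefl i : weyl D (sr i).
Proof. exact/weyl_refl/simple_root. Qed.

Lemma weyl_lker0 w : weyl D w -> lker w == 0%VS.
Proof.
move=> W; apply/lker0P => x y wxy; apply/eqP; rewrite -subr_eq0 -(ip_eq0 f).
by rewrite -(weyl_isometry _ _ W) [w _]linearB /= wxy subrr ip0l.
Qed.

Lemma weylK w : weyl D w -> cancel w (w^-1)%VF.
Proof. by move=> /weyl_lker0; exact: lker0_lfunK. Qed.

Lemma weylVK w : weyl D w -> cancel (w^-1)%VF w.
Proof. by move=> /weyl_lker0; exact: lker0_lfunVK. Qed.

Lemma weyl_invE w (u : 'End(V)) : weyl D w -> cancel w u -> (w^-1)%VF = u.
Proof. by move=> W wu; apply/lfunP => x; rewrite -{2}(weylVK W x) wu. Qed.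

Lemma weylV w : weyl D w -> weyl D (w^-1)%VF.
Proof.
elim=> [|b u rb Wu IH].
  rewrite (@weyl_invE \1%VF \1%VF); [constructor|constructor|].
  by move=> x; rewrite !id_lfunE.
rewrite (@weyl_invE _ (u^-1 \o rf b)%VF).
- by apply: weyl_comp => //; exact: weyl_refl.
- by constructor.
- by move=> x; rewrite !comp_lfunE reflectionK ?root_neq0 // weylK.
Qed.

Definition sword (s : seq 'I_n) : 'End(V) :=
  foldr (fun i g => (sr i \o g)%VF) \1%VF s.

Lemma sword_cat s1 s2 : sword (s1 ++ s2) = (sword s1 \o sword s2)%VF.
Proof.
by elim: s1 => [|i s1 IH] /=; rewrite ?comp_lfun1l // IH comp_lfunA.
Qed.

Lemma weyl_sword s : weyl D (sword s).
Proof.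
elim: s => [|i s IH] /=; first by constructor.
by apply: weyl_comp => //; exact: weyl_srefl.
Qed.

Lemma refl_sword a : a \in rts -> exists s, rf a = sword s.
Proof.
have base b : b \in rts -> 0 < f rho b -> exists s, rf b = sword s.
  move: b; apply: pos_root_ind => [i|i b rb pb _ [s sE]].
    by exists [:: i]; rewrite /= comp_lfun1r.
  exists (i :: s ++ [:: i]); rewrite /= sword_cat -sE /= comp_lfun1r.
  apply/lfunP => x; rewrite !comp_lfunE.
  have := reflection_conj b (fun x y => weyl_isometry x y (weyl_srefl i)).
  move=> /(congr1 (fun g : 'End(V) => g x)); rewrite !comp_lfunE => e.
  by rewrite e sreflK.
move=> ra; have [pa|na] := ltP 0 (f rho a); first exact: base.
rewrite -reflectionN; apply: base; first exact: root_opp.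
by rewrite ipNr oppr_gt0 lt_neqAle root_sign.
Qed.

Lemma weyl_swordP w : weyl D w -> exists s, w = sword s.
Proof.
elim=> [|a u /refl_sword[s ->] _ [s' ->]]; first by exists [::].
by exists (s ++ s'); rewrite sword_cat.
Qed.

(** The root changes sign at some letter j of the word, and by [srefl_pos] the only positive root
    that s_j makes negative is alpha_j. *)
Lemma sword_deletion s a : a \in rts -> 0 < f rho a ->
  f rho (sword s a) < 0 ->
  exists s1 j s2, s = s1 ++ j :: s2 /\ sword s2 a = alpha j.
Proof.
move=> ra pa; elim: s => [|j s IH] /=.
  by rewrite id_lfunE => /(lt_trans pa); rewrite ltxx.
rewrite comp_lfunE => neg.
have rsa : sword s a \in rts := weyl_root (weyl_sword s) ra.
have [psa|] := ltP 0 (f rho (sword s a)); last first.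
  rewrite le_eqVlt (negPf (root_sign rsa)) /= => /IH[s1 [k [s2 [-> e]]]].
  by exists (j :: s1), k, s2.
exists [::], j, s; split=> //; apply/eqP; apply: contraTT neg => ne.
by rewrite -leNgt ltW // srefl_pos.
Qed.

(** If the word ends in i, the rest of it makes alpha_i negative. Deletion then gives s2 alpha_i =
    alpha_j, hence s2 s_i = s_j s2, and the word loses both its last letter and an inner one. *)
Lemma weyl_pos_id w : weyl D w -> (forall i, 0 < f rho (w (alpha i))) ->
  w = \1%VF.
Proof.
move=> /weyl_swordP[s ->].
have [N] := ubnP (size s); elim: N => // N IHN in s *.
case/lastP: s => // s i; rewrite size_rcons ltnS => sN pos.
have srE : sword (rcons s i) = (sword s \o sr i)%VF.
  by rewrite -cats1 sword_cat /= comp_lfun1r.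
have := pos i; rewrite srE comp_lfunE reflection_self ?simple_neq0 //.
rewrite linearN ipNr oppr_gt0.
move=> /(sword_deletion (simple_root i) (pos_simple i)).
move=> [s1 [j [s2 [sE aj]]]].
have := reflection_conj (alpha i) (fun x y => weyl_isometry x y (weyl_sword s2)).
rewrite aj => conj.
have wE : (sword s \o sr i)%VF = sword (s1 ++ s2).
  rewrite sE !sword_cat /= /srefl conj.
  by apply/lfunP => x; rewrite !comp_lfunE reflectionK ?simple_neq0.
rewrite wE; apply: IHN.
  by move: sN; rewrite sE !size_cat /= addnS => /ltnW.
by move=> k; rewrite -wE -srE.
Qed.

Definition npos (phi : pred V) : nat :=
  count (fun a => (0 < f rho a) && phi a) (undup rts).

(** s_i injects the positive roots counted on the left into those counted on the right and misses
    alpha_i. This is the descent behind [weyl_dominant] and [chamber_connected]. *)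
Lemma npos_srefl (phi : pred V) i :
    (forall a, a \in rts -> phi (- a) = ~~ phi a) -> phi (alpha i) ->
  (npos (phi \o sr i) < npos phi)%N.
Proof.
move=> phiN phia; rewrite /npos -!size_filter.
set A := filter _ _; set B := filter _ _.
rewrite -(size_map (sr i)).
have uA : uniq (alpha i :: map (sr i) A).
  rewrite /= (map_inj_uniq (inv_inj (@sreflK i))) filter_uniq ?undup_uniq // andbT.
  apply/mapP => -[b]; rewrite mem_filter => /andP[/andP[pb _] _] /(congr1 (sr i)).
  rewrite sreflK reflection_self ?simple_neq0 // => bE.
  by move: pb; rewrite -bE ipNr oppr_gt0 ltNge ltW ?pos_simple.
apply: (uniq_leq_size uA) => b; rewrite inE => /orP[/eqP->|/mapP[c]].
  by rewrite mem_filter pos_simple phia mem_undup simple_root.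
rewrite !mem_filter mem_undup /= => /andP[/andP[pc phic] rc] ->.
rewrite mem_undup in rc; rewrite phic root_refl ?simple_root // !andbT srefl_pos //.
apply: contraTneq phic => ->; rewrite reflection_self ?simple_neq0 //.
by rewrite phiN ?simple_root // phia.
Qed.

Lemma weyl_dominant x : (forall a, a \in rts -> f x a != 0) ->
  exists2 w, weyl D w & forall i, 0 < f (w x) (alpha i).
Proof.
have [N] := ubnP (npos (fun a => f x a < 0)); elim: N => // N IHN in x *.
rewrite ltnS => xN reg.
have [h|/existsNP[i hi]] := pselect (forall i, 0 < f x (alpha i)).
  by exists \1%VF; [constructor|move=> i; rewrite id_lfunE].
have ai : f x (alpha i) < 0.
  by rewrite lt_neqAle reg ?simple_root //= leNgt; apply/negP.
have [] := IHN (sr i x).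
- apply: leq_trans xN; have -> : npos (fun a => f (sr i x) a < 0) =
      npos ((fun a => f x a < 0) \o sr i).
    by apply: eq_count => a; rewrite /= ip_reflection ?simple_neq0.
  apply: npos_srefl => // a ra; rewrite ipNr oppr_lt0.
  by rewrite -leNgt le_eqVlt eq_sym (negPf (reg _ ra)).
- by move=> a ra; rewrite ip_reflection ?simple_neq0 // reg // root_refl ?simple_root.
move=> w Ww pos; exists (w \o sr i)%VF.
  by apply: weyl_comp => //; exact: weyl_srefl.
by move=> j; rewrite comp_lfunE.
Qed.

Lemma ip_gt0_dominant x a : (forall i, 0 < f x (alpha i)) -> a \in rts ->
  (0 < f x a) = (0 < f rho a).
Proof.
move=> dom ra.
have pos b : b \in rts -> 0 < f rho b -> 0 < f x b.
  move=> rb pb; have [_ [m bE]] : pos_root D b by apply/pos_rootE.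
  have : 0 <= f x b.
    rewrite bE ip_sumr sumr_ge0 // => i _; rewrite -scaler_nat ipZr.
    by rewrite mulr_ge0 // ltW.
  rewrite le_eqVlt => /orP[|//]; rewrite {1}bE ip_sumr eq_sym.
  rewrite psumr_eq0 => [/allP h|i _]; last by
    rewrite -scaler_nat ipZr mulr_ge0 // ltW.
  suff b0 : b = 0 by rewrite b0 ip0r ltxx in pb.
  rewrite bE big1 // => i _; have := h i; rewrite mem_index_enum => /(_ isT).
  rewrite /= -scaler_nat ipZr mulf_eq0 (gt_eqF (dom i)) orbF.
  by move=> /eqP ->; rewrite scale0r.
apply/idP/idP => [xa|]; last exact: pos.
rewrite lt_neqAle eq_sym root_sign //= leNgt; apply/negP => na.
have := pos _ (root_opp ra); rewrite !ipNr !oppr_gt0 => /(_ na).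
by rewrite ltNge ltW.
Qed.

(** Conjugation by an element that makes x dominant turns the positive system of x into the standard
    one, where [weyl_pos_id] applies. *)
Lemma weyl_fix_regular w x : weyl D w ->
    (forall a, a \in rts -> f x a != 0) ->
    (forall a, a \in rts -> 0 < f x a -> 0 < f x (w a)) ->
  w = \1%VF.
Proof.
move=> Ww reg wpos; have [v Wv dom] := weyl_dominant reg.
have WV := weylV Wv.
have fv a : f (v x) (v a) = f x a := weyl_isometry x a Wv.
suff e : (v \o w \o v^-1)%VF = \1%VF.
  apply/lfunP => y; rewrite id_lfunE.
  have := congr1 (fun g : 'End(V) => g (v y)) e.
  by rewrite !comp_lfunE id_lfunE weylK // => /(can_inj (weylK Wv)).
apply: weyl_pos_id => [|i]; first by do 2![apply: weyl_comp => //].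
rewrite -(ip_gt0_dominant dom); last first.
  by apply: weyl_root; [do 2![apply: weyl_comp => //]|exact: simple_root].
rewrite !comp_lfunE fv; apply: wpos; first exact/weyl_root/simple_root.
by rewrite -fv weylVK.
Qed.

Lemma weightP x : reflect (forall i, f x (cor (alpha i)) \is a Num.int)
  (x \in weight_pred D).
Proof.
apply: (iffP (asboolP _)) => [[a ->] i|h].
  rewrite ip_suml rpred_sum // => j _.
  rewrite -tnth_nth -scaler_int ipZl fund_dual rpredM ?intr_int //.
  by case: (j == i); rewrite ?rpred1 ?rpred0.
exists [ffun i => Num.floor (f x (cor (alpha i)))].
rewrite [LHS]fund_expansion; apply: eq_bigr => i _.
by rewrite ffunE -scaler_int floorK // -tnth_nth.
Qed.

Lemma root_weight a : a \in rts -> a \in weight_pred D.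
Proof.
by move=> ra; apply/weightP => i; rewrite root_cartan_int ?simple_root.
Qed.

Lemma fund_weight i : omega i \in weight_pred D.
Proof. by apply/weightP => j; rewrite fund_dual; case: eqP. Qed.

Lemma weight_srefl i x : x \in weight_pred D -> sr i x \in weight_pred D.
Proof.
move=> xP; rewrite sreflE rpredB //.
have /intrP[m ->] := weightP _ xP i.
by rewrite scaler_int rpredMz // root_weight ?simple_root.
Qed.

Lemma weight_weyl w x : weyl D w -> x \in weight_pred D -> w x \in weight_pred D.
Proof.
move=> /weyl_swordP[s ->] xP; elim: s => [|i s IH] /=; first by rewrite id_lfunE.
by rewrite comp_lfunE weight_srefl.
Qed.

Lemma weight_coroot_int x a : x \in weight_pred D -> a \in rts ->
  f x (cor a) \is a Num.int.
Proof.
have base b : b \in rts -> 0 < f rho b ->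
    forall x, x \in weight_pred D -> f x (cor b) \is a Num.int.
  move: b; apply: pos_root_ind => [i y yP|i b rb pb _ IH y yP].
    exact: weightP.
  have := IH _ (weight_srefl i yP); rewrite coroot_isometry.
    by rewrite (weyl_isometry _ _ (weyl_srefl i)).
  by move=> u v; rewrite (weyl_isometry _ _ (weyl_srefl i)).
move=> xP ra; have [pa|na] := ltP 0 (f rho a); first exact: base.
rewrite -[a]opprK corootN ipNr rpredN; apply: base => //; first exact: root_opp.
by rewrite ipNr oppr_gt0 lt_neqAle root_sign.
Qed.

(** s_j alpha_i is a positive root, and its coefficient at alpha_j is minus this Cartan integer. *)
Lemma cartan_le0 i j : i != j -> f (alpha i) (cor (alpha j)) <= 0.
Proof.
move=> ij; have := @pos_root_fund (sr j (alpha i)) j.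
rewrite root_refl ?simple_root // srefl_pos ?pos_simple ?simple_root //; last first.
  apply: contraNneq ij => e; have := ip_fund i i; rewrite e ip_fund eqxx.
  by case: eqP => // _; rewrite mulr1 mulr0 => /esym/eqP; rewrite mulf_eq0
    gt_eqF ?ip_gt0 ?simple_neq0 //= invr_eq0 pnatr_eq0.
move=> /(_ isT isT); rewrite sreflE ipBr ipZr !ip_fund eqxx eq_sym (negPf ij).
rewrite mulr0 mulr1 sub0r oppr_ge0 pmulr_lle0 //.
by rewrite divr_gt0 ?ip_gt0 ?simple_neq0.
Qed.

Lemma cartan_prod_lt4 i j : i != j ->
  f (alpha i) (cor (alpha j)) * f (alpha j) (cor (alpha i)) < 4.
Proof.
move=> ij; rewrite !ip_coroot (ipC f (alpha j) (alpha i)).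
have a0 := ip_gt0 f (simple_neq0 i); have b0 := ip_gt0 f (simple_neq0 j).
have -> : forall a b u : R, 2 / b * u * (2 / a * u) = 4 * ((u * u) / (a * b)).
  by move=> a b u; rewrite invfM; ring.
rewrite -[ltRHS]mulr1 ltr_pM2l // ltr_pdivrMr ?mulr_gt0 // mul1r.
apply: cauchy_schwarz_lt; last exact: simple_neq0.
move=> c; apply/eqP => e; have := congr1 (f (omega i)) e.
rewrite ipBr ipZr ip0r !ip_fund eqxx (negPf ij) !mulr0 subr0 mulr1 => /eqP.
by rewrite mulf_eq0 gt_eqF //= invr_eq0 pnatr_eq0.
Qed.

Lemma cartan_eq0 i j : f (alpha i) (cor (alpha j)) = 0 ->
  f (alpha j) (cor (alpha i)) = 0.
Proof.
rewrite !ip_coroot (ipC f (alpha j)) => /eqP.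
rewrite mulf_eq0 mulf_eq0 invr_eq0 pnatr_eq0 /= ip_eq0 (negPf (simple_neq0 j)) /=.
by move=> /eqP ->; rewrite mulr0.
Qed.

End RootData.

(** * Stabilizers of characters *)

Section Characters.

Variables (P : zmodType) (K : fieldType).

Definition character (t : P -> K) : Prop :=
  (forall l, t l != 0) /\ forall l k, t (l + k) = t l * t k.

Variable (t : P -> K).
Hypothesis ht : character t.

Lemma char_neq0 l : t l != 0. Proof. by case: ht. Qed.

Lemma charD l k : t (l + k) = t l * t k. Proof. by case: ht. Qed.

Lemma char0 : t 0 = 1.
Proof. by apply: (mulfI (char_neq0 0)); rewrite -charD addr0 mulr1. Qed.

Lemma charN l : t (- l) = (t l)^-1.
Proof. by apply: (mulfI (char_neq0 l)); rewrite -charD subrr char0 divff ?char_neq0. Qed.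

Lemma charMz l (m : int) : t (l *~ m) = t l ^ m.
Proof.
have h k : t (l *+ k) = t l ^+ k.
  by elim: k => [|k IH]; rewrite ?mulr0n ?char0 ?expr0 // mulrS charD IH exprS.
by case: m => k; rewrite ?NegzE -?mulrNz /= ?charN ?h //= mulrS charD h exprS.
Qed.

End Characters.

(** * Polar coordinates and the kernel of the complex exponential *)

Section ComplexExponential.

Variable R : realType.

Definition cexp (r th : R) : R[i] := Complex (expR r * cos th) (expR r * sin th).

Lemma cexpD r th r' th' : cexp (r + r') (th + th') = cexp r th * cexp r' th'.
Proof.
apply/eqP; rewrite eq_complex /=.
by rewrite expRD cosD sinD; apply/andP; split; apply/eqP; ring.
Qed.

Lemma cexp_surj (x : R[i]) : x != 0 -> exists r th, x = cexp r th.
Proof.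
case: x => a b; rewrite eq_complex /= => ab0.
have s0 : 0 < a ^+ 2 + b ^+ 2.
  rewrite lt_neqAle addr_ge0 ?sqr_ge0 // andbT eq_sym paddr_eq0 ?sqr_ge0 //.
  by rewrite !sqrf_eq0.
set s := Num.sqrt (a ^+ 2 + b ^+ 2).
have sp : 0 < s by rewrite sqrtr_gt0.
have s2 : s ^+ 2 = a ^+ 2 + b ^+ 2 by rewrite sqr_sqrtr // ltW.
have c1 : -1 <= a / s <= 1.
  rewrite -ler_norml normrM normfV (gtr0_norm sp) ler_pdivrMr // mul1r.
  rewrite -(ler_pXn2r (n:=2)) ?nnegrE ?normr_ge0 ?(ltW sp) //.
  by rewrite real_normK ?num_real // s2 lerDl sqr_ge0.
have cE : cos (acos (a / s)) = a / s by rewrite acosK // in_itv.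
have sE : sin (acos (a / s)) = `|b| / s.
  rewrite sin_acos // -[RHS]ger0_norm ?divr_ge0 ?(ltW sp) // -sqrtr_sqr.
  congr Num.sqrt; rewrite !expr_div_n real_normK ?num_real // s2.
  by field; rewrite gt_eqF.
have es : expR (ln s) = s by rewrite lnK ?posrE.
have [b0|b0] := leP 0 b.
  exists (ln s), (acos (a / s)); rewrite /cexp es cE sE ger0_norm //.
  by congr Complex; field; rewrite gt_eqF.
exists (ln s), (- acos (a / s)); rewrite /cexp es cosN sinN cE sE ltr0_norm //.
by congr Complex; field; rewrite gt_eqF.
Qed.

Lemma cosD2piz (x : R) (m : int) : cos (x + (pi *+ 2) *~ m) = cos x.
Proof.
case: m => k; first exact: (periodicn (@cosD2pi R)).
rewrite NegzE mulrNz -pmulrn.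
by rewrite -[in RHS](subrK ((pi *+ 2) *+ k.+1) x) (periodicn (@cosD2pi R)).
Qed.

Lemma cos_eq1 (x : R) : cos x = 1 -> x / (pi *+ 2) \is a Num.int.
Proof.
have p0 : 0 < pi *+ 2 :> R by rewrite mulrn_wgt0 // pi_gt0.
set k := Num.floor (x / (pi *+ 2)); set y := x - (pi *+ 2) *~ k.
move=> cx; have cy : cos y = 1.
  by rewrite /y -mulrNz cosD2piz.
have /andP[k1 k2] := floor_itv (x / (pi *+ 2)).
have y0 : 0 <= y.
  by rewrite subr_ge0 -mulrzl -ler_pdivlMr.
have y2 : y < pi *+ 2.
  rewrite ltrBlDr -mulrzl -[X in X + _]mul1r -mulrDl -ltr_pdivrMr //.
  by rewrite addrC -[X in _ + X]/(1%:~R) -intrD.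
have inj := @cos_inj R.
suff y00 : y = 0.
  move/eqP: y00; rewrite subr_eq0 => /eqP ->.
  by rewrite -mulrzl mulfK ?gt_eqF // intr_int.
have [yp|yp] := leP y pi.
  by apply: inj; rewrite ?in_itv /= ?y0 ?lexx ?pi_ge0 ?cos0 ?cy.
have : pi *+ 2 - y = 0.
  apply: inj; rewrite ?in_itv /= ?lexx ?pi_ge0 //.
    by rewrite subr_ge0 (ltW y2) mulr2n; move: yp; lra.
  by rewrite addrC cosD2pi cosN cos0.
by move: y2 => /[swap] /eqP; rewrite subr_eq0 => /eqP ->; rewrite ltxx.
Qed.

Lemma cexp_eq1 r th : (cexp r th = 1) <-> (r = 0 /\ th / (pi *+ 2) \is a Num.int).
Proof.
have p0 : 0 < pi *+ 2 :> R by rewrite mulrn_wgt0 // pi_gt0.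
split=> [[h1 h2]|[-> /intrP[m mE]]].
  have s0 : sin th = 0.
    by move/eqP: h2; rewrite mulf_eq0 gt_eqF ?expR_gt0 //= => /eqP.
  have c1 : cos th = 1.
    have : cos th ^+ 2 = 1 by rewrite cos2sin2 s0 expr0n subr0.
    move/eqP; rewrite sqrf_eq1 => /orP[/eqP//|/eqP cN].
    have := expR_gt0 r; move: h1; rewrite cN mulrN1 => h1.
    by rewrite -oppr_lt0 h1 ltr10.
  split; last exact: cos_eq1.
  by apply: expR_inj; rewrite expR0 -h1 c1 mulr1.
have -> : th = 0 + (pi *+ 2) *~ m.
  by rewrite add0r -mulrzl -mE divfK // gt_eqF.
have c1 := cosD2piz 0 m; rewrite cos0 in c1.
have s0 : sin (0 + (pi *+ 2) *~ m) = 0 :> R.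
  by apply: cos1sin0; rewrite c1 normr1.
by rewrite /cexp c1 s0 expR0 mulr1 mulr0.
Qed.

End ComplexExponential.

(** * Logarithms of characters of the weight lattice *)

Section TorusLogarithm.

Variables (R : realType) (V : vectType R) (n : nat) (D : root_datum V n).

Local Notation f := (ip D).
Local Notation alpha := (tnth (simple D)).
Local Notation omega := (tnth (fund D)).
Local Notation cor := (coroot (ip D)).

Lemma val_to_weight x : x \in weight_pred D -> val (to_weight D x) = x.
Proof. by move=> xP; rewrite insubdK. Qed.

Lemma val_wact w (l : weight D) : weyl D w -> val (wact w l) = w (val l).
Proof. by move=> W; rewrite val_to_weight // weight_weyl //; case: l. Qed.

Lemma weightD (k l : weight D) : val (k + l) = val k + val l.
Proof. by []. Qed.

Lemma weightMz (l : weight D) m : val (l *~ m) = val l *~ m.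
Proof. exact: (raddfMz (\val : weight D -> V)). Qed.

Lemma weight_expansion (l : weight D) :
  exists m : 'I_n -> int, l = \sum_i to_weight D (omega i) *~ m i.
Proof.
have lP : val l \in weight_pred D by case: l.
exists (fun i => Num.floor (f (val l) (cor (alpha i)))).
apply: val_inj; rewrite raddf_sum /= [LHS](fund_expansion D); apply: eq_bigr => i _.
by rewrite weightMz val_to_weight ?fund_weight // -scaler_int floorK //
  (weightP _ _ lP).
Qed.

Lemma torusE (t : weight D -> R[i]) : torus t <-> character t.
Proof. by []. Qed.

(** a and b collect the logarithms of the moduli and the arguments of t at the fundamental weights,
    along the dual basis of simple coroots. Arguments are measured in full turns, so that periods
    become integers. *)
Lemma char_log (t : weight D -> R[i]) : character t ->
  exists a b : V, forall l : weight D,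
    t l = 1 <-> (f (val l) a = 0 /\ f (val l) b \is a Num.int).
Proof.
move=> ht.
have /choice[c cE] : forall i, exists c : R * R,
    t (to_weight D (omega i)) = cexp c.1 c.2.
  move=> i; have [r [th e]] := cexp_surj (char_neq0 ht (to_weight D (omega i))).
  by exists (r, th).
have p0 : pi *+ 2 != 0 :> R by rewrite gt_eqF // mulrn_wgt0 // pi_gt0.
pose a := \sum_i (c i).1 *: cor (alpha i).
pose b := \sum_i ((c i).2 / (pi *+ 2)) *: cor (alpha i).
exists a, b => l.
pose E (l : weight D) := cexp (f (val l) a) (f (val l) b * (pi *+ 2)).
have E0 : E 0 = 1 by apply/cexp_eq1; rewrite /= !ip0l !mul0r.
have hE : character E.
  have ED k k' : E (k + k') = E k * E k' by rewrite /E weightD !ipDl mulrDl cexpD.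
  split=> // k; apply/eqP => Ek; have := ED k (- k).
  by rewrite subrr E0 Ek mul0r => /eqP; rewrite oner_eq0.
have fE (g : 'I_n -> R) i : f (omega i) (\sum_j g j *: cor (alpha j)) = g i.
  rewrite ip_sumr (bigD1 i) //= ipZr fund_dual eqxx mulr1 big1 ?addr0 // => j ji.
  by rewrite ipZr fund_dual eq_sym (negPf ji) mulr0.
have tE i : t (to_weight D (omega i)) = E (to_weight D (omega i)).
  by rewrite cE /E val_to_weight ?fund_weight // !fE divfK.
have -> : t l = E l.
  have [m ->] := weight_expansion l.
  elim: (index_enum _) => [|i s IH]; first by rewrite big_nil !char0.
  by rewrite !big_cons (charD ht) (charD hE) IH (charMz ht) (charMz hE) tE.
by rewrite cexp_eq1 mulfK.
Qed.

End TorusLogarithm.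

(** * Small perturbations and integers *)

Section SmallPerturbation.

Variable R : realType.

Lemma small_all (T : eqType) (s : seq T) (Q : T -> R -> Prop) :
    (forall x, x \in s -> exists2 e0, 0 < e0 & forall e, 0 < e < e0 -> Q x e) ->
  exists2 e, 0 < e & forall x, x \in s -> Q x e.
Proof.
move=> h; suff [e0 e00 he] : exists2 e0, 0 < e0 &
    forall e, 0 < e < e0 -> forall x, x \in s -> Q x e.
  exists (e0 / 2); first by rewrite divr_gt0.
  by apply: he; rewrite divr_gt0 //= gtr_pMr // invf_lt1 // ltr1n.
elim: s h => [|y s IH] h; first by exists 1.
have [e1 e10 h1] := h y (mem_head _ _).
have [|e2 e20 h2] := IH.
  by move=> x xs; apply: h; rewrite inE xs orbT.
exists (Num.min e1 e2); first by rewrite lt_min e10.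
move=> e; rewrite lt_min => /and3P[e0 ee1 ee2] x; rewrite inE => /orP[/eqP->|xs].
  by apply: h1; rewrite e0.
by apply: h2 => //; rewrite e0.
Qed.

Lemma small_shift (x y : R) : exists2 e0, 0 < e0 & forall e, 0 < e < e0 ->
  `|e * y| < 1 /\ (x \isn't a Num.int ->
     (Num.floor x)%:~R < x + e * y < (Num.floor x)%:~R + 1).
Proof.
(* The distance from x to the nearest integer. For integral x only the bound by 1 is claimed, and d
   = 1 serves. *)
pose d := if x \is a Num.int then 1 else
  Num.min (x - (Num.floor x)%:~R) ((Num.floor x)%:~R + 1 - x).
have /andP[f1 f2] := floor_itv x; rewrite intrD in f2.
have d0 : 0 < d.
  rewrite /d; case: ifPn => // xi; rewrite lt_min !subr_gt0 f2 andbT.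
  rewrite lt_neqAle f1 andbT; apply: contraNneq xi => <-.
  exact: intr_int.
have d1 : d <= 1.
  rewrite /d; case: ifP => // _; rewrite ge_min; apply/orP; right.
  by move: f1; lra.
have y1 : 0 < `|y| + 1 by rewrite ltr_wpDl.
exists (d / (`|y| + 1)); first by rewrite divr_gt0.
move=> e /andP[e0]; rewrite ltr_pdivlMr // => he.
have ey : `|e * y| < d.
  rewrite normrM (gtr0_norm e0); apply: le_lt_trans he.
  by rewrite ler_pM2l // lerDl.
split; first exact: lt_le_trans d1.
move=> /negbTE xi; move: ey; rewrite /d xi lt_min !ltr_norml.
move=> /andP[/andP[h1 _] /andP[_ h2]].
by apply/andP; split; [move: h1|move: h2]; lra.
Qed.

Lemma int_norm_lt1 (x : R) : x \is a Num.int -> `|x| < 1 -> x = 0.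
Proof.
move=> /intrP[m ->]; rewrite -intr_norm (ltrz1 R) => h.
by have -> : m = 0 by lia.
Qed.

Lemma floor_gap_notint (x : R) (m : int) : m%:~R < x < m%:~R + 1 ->
  x \isn't a Num.int.
Proof.
move=> /andP[h1 h2]; apply/negP => /intrP[k kE]; move: h1 h2.
by rewrite kE -[X in _ + X]/(1%:~R) -intrD !ltr_int; lia.
Qed.

End SmallPerturbation.

(** * Alcoves and stabilizers *)

Section Stabilizer.

Variables (R : realType) (V : vectType R) (n : nat) (D : root_datum V n).

Local Notation f := (ip D).
Local Notation rts := (Defs.roots D).
Local Notation alpha := (tnth (simple D)).
Local Notation omega := (tnth (fund D)).
Local Notation sr := (srefl D).
Local Notation cor := (coroot (ip D)).
Local Notation rho := (rho D).

(* The coroot lattice, described as the dual of the weight lattice. *)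
Definition coweight_int (k : V) := forall x, x \in weight_pred D -> f x k \is a Num.int.

Lemma coweight_intD k l : coweight_int k -> coweight_int l -> coweight_int (k + l).
Proof. by move=> hk hl x xP; rewrite ipDr rpredD ?hk ?hl. Qed.

(* Subtracting coroots b from a vector x with <x,b> > 1 shortens x. *)
Lemma alcove_shift (x : V) : (forall a, a \in rts -> f a x \isn't a Num.int) ->
  exists2 k, coweight_int k & forall a, a \in rts -> `|f a (x + k)| < 1.
Proof.
move=> xni.
(* A gap between the pairings of x with roots and the integers. Shifts by coroots change these
   pairings by integers, so the same e serves through the whole descent. *)
have [e e0 gap] : exists2 e, 0 < e &
    forall a, a \in rts -> forall m : int, e * f a a <= `|f a x - m%:~R|.
  apply: small_all => a ra.
  have [e1 e10 h1] := small_shift (f a x) 1; have [e2 e20 h2] := small_shift (f a x) (-1).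
  have aa : 0 < f a a by rewrite ip_gt0 ?(root_neq0 ra).
  exists (Num.min e1 e2 / f a a) => [|d /andP[d0]]; first by rewrite divr_gt0 // lt_min e10.
  rewrite ltr_pdivlMr // lt_min => /andP[d1 d2] m.
  have da0 : 0 < d * f a a by rewrite mulr_gt0.
  have [_ /(_ (xni _ ra)) /andP[_ {}h1]] := h1 _ (introT andP (conj da0 d1)).
  have [_ /(_ (xni _ ra)) /andP[{}h2 _]] := h2 _ (introT andP (conj da0 d2)).
  rewrite mulr1 in h1; rewrite mulrN1 in h2.
  have [mx|xm] := lerP m%:~R (f a x).
    rewrite -floor_ge_int -(ler_int R) in mx.
    by move: mx h2; lra.
  have h3 : (Num.floor (f a x))%:~R + 1 <= m%:~R :> R.
    rewrite -floor_lt_int in xm.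
    rewrite -[X in _ + X]/(1%:~R) -intrD ler_int.
    by rewrite lezD1.
  by move: h1 h3; lra.
(* Subtracting the coroot of a lowers the square norm by 4 (<a,x> - 1) / <a,a>, which is at least 4
   e by the gap at the integer 1; N bounds the number of subtractions. *)
have [N] : exists N : nat, f x x < N%:R * (4 * e).
  exists (Num.bound (f x x / (4 * e))); rewrite -ltr_pdivrMr ?mulr_gt0 //.
  by apply: archi_boundP; rewrite divr_ge0 ?ip_ge0 ?mulr_ge0 // ltW.
elim: N => [|N IH] in x xni gap *.
  by rewrite mul0r ltNge ip_ge0.
move=> hN; have [h|/existsNP[a /not_implyP[ra /negP]]] :=
    pselect (forall a, a \in rts -> `|f a x| < 1).
  by exists 0 => [y _|]; rewrite ?ip0r ?rpred0 ?addr0.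
rewrite -leNgt => ha.
have {a ra ha} [a ra ha] : exists2 a, a \in rts & 1 <= f a x.
  have [p|p] := lerP 0 (f a x); first by exists a; rewrite // -(ger0_norm p).
  by exists (- a); rewrite ?root_opp // ipNl -(ltr0_norm p).
have aa : 0 < f a a by rewrite ip_gt0 ?(root_neq0 ra).
have kN : coweight_int (- cor a).
  by move=> y yP; rewrite ipNr rpredN weight_coroot_int.
have [|||k kQ hk] := IH (x + - cor a).
- move=> b rb; rewrite ipDr rpredDr ?xni //; apply: kN; exact: root_weight.
- move=> b rb m; have /intrP[j jE] := kN _ (root_weight rb).
  have -> : f b (x + - cor a) - m%:~R = f b x - (m - j)%:~R.
    by rewrite ipDr jE intrB; ring.
  exact: gap.
- have := gap _ ra 1; rewrite ger0_norm ?subr_ge0 // => ga.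
  have -> : f (x + - cor a) (x + - cor a) = f x x - 4 / f a a * (f a x - 1).
    rewrite ipDl !ipDr !ipNl !ipNr opprK [f (cor a) _]ipC !ip_coroot.
    rewrite (ipC _ (cor a)) ip_coroot (ipC _ x a).
    by field; rewrite gt_eqF.
  have : 4 * e <= 4 / f a a * (f a x - 1).
    by rewrite -mulrA ler_pM2l // mulrC ler_pdivlMr.
  by move: hN; rewrite -natr1 mulrDl mul1r; lra.
exists (- cor a + k); first exact: coweight_intD.
by move=> b rb; rewrite addrA hk.
Qed.

(* A minuscule coweight in the coroot lattice is zero: reflecting it in a
   simple root on which it is nonzero shortens its expansion in the simple
   coroots, but preserves its norm. *)
Lemma minuscule_eq0 (k : V) : coweight_int k ->
  (forall a, a \in rts -> `|f a k| <= 1) -> k = 0.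
Proof.
move=> kQ ka.
have [N] : exists N : nat, \sum_i `|f (omega i) k| < N%:R.
  by exists (Num.bound (\sum_i `|f (omega i) k|)); apply: archi_boundP; rewrite sumr_ge0.
elim: N => [|N IH] in k kQ ka *; first by rewrite ltNge sumr_ge0.
move=> hN; apply/eqP; rewrite -(ip_eq0 f); apply/negPn/negP => kk.
(* <k,k> is a combination with positive coefficients of the products <omega_i,k> <alpha_i,k>, so one
   of them is positive. Below, s is therefore 1 or -1 with the sign of m, and subtracting it shrinks
   m. *)
have [i hi] : exists i, 0 < f (omega i) k * f (alpha i) k.
  case: (pselect (exists i, 0 < f (omega i) k * f (alpha i) k)) => // h; exfalso.
  suff : f k k <= 0 by rewrite leNgt lt_neqAle eq_sym kk ip_ge0.
  rewrite [X in f X _](coroot_expansion D k) ip_suml sumr_le0 // => i _.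
  rewrite ipZl (ipC _ (cor _)) ip_coroot (ipC _ k) mulrCA pmulr_rle0.
    by rewrite leNgt; apply/negP => hi; apply: h; exists i.
  by rewrite divr_gt0 // ip_gt0 // simple_neq0.
have /intrP[s sE] := kQ _ (root_weight (simple_root D i)).
have /intrP[m mE] := kQ _ (fund_weight D i).
have s1 := ka _ (simple_root D i); rewrite sE -intr_norm (lerz1 R) in s1.
rewrite sE mE -intrM ltr0z in hi.
have sk : sr i k = k - s%:~R *: cor (alpha i).
  rewrite sreflE; congr (_ - _); rewrite /coroot ipZr -sE scalerA (ipC _ k).
  by congr (_ *: _); rewrite mulrC.
suff sk0 : sr i k = 0.
  move: kk; rewrite -(weyl_isometry _ _ (weyl_srefl D i)) sk0 ip0l.
  by rewrite eqxx.
apply: IH.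
- move=> x xP; rewrite -ip_reflection ?simple_neq0 //; apply: kQ.
  exact: weight_srefl.
- move=> a ra; rewrite -ip_reflection ?simple_neq0 // ka // root_refl //.
  exact: simple_root.
- rewrite -(ltrD2r 1) natr1; apply: le_lt_trans hN.
  rewrite (bigD1 i) //= [leRHS](bigD1 i) //= addrAC lerD //; last first.
    apply: ler_sum => j ji; rewrite sk ipBr ipZr fund_dual (negPf ji).
    by rewrite mulr0 subr0.
  rewrite sk ipBr ipZr fund_dual eqxx mulr1 mE -intrB -!intr_norm.
  rewrite -[X in _ + X]/(1%:~R) -intrD ler_int.
  have s0 : s != 0 by apply: contraTneq hi => ->; rewrite mulr0.
  have : s = 1 \/ s = -1 by lia.
  by case=> sv; move: hi; rewrite sv; lia.
Qed.

(* Steinberg's theorem on stabilizers, in the form: an element of W that fixes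
   t and the positive system of the roots killed by t is trivial.  Writing t
   through its logarithm as a point x, so that w moves x by a coroot lattice
   vector, one moves x to an alcove around the origin, where this vector
   becomes minuscule, hence zero. *)
Lemma char_stabilizer (t : weight D -> R[i]) (w : 'End(V)) :
    character t -> weyl D w -> (forall l, t (wact w l) = t l) ->
    (forall a, Zset t a -> 0 < f rho (w a)) ->
  w = \1%VF.
Proof.
move=> ht Ww wt wZ.
have [a [b tE]] := char_log ht.
have t1 x : x \in weight_pred D -> t (to_weight D x) = 1 <->
    (f x a = 0 /\ f x b \is a Num.int).
  by move=> xP; rewrite tE val_to_weight.
(* A small multiple of the real part a is added to b. This merges the two conditions of [char_log]:
   on the resulting point x0 a root has an integral pairing exactly when t is 1 on it. *)
have [e e0 he] : exists2 e, 0 < e & forall c, c \in rts ->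
    f c (b + e *: a) \is a Num.int -> t (to_weight D c) = 1.
  apply: small_all => c rc; have [e1 e10 h1] := small_shift (f c b) (f c a).
  exists e1 => // e he; have [ea gap] := h1 _ he.
  rewrite ipDr ipZr => xi; apply/t1; first exact: root_weight.
  have bi : f c b \is a Num.int.
    apply: contraT => /gap; move=> /floor_gap_notint.
    by rewrite xi.
  split=> //; have : e * f c a = 0.
    by apply: int_norm_lt1 => //; rewrite rpredDl in xi.
  by move/eqP; rewrite mulf_eq0 => /orP[|/eqP//]; case/andP: he => /gt_eqF ->.
set x0 := b + e *: a in he.
have x0int c : c \in rts -> t (to_weight D c) = 1 -> f c x0 \is a Num.int.
  move=> rc /t1; rewrite root_weight // => /(_ isT)[ca cb].
  by rewrite ipDr ipZr ca mulr0 addr0.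
have x0w x : x \in weight_pred D -> f (w x - x) x0 \is a Num.int.
  move=> xP; have wxP := weight_weyl Ww xP.
  have : t (to_weight D (w x - x)) = 1.
    have -> : to_weight D (w x - x) = wact w (to_weight D x) - to_weight D x.
      apply: val_inj; rewrite val_to_weight ?rpredB //.
      by rewrite raddfB /= val_wact // !val_to_weight.
    by rewrite charD // charN // wt divff // char_neq0.
  move/t1; rewrite rpredB // => /(_ isT)[ca cb].
  by rewrite ipDr ipZr ca mulr0 addr0.
(* The shift by d rho leaves all the hyperplanes of integral pairing, on the positive side of those
   through x0, and crosses none of the others. *)
have [d d0 hd] : exists2 d, 0 < d & forall c, c \in rts ->
    `|d * f c rho| < 1 /\ (f c x0 \isn't a Num.int ->
     (Num.floor (f c x0))%:~R < f c x0 + d * f c rho < (Num.floor (f c x0))%:~R + 1).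
  apply: small_all => c rc; exact: small_shift.
have [k kQ hk] : exists2 k, coweight_int k &
    forall c, c \in rts -> `|f c (x0 + d *: rho + k)| < 1.
  apply: alcove_shift => c rc; rewrite ipDr ipZr; have [h1 h2] := hd _ rc.
  have [ci|/h2/floor_gap_notint//] := boolP (f c x0 \is a Num.int).
  rewrite rpredDl //; apply/negP => /int_norm_lt1/(_ h1)/eqP.
  by rewrite mulf_eq0 gt_eqF //= (ipC _ c) (negPf (root_sign rc)).
(* k is found for the perturbed point but applied to x0, so that the roots on which t is 1 keep
   integral pairings. *)
set x1 := x0 + k.
have x1E c : f c (x0 + d *: rho + k) = f c x1 + d * f c rho.
  by rewrite addrAC ipDr ipZr.
have x1n c : c \in rts -> t (to_weight D c) <> 1 -> `|f c x1| < 1.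
  move=> rc tc; have [_] := hd _ rc.
  have ni : f c x0 \isn't a Num.int by apply/negP => /(he _ rc).
  have /intrP[m mE] := kQ _ (root_weight rc).
  move=> /(_ ni)/andP[h1 h2]; have := hk _ rc; rewrite x1E /x1 ipDr mE.
  have /andP[g1 g2] := floor_itv (f c x0); rewrite intrD in g2.
  have g3 : (Num.floor (f c x0))%:~R < f c x0.
    rewrite lt_neqAle g1 andbT; apply: contraNneq ni => <-.
    exact: intr_int.
  set p := Num.floor (f c x0) in h1 h2 g1 g2 g3 *.
  rewrite !ltr_norml => /andP[u1 u2].
  have v1 : (-1)%:~R < (p + m + 1)%:~R :> R by rewrite mulrNz !intrD; lra.
  have v2 : (p + m)%:~R < 1%:~R :> R by rewrite !intrD; lra.
  rewrite !ltr_int in v1 v2.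
  have q1 : 0 <= (p + m + 1)%:~R :> R by rewrite ler0z; clear -v1; lia.
  have q2 : (p + m)%:~R <= 0 :> R by rewrite lerz0; clear -v2; lia.
  by apply/andP; split; move: q1 q2; rewrite !intrD; lra.
(* The pairing is an integer m with |m + d <c,rho>| < 1 and 0 < d <c,rho> < 1, which leaves only 0
   and -1. *)
have x1z c : Zset t c -> f c x1 = 0 \/ f c x1 = -1.
  move=> [/pos_rootE[rc pc] tc]; have [h1 _] := hd _ rc.
  have : f c x1 \is a Num.int.
    by rewrite /x1 ipDr rpredD ?x0int ?kQ ?root_weight.
  move=> /intrP[m mE]; have := hk _ rc; rewrite x1E mE !ltr_norml.
  have q0 : 0 < d * f c rho by rewrite mulr_gt0 // (ipC _ c).
  rewrite gtr0_norm // in h1; move=> /andP[u1 u2].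
  have v1 : (-2)%:~R < m%:~R :> R by rewrite mulrNz; lra.
  have v2 : m%:~R < 1%:~R :> R by lra.
  rewrite !ltr_int in v1 v2; have [->|->] : m = 0 \/ m = -1 by clear -v1 v2; lia.
    by left.
  by right.
have tw c : c \in rts -> t (to_weight D (w c)) = t (to_weight D c).
  move=> rc; rewrite -(wt (to_weight D c)); congr t; apply: val_inj.
  by rewrite val_wact // !val_to_weight // root_weight // weyl_root.
have WV := weylV Ww.
have Zw c : Zset t c -> Zset t (w c).
  move=> Zc; have [/pos_rootE[rc pc] tc] := Zc; split; last by rewrite tw.
  by apply/pos_rootE; split; [exact: weyl_root|exact: wZ].
(* The difference is an integer. Either both pairings lie strictly between -1 and 1, or, up to the
   sign of c, both belong to {0, -1} because w preserves Z(t); without that they could differ by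
   2. *)
have x1w c : c \in rts -> `|f (w c) x1 - f c x1| <= 1.
  move=> rc; have xi : f (w c) x1 - f c x1 \is a Num.int.
    rewrite -ipBl /x1 ipDr rpredD ?x0w ?root_weight //; apply: kQ.
    by rewrite rpredB ?root_weight // weyl_root.
  have [tc|tc] := pselect (t (to_weight D c) = 1); last first.
    have n1 := x1n _ rc tc.
    have n2 : `|f (w c) x1| < 1 by apply: x1n; rewrite ?tw ?weyl_root.
    move: xi n1 n2 => /intrP[m mE]; rewrite !ltr_norml => /andP[n1 n2] /andP[n3 n4].
    have v1 : (-2)%:~R < m%:~R :> R by rewrite mulrNz -mE; lra.
    have v2 : m%:~R < 2%:~R :> R by rewrite -mE; lra.
    rewrite !ltr_int in v1 v2; by rewrite mE -intr_norm (lerz1 R); clear -v1 v2; lia.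
  have Zc b' : Zset t b' -> `|f (w b') x1 - f b' x1| <= 1.
    move=> Zb; have [->|->] := x1z _ Zb; have [->|->] := x1z _ (Zw _ Zb).
    - by rewrite subrr normr0.
    - by rewrite subr0 normrN1.
    - by rewrite sub0r opprK normr1.
    - by rewrite subrr normr0.
  have [pc|nc] := ltP 0 (f rho c); first by apply: Zc; split=> //; apply/pos_rootE.
  have := Zc (- c); rewrite linearN !ipNl -opprD normrN; apply.
  have tN : to_weight D (- c) = - to_weight D c.
    apply: val_inj; rewrite val_to_weight ?root_weight ?root_opp //.
    by rewrite raddfN /= val_to_weight ?root_weight.
  split; last by rewrite tN charN // tc invr1.
  apply/pos_rootE; split; first exact: root_opp.
  by rewrite ipNr oppr_gt0 lt_neqAle root_sign.
have x1fix x : f (w x) x1 = f x x1.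
  have e1 x' : f (w x') x1 = f x' ((w^-1)%VF x1).
    by rewrite -{1}(weylVK Ww x1) weyl_isometry.
  suff k0 : (w^-1)%VF x1 - x1 = 0 by apply/eqP; rewrite e1 -subr_eq0 -ipBr k0 ip0r.
  apply: minuscule_eq0 => [y yP|c rc]; last by rewrite ipBr -e1 x1w.
  rewrite ipBr -e1 -ipBl /x1 ipDr rpredD ?x0w //; apply: kQ.
  by rewrite rpredB // weight_weyl.
(* The positive system of x1 with ties broken by rho. A root orthogonal to x1 has t equal to 1, so w
   respects the ties too; the regular point x1 + g rho realizes this system. *)
pose phi c := (0 < f x1 c) || ((f x1 c == 0) && (0 < f rho c)).
have wphi c : c \in rts -> phi c -> phi (w c).
  rewrite /phi !(ipC _ x1) x1fix => rc /orP[->//|/andP[c0 pc]].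
  rewrite c0 /= wZ ?orbT //; split; first exact/pos_rootE.
  case: (pselect (t (to_weight D c) = 1)) => // tc; exfalso.
  have ni : f c x0 \isn't a Num.int by apply/negP => /(he _ rc).
  move: c0; rewrite /x1 ipDr addr_eq0 => /eqP c0.
  by move: ni; rewrite c0 rpredN kQ // root_weight.
have [g g0 hg] : exists2 g, 0 < g & forall c, c \in rts ->
    (0 < f (x1 + g *: rho) c) = phi c /\ f (x1 + g *: rho) c != 0.
  apply: small_all => c rc.
  have [x1c|x1c] := eqVneq (f x1 c) 0.
    exists 1 => // g /andP[g0 _]; rewrite /phi ipDl ipZl x1c add0r ltxx /= eqxx.
    by rewrite pmulr_rgt0 // mulf_neq0 ?(lt0r_neq0 g0) ?(root_sign rc).
  have y1 : 0 < `|f rho c| + 1 by rewrite ltr_wpDl.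
  exists (`|f x1 c| / (`|f rho c| + 1)).
    by rewrite divr_gt0 // normr_gt0.
  move=> g /andP[g0]; rewrite ltr_pdivlMr // => hg.
  have gy : `|g * f rho c| < `|f x1 c|.
    rewrite normrM (gtr0_norm g0); apply: le_lt_trans hg.
    by rewrite ler_pM2l // lerDl.
  rewrite /phi ipDl ipZl (negPf x1c) /= orbF.
  move: gy; have [p|p] := lerP 0 (f x1 c).
    rewrite (ger0_norm p) ltr_norml => /andP[g1 g2].
    have pp : 0 < f x1 c by rewrite lt_neqAle eq_sym x1c.
    have q : 0 < f x1 c + g * f rho c by lra.
    by rewrite q pp gt_eqF.
  rewrite (ltr0_norm p) ltr_norml opprK => /andP[g1 g2].
  have q : f x1 c + g * f rho c < 0 by lra.
  by rewrite lt_eqF // ltNge ltW // ltNge ltW.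
apply: (@weyl_fix_regular _ _ _ D _ (x1 + g *: rho)) => //.
  by move=> c rc; case: (hg _ rc).
move=> c rc; have [-> _] := hg _ rc; have [|-> _] := hg (w c); first exact: weyl_root.
exact: wphi.
Qed.

End Stabilizer.

(** * Linear maps on free modules, weight vectors *)

Section LinearExtension.

Variables (K : nzRingType) (I : choiceType) (U : lmodType K).

Definition mlift (h : I -> U) (g : {malg K[I]}) : U :=
  \sum_(k <- msupp g) g@_k *: h k.

Lemma mliftEw (h : I -> U) g (d : {fset I}) : (msupp g `<=` d)%fset ->
  mlift h g = \sum_(k <- d) g@_k *: h k.
Proof.
move=> gd; rewrite /mlift (big_fset_incl _ gd) // => k _ /mcoeff_outdom ->.
exact: scale0r.
Qed.

Lemma mliftU (h : I -> U) k : mlift h << k >> = h k.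
Proof. by rewrite /mlift msuppU oner_eq0 big_seq_fset1 mcoeffUU scale1r. Qed.

Lemma mlift_is_linear (h : I -> U) : linear (mlift h).
Proof.
move=> c x y; pose d := (msupp x `|` msupp y `|` msupp (c *: x + y))%fset.
rewrite (@mliftEw _ _ d) ?(@mliftEw _ x d) ?(@mliftEw _ y d) //.
- rewrite scaler_sumr -big_split; apply: eq_bigr => k _ /=.
  by rewrite mcoeffD mcoeffZ scalerDl scalerA.
- by rewrite /d -fsetUA; apply: fsubset_trans (fsubsetUr _ _); exact: fsubsetUl.
- by rewrite /d -fsetUA; exact: fsubsetUl.
- exact: fsubsetUr.
Qed.

HB.instance Definition _ h := GRing.isLinear.Build K {malg K[I]} U *:%R
  (mlift h) (mlift_is_linear h).

Lemma malgUZ c k : << c *g k >> = c *: << k >> :> {malg K[I]}.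
Proof. by apply/malgP => j; rewrite mcoeffZ !mcoeffU mulr_natr. Qed.

Lemma malg_sumE (g : {malg K[I]}) : g = \sum_(k <- msupp g) g@_k *: << k >>.
Proof.
by rewrite [LHS]monalgE; apply: eq_bigr => k _; rewrite malgUZ.
Qed.

Lemma eq_malg_linear (f1 f2 : {malg K[I]} -> U) : linear f1 -> linear f2 ->
  (forall k, f1 << k >> = f2 << k >>) -> f1 =1 f2.
Proof.
move=> l1 l2 e g.
pose F1 : {linear {malg K[I]} -> U} := HB.pack f1 (GRing.isLinear.Build _ _ _ _ f1 l1).
pose F2 : {linear {malg K[I]} -> U} := HB.pack f2 (GRing.isLinear.Build _ _ _ _ f2 l2).
rewrite -[f1]/(F1 : _ -> _) -[f2]/(F2 : _ -> _) [g]malg_sumE !linear_sum.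
by apply: eq_bigr => k _; rewrite !linearZ /= e.
Qed.

End LinearExtension.

Lemma mlift_mlift (K : nzRingType) (I1 I2 : choiceType) (U : lmodType K)
    (h2 : I2 -> U) (h1 : I1 -> {malg K[I2]}) g :
  mlift h2 (mlift h1 g) = mlift (fun k => mlift h2 (h1 k)) g.
Proof.
by rewrite [mlift h1 g]/mlift linear_sum; apply: eq_bigr => k _; rewrite linearZ.
Qed.

Section WeightVectors.

Variables (P : Type) (K : fieldType) (M : lmodType K) (X : P -> {linear M -> M}).

Definition weight_vec (chi : P -> K) (y : M) := forall l, X l y = chi l *: y.

Lemma weight_vecZ chi c y : weight_vec chi y -> weight_vec chi (c *: y).
Proof. by move=> hy l; rewrite linearZ /= hy !scalerA mulrC. Qed.

Lemma weight_vec0 chi : weight_vec chi 0.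
Proof. by move=> l; rewrite linear0 scaler0. Qed.

(** Elimination one term at a time: for l separating the k-th character from chi, the operator X l -
    chis k l kills y k, rescales the other terms, and after division fixes z. A term y k = 0 may
    carry the character chi itself, which happens for vectors of M beyond a wall. *)
Lemma weight_component (N : M -> Prop) (I : Type) (s : seq I) (y : I -> M)
    (chis : I -> P -> K) (chi : P -> K) (z : M) :
    (forall u v, N u -> N v -> N (u + v)) -> (forall c u, N u -> N (c *: u)) ->
    (forall l u, N u -> N (X l u)) ->
    (forall k, weight_vec (chis k) (y k)) -> weight_vec chi z ->
    all (fun k => `[< y k <> 0 -> chis k <> chi >]) s ->
  N (\sum_(k <- s) y k + z) -> N z.
Proof.
move=> ND NZ NX hy hz; elim: s => [|k s IH] /= in y hy *.
  by rewrite big_nil add0r.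
move=> /andP[/asboolP ks hs]; rewrite big_cons.
have [->|/eqP/ks] := eqVneq (y k) 0; first by rewrite add0r; apply: IH.
move=> kchi; have [l hl] : exists l, chis k l <> chi l.
  by apply: contra_notP kchi => /forallNP h; apply/funext => l; apply: contrapT.
have c0 : chi l - chis k l != 0 by rewrite subr_eq0; apply/eqP => /esym.
pose c j := (chis j l - chis k l) / (chi l - chis k l).
move=> Nsum; apply: (IH (fun j => c j *: y j)).
- by move=> j; exact: weight_vecZ.
- apply: sub_all hs => j /asboolP h; apply/asboolP => cy; apply: h => y0.
  by apply: cy; rewrite y0 scaler0.
have := NZ (chi l - chis k l)^-1 _ (ND _ _ (NX l _ Nsum) (NZ (- chis k l) _ Nsum)).
congr N; set d := chi l - chis k l in c0 *.
have -> : \sum_(j <- s) c j *: y j = d^-1 *: \sum_(j <- s) (chis j l - chis k l) *: y j.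
  by rewrite scaler_sumr; apply: eq_bigr => j _; rewrite scalerA mulrC.
rewrite -[z in RHS](scalerK c0) -scalerDr; congr (_ *: _).
rewrite !linearD /= hy hz linear_sum /=.
have -> : \sum_(j <- s) (chis j l - chis k l) *: y j =
    \sum_(j <- s) X l (y j) - chis k l *: \sum_(j <- s) y j.
  rewrite scaler_sumr -sumrB; apply: eq_bigr => j _.
  by rewrite hy scalerBl.
rewrite /d scalerBl !scaleNr.
by rewrite (AC (3*3) ((2*5)*(3*6)*(1*4))) /= subrr addr0.
Qed.

End WeightVectors.

(** * Alternating walks in rank two *)

Definition letter (b : bool) (k : nat) : bool := b (+) odd k.

Lemma letter0 b : letter b 0 = b. Proof. exact: addbF. Qed.

Lemma letterS b k : letter b k.+1 = ~~ letter b k.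
Proof. by rewrite /letter /= addbN. Qed.

Lemma letterD b j k : letter b (j + k) = letter (letter b j) k.
Proof. by rewrite /letter oddD addbA. Qed.

Lemma letterN b k : letter (~~ b) k = ~~ letter b k.
Proof. by rewrite /letter addNb. Qed.

Lemma letterK b k : letter (letter b k) k = b.
Proof. by rewrite /letter -addbA addbb addbF. Qed.

(* The letters are read from the right: S b acts first. *)
Fixpoint word (U : Type) (S : bool -> U -> U) b r y : U :=
  if r is k.+1 then S (letter b k) (word S b k y) else y.

Section AlternatingWords.

Variables (U : Type) (S : bool -> U -> U).

(** The leftmost factor acts last, so the word starts with the last letter of the product, which is
    [~~ letter b m]. The predicate Q admits actions that are multiplicative only on a subalgebra. *)
Lemma word_prod (A : pzRingType) (Q : A -> Prop) (x : bool -> A) (act : A -> U -> U)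
    b m y :
    Q 1 -> (forall a c, Q a -> Q c -> Q (a * c)) -> (forall c, Q (x c)) ->
    (forall u, act 1 u = u) ->
    (forall a c u, Q a -> Q c -> act (a * c) u = act a (act c u)) ->
    (forall c u, act (x c) u = S c u) ->
  act (\prod_(k < m) x (letter b k)) y = word S (~~ letter b m) m y.
Proof.
move=> Q1 QM Qx act1 actM actx; elim: m => [|m IH] in b *.
  by rewrite big_ord0 act1.
have prodE : \prod_(i < m) x (letter b (bump 0 i)) = \prod_(i < m) x (letter (~~ b) i).
  by apply: eq_bigr => i _; rewrite letterS letterN.
have Qp k c : Q (\prod_(i < k) x (letter c i)) by elim/big_ind: _.
rewrite big_ord_recl /= prodE letter0 actM // IH actx.
by rewrite letterN negbK letterS negbK letterK.
Qed.

Hypothesis SK : forall b, involutive (S b).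

Lemma word_rev b r k y : (k <= r)%N ->
  word S (letter (~~ b) r) k (word S b r y) = word S b (r - k) y.
Proof.
elim: k => [|k IH] kr; first by rewrite subn0.
rewrite /= IH 1?ltnW // subnS; have : (0 < r - k)%N by rewrite subn_gt0.
case E: (r - k)%N => [//|j] _ /=.
have -> : letter (letter (~~ b) r) k = letter b j.
  have -> : r = (j.+1 + k)%N by lia.
  by rewrite letterD letterK letterN letterS negbK.
by rewrite SK.
Qed.

Lemma iter_swap m : iter m (S true \o S false) =1 id ->
  forall b, iter m (S b \o S (~~ b)) =1 id.
Proof.
move=> h [] //= y; rewrite -[RHS](SK true); rewrite -[in RHS](h (S true y)).
by elim: m {h} => [|k IH] /=; rewrite ?SK // IH !SK.
Qed.

Lemma word_double b k y : word S b k.*2 y = iter k (S (~~ b) \o S b) y.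
Proof.
elim: k => //= k ->; rewrite /letter /= odd_double addbF addbT.
by [].
Qed.

(** 2 m letters make a full turn, so m letters one way lead to the same place as m letters the other
    way. *)
Lemma word_braid m : iter m (S true \o S false) =1 id ->
  forall y, word S true m y = word S false m y.
Proof.
move=> h y; have := @word_rev false m.*2 m y.
have -> : word S false m.*2 y = y by rewrite word_double; exact: h.
by rewrite -addnn addnK leq_addr /letter oddD addbb addbF => ->.
Qed.

End AlternatingWords.

(** * Rank two Weyl groups acting on weights and characters *)

Section RankTwoLattice.

Variables (P : zmodType) (al om : bool -> P) (co : bool -> P -> int).
Hypothesis coD : forall b l k, co b (l + k) = co b l + co b k.
Hypothesis co_al : forall b, co b (al b) = 2.
Hypothesis co_om : forall b, co b (om b) = 1.
Hypothesis co_omN : forall b, co (~~ b) (om b) = 0.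

(** Types A1 x A1, A2, B2 and G2, the last two with both orders of the simple roots. *)
Definition cartan_pairs : seq (int * int) :=
  [:: (0, 0); (-1, -1); (-1, -2); (-2, -1); (-1, -3); (-3, -1)].

Local Notation ca b := (co (~~ b) (al b)).
Hypothesis cartanP : (ca true, ca false) \in cartan_pairs.

Definition sl (b : bool) (l : P) : P := l - al b *~ co b l.

Variable m : nat.
Hypothesis m_gt0 : (0 < m)%N.
Hypothesis order_m : iter m (sl true \o sl false) =1 id.
Hypothesis min_m : forall k, (0 < k < m)%N ->
  ~ iter k (sl true \o sl false) =1 id.

Lemma co0 b : co b 0 = 0.
Proof. by apply: (addrI (co b 0)); rewrite -coD !addr0. Qed.

Lemma coN b l : co b (- l) = - co b l.
Proof. by apply: (addrI (co b l)); rewrite -coD !subrr co0. Qed.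

Lemma coMz b l (z : int) : co b (l *~ z) = co b l * z.
Proof.
have h k : co b (l *+ k) = co b l *+ k.
  by elim: k => [|k IH]; rewrite ?mulr0n ?co0 // !mulrS coD IH.
rewrite -mulrzz; case: z => k; first exact: h.
by rewrite NegzE !mulrNz coN; congr (- _); exact: h.
Qed.

Lemma slK b : involutive (sl b).
Proof.
move=> l; rewrite /sl coD coN coMz co_al -addrA -opprD -mulrzDr.
have -> : co b l + (co b l - 2 * co b l) = 0 by ring.
by rewrite mulr0z subr0.
Qed.

Lemma slD b l k : sl b (l + k) = sl b l + sl b k.
Proof. by rewrite /sl coD mulrzDr opprD addrACA. Qed.

Lemma sl_al b : sl b (al b) = - al b.
Proof. by rewrite /sl co_al mulrz_nat mulr2n opprD addrA subrr add0r. Qed.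

Lemma sl_om b : sl b (om b) = om b - al b.
Proof. by rewrite /sl co_om mulr1z. Qed.

Lemma cartanP' b : (ca b, ca (~~ b)) \in cartan_pairs.
Proof.
case: b => //=; move: cartanP; rewrite !inE !xpair_eqE.
by case/or4P=> [|||/or3P[||]] /andP[/eqP -> /eqP ->].
Qed.

Lemma order_sl b : iter m (sl b \o sl (~~ b)) =1 id.
Proof.
exact: (iter_swap slK).
Qed.

Lemma order_sl_min b k : (0 < k < m)%N -> ~ iter k (sl b \o sl (~~ b)) =1 id.
Proof.
case: b => [|h id_k]; [exact: min_m|apply: (min_m h) => l].
rewrite -[RHS](slK false) -[in RHS](id_k (sl false l)).
elim: (k) => [|j IH] /=; first by rewrite slK.
by rewrite IH !slK.
Qed.

Section Coordinates.

Variable b : bool.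
Local Notation a := (ca b).
Local Notation a' := (ca (~~ b)).

Definition plane (p r : int) : P := al b *~ p + al (~~ b) *~ r.

Lemma sl_plane1 l p r : sl b (l + plane p r) =
  l + plane (- p - co b l - a' * r) r.
Proof.
rewrite /sl /plane !coD !coMz co_al; have := negbK b; case: b => /= _.
all: rewrite -!addrA; congr (_ + _); rewrite addrCA [RHS]addrC; congr (_ + _).
all: by rewrite -mulrzBr; congr (_ *~ _); ring.
Qed.

Lemma sl_plane2 l p r : sl (~~ b) (l + plane p r) =
  l + plane p (- r - co (~~ b) l - a * p).
Proof.
rewrite /sl /plane !coD !coMz co_al -!addrA; congr (_ + (_ + _)).
by rewrite -mulrzBr; congr (_ *~ _); ring.
Qed.

(** One rotation in coordinates: the product of the two reflections sends [l + plane b pr.1 pr.2] to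
    the point with coordinates [rot x y pr], where x and y are the pairings of l with the two
    coroots. *)
Definition rot (x y : int) (pr : int * int) : int * int :=
  let r := - pr.2 - y - a * pr.1 in (- pr.1 - x - a' * r, r).

Lemma iter_rot k l : iter k (sl b \o sl (~~ b)) l =
  let pr := iter k (rot (co b l) (co (~~ b) l)) (0, 0) in l + plane pr.1 pr.2.
Proof.
elim: k => [|k IH] /=; first by rewrite /plane !mulr0z !addr0.
by rewrite IH /= sl_plane2 sl_plane1.
Qed.

(** 4 - a a' is the determinant of the Cartan matrix. *)
Lemma plane_eq0 p r : a * a' != 4 -> plane p r = 0 -> p = 0 /\ r = 0.
Proof.
move=> d h; have := congr1 (co b) h; have := congr1 (co (~~ b)) h.
rewrite /plane !coD !coMz !co0 !co_al => h1 h2; rewrite negbK in d.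
set u := co (~~ b) (al b) in d h1 *; set v := co b (al (~~ b)) in d h2 *.
have d0 : 4 - u * v != 0 by rewrite subr_eq0 eq_sym.
split; apply: (mulIf d0); rewrite mul0r.
  have -> : p * (4 - u * v) = 2 * (2 * p + v * r) - v * (u * p + 2 * r) by ring.
  by rewrite h1 h2 !mulr0 subrr.
have -> : r * (4 - u * v) = 2 * (u * p + 2 * r) - u * (2 * p + v * r) by ring.
by rewrite h1 h2 !mulr0 subrr.
Qed.

End Coordinates.

Definition coxeter_of (a a' : int) : nat :=
  match absz (a * a') with 0 => 2 | 1 => 3 | 2 => 4 | _ => 6 end.

(** Iterating [rot] returns to the origin after [coxeter_of] turns for every weight, while the two
    fundamental weights together exclude any smaller number. *)
Lemma m_coxeter b : m = coxeter_of (ca b) (ca (~~ b)).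
Proof.
have cP := cartanP' b; set m0 := coxeter_of _ _.
have m00 : (0 < m0)%N.
  move: cP; rewrite /m0 !inE !xpair_eqE.
  by case/or4P=> [|||/or3P[||]] /andP[/eqP -> /eqP ->].
have d4 : ca b * ca (~~ b) != 4.
  move: cP; rewrite !inE !xpair_eqE.
  by case/or4P=> [|||/or3P[||]] /andP[/eqP -> /eqP ->].
apply/eqP; rewrite eqn_leq; apply/andP; split.
  rewrite leqNgt; apply/negP => lt; apply: (@order_sl_min b m0); first by rewrite m00.
  move=> l; rewrite iter_rot.
  suff -> : iter m0 (rot b (co b l) (co (~~ b) l)) (0, 0) = (0, 0).
    by rewrite /= /plane !mulr0z !addr0.
  move: (co b l) (co (~~ b) l) => x y; rewrite /m0 /rot.
  move: cP; rewrite !inE !xpair_eqE.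
  by case/or4P=> [|||/or3P[||]] /andP[/eqP -> /eqP ->] /=; congr pair; ring.
rewrite leqNgt; apply/negP => lt.
have e1 := order_sl b (om b); have e2 := order_sl b (om (~~ b)).
rewrite iter_rot co_om co_omN /= in e1.
rewrite iter_rot co_om -{2}(negbK b) co_omN /= in e2.
have /(plane_eq0 d4) {}e1 := addrI (om b) (etrans e1 (esym (addr0 _))).
have /(plane_eq0 d4) {}e2 := addrI (om (~~ b)) (etrans e2 (esym (addr0 _))).
move: e1 e2 lt m_gt0; rewrite /m0 /rot.
move: cP; rewrite !inE !xpair_eqE.
case/or4P=> [|||/or3P[||]] /andP[/eqP -> /eqP ->];
  case: m => [|[|[|[|[|[|k]]]]]] //=; by move=> [? ?] [? ?].
Qed.

Section Walks.

Variable K : fieldType.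
Implicit Types chi : P -> K.

Definition chi_refl b chi : P -> K := fun l => chi (sl b l).

(* The weights met along the alternating walk around the rank two Weyl group
   that starts with the reflection b; [edge b chi n] is the value of the n-th
   weight at the root of the reflection applied next. *)
Fixpoint walk b chi n : P -> K :=
  if n is k.+1 then chi_refl (letter b k) (walk b chi k) else chi.

Definition edge b chi n : K := walk b chi n (al (letter b n)).

Lemma chi_reflK b : involutive (chi_refl b).
Proof. by move=> chi; apply/funext => l; rewrite /chi_refl slK. Qed.

Lemma character_refl b chi : character chi -> character (chi_refl b chi).
Proof.
by case=> h1 h2; split=> [l|l k]; [exact: h1|rewrite /chi_refl slD h2].
Qed.

Lemma character_walk b chi n : character chi -> character (walk b chi n).
Proof. by move=> h; elim: n => [|n IH] //=; exact: character_refl. Qed.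

Lemma walkD b chi j k : walk b chi (j + k) = walk (letter b j) (walk b chi j) k.
Proof.
by elim: k => [|k IH]; rewrite ?addn0 // addnS /= IH letterD.
Qed.

Lemma edgeD b chi j k : edge b chi (j + k) = edge (letter b j) (walk b chi j) k.
Proof. by rewrite /edge walkD letterD. Qed.

Lemma walk_rev b chi n k : (k <= n)%N ->
  walk (letter (~~ b) n) (walk b chi n) k = walk b chi (n - k).
Proof.
have walkE c psi r : walk c psi r = word chi_refl c r psi by elim: r => //= r ->.
by rewrite !walkE; exact/word_rev/chi_reflK.
Qed.

Lemma edge_back b chi n : character chi ->
  walk b chi n.+1 (al (letter b n)) = (edge b chi n)^-1.
Proof.
move=> h; rewrite /= /chi_refl sl_al (charN (character_walk _ _ h)).
by [].
Qed.

Lemma edge_rev b chi n k : character chi -> (k < n)%N ->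
  edge (letter (~~ b) n) (walk b chi n) k = (edge b chi (n - k.+1))^-1.
Proof.
move=> h kn; rewrite /edge walk_rev 1?ltnW //.
rewrite subnS; have : (0 < n - k)%N by rewrite subn_gt0.
case E: (n - k)%N => [//|j] _ /=.
have -> : letter (letter (~~ b) n) k = letter b j.
  have -> : n = (j.+1 + k)%N by lia.
  by rewrite letterD letterK letterN letterS negbK.
exact: edge_back.
Qed.

Lemma walk2 b chi k :
  walk b chi k.*2 = fun l => chi (iter k (sl b \o sl (~~ b)) l).
Proof.
elim: k => [|k IH]; first by [].
apply/funext => l; rewrite doubleS /= IH /chi_refl.
rewrite /letter odd_double addbF /= odd_double addbT.
by congr chi; rewrite -[RHS]/(iter k.+1 (sl b \o sl (~~ b)) l) iterSr.
Qed.

Lemma walk_2m b chi : walk b chi m.*2 = chi.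
Proof. by rewrite walk2; apply/funext => l; rewrite order_sl. Qed.

(** A walk evaluates chi at the transform of a root, on which the last reflection of the walk acts
    first; hence the parity test on k while n decreases. *)
Definition plane_word (a a' : int) : nat -> int * int -> int * int :=
  fix pw n pr := if n is k.+1 then
    pw k (if odd k then (pr.1, - pr.2 - a * pr.1) else (- pr.1 - a' * pr.2, pr.2))
  else pr.

Lemma walk_plane b chi n p r : walk b chi n (plane b p r) =
  let pr := plane_word (ca b) (ca (~~ b)) n (p, r) in chi (plane b pr.1 pr.2).
Proof.
elim: n => [|n IH] //= in p r *; rewrite /chi_refl /letter.
have [on|on] := boolP (odd n); rewrite ?addbT ?addbF.
  have := sl_plane2 b 0 p r; rewrite !add0r co0 subr0 => ->; exact: IH.
by have := sl_plane1 b 0 p r; rewrite !add0r co0 subr0 => ->; exact: IH.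
Qed.

(** The longest element maps simple roots to negatives of simple roots. After moving the start to
    step n this is a computation for each Cartan pair. *)
Lemma edge_antipode b chi n : character chi ->
  edge b chi (n + m) = (edge b chi n)^-1.
Proof.
move=> h; rewrite edgeD -[n in RHS]addn0 edgeD.
have {h} := character_walk b n h; move: (walk b chi n) (letter b n) => {}chi {}b h.
rewrite {2}/edge letter0 /= -charN // /edge.
have -> : al (letter b m) = if odd m then plane b 0 1 else plane b 1 0.
  by rewrite /letter /plane; case: (odd m); rewrite ?addbT ?addbF mulr0z mulr1z
    ?add0r ?addr0.
have -> : - al b = plane b (-1) 0 by rewrite /plane mulr0z addr0 mulrNz mulr1z.
rewrite -(fun_if (fun z : int * int => plane b z.1 z.2) (odd m) (0, 1) (1, 0)).
rewrite walk_plane -surjective_pairing (m_coxeter b) /=.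
have := cartanP' b; rewrite !inE !xpair_eqE.
by case/or4P=> [|||/or3P[||]] /andP[/eqP -> /eqP ->].
Qed.

(** The second walk is the first one run backwards around the closed cycle of 2 m steps. Reversing
    an edge inverts its value, and so does passing to the opposite edge. *)
Lemma edge_side chi l : character chi -> (l < m)%N ->
  edge false chi l = edge true chi (m - l.+1).
Proof.
move=> h lm; rewrite -[edge true _ _]invrK -edge_antipode //.
have -> : (m - l.+1 + m)%N = (m.*2 - l.+1)%N by rewrite -addnn; lia.
rewrite -(@edge_rev true) ?walk_2m //; last by rewrite -addnn; lia.
by rewrite /letter odd_double.
Qed.

(** A walk of odd length is a palindrome: peeling off its outer letters leaves one reflection fixing
    the middle character, and evaluation at the fundamental weight gives the value 1 on its root. *)
Lemma fold_walk b chi r : walk b chi r.*2.+1 = chi -> character chi ->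
  edge b chi r = 1.
Proof.
elim: r => [|r IH] in b chi *.
  rewrite /= /edge letter0 /= => e h.
  have := congr1 (fun g => g (om b)) e; rewrite /chi_refl sl_om charD // => e1.
  have := char_neq0 h (om b); move: e1; rewrite charN // => /(canRL (mulKf _)).
  move=> e1 /[dup] h0 /e1; rewrite mulVf // => /(congr1 GRing.inv).
  by rewrite invrK invr1.
move=> e h; have e1 : walk b chi 1 = chi_refl b chi by rewrite /= letter0.
have := IH (~~ b) (chi_refl b chi).
have <- : letter b 1 = ~~ b by rewrite letterS letter0.
rewrite -e1 -edgeD add1n; apply; last by apply: character_walk.
rewrite -walkD add1n; move: e; rewrite doubleS /=.
have -> : letter b r.*2.+2 = b by rewrite /letter /= negbK odd_double addbF.
by move=> /(congr1 (chi_refl b)); rewrite chi_reflK letter0.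
Qed.

Lemma walk_period b chi r k : walk b chi r.*2 = chi -> walk b chi (k * r).*2 = chi.
Proof.
move=> h; elim: k => [|k IH]; first by rewrite mul0n.
rewrite mulSn doubleD walkD h; suff -> : letter b r.*2 = b by [].
by rewrite /letter odd_double addbF.
Qed.

(** Bezout with the full turn of 2 m steps; this leaves only rotations by divisors of m to
    examine. *)
Lemma walk_gcd b chi r : (0 < r)%N -> walk b chi r.*2 = chi ->
  walk b chi (gcdn r m).*2 = chi.
Proof.
move=> r0 h; have [u v uv _] := egcdnP m r0.
have := walk_period u h; rewrite uv addnC doubleD walkD => e.
have := walk_period v (walk_2m b (walk b chi (gcdn r m).*2)).
have lb : letter b (gcdn r m).*2 = b by rewrite /letter odd_double addbF.
by rewrite lb in e; rewrite e.
Qed.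

Lemma walk_om b chi g : character chi -> walk b chi g.*2 = chi -> forall l,
  let pr := iter g (rot b (co b l) (co (~~ b) l)) (0, 0) in
  chi (al b) ^ pr.1 * chi (al (~~ b)) ^ pr.2 = 1.
Proof.
move=> h e l pr; have := congr1 (fun g => g l) e; rewrite walk2 iter_rot -/pr /=.
rewrite charD // -[RHS]mulr1 => /(mulfI (char_neq0 h l)).
by rewrite /plane charD // !charMz.
Qed.

(* The rank two case of Steinberg's theorem on stabilizers. *)
Lemma rotation_walk b chi r : character chi -> (0 < r < m)%N ->
  walk b chi r.*2 = chi -> exists2 l, (l < r.*2)%N & edge b chi l = 1.
Proof.
move=> h /andP[r0 rm] /(walk_gcd r0).
have gr : (gcdn r m <= r)%N := dvdn_leq r0 (dvdn_gcdl r m).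
have gm : (gcdn r m %| m)%N := dvdn_gcdr r m.
have g0 : (0 < gcdn r m)%N by rewrite gcdn_gt0 r0.
move: (gcdn r m) gr gm g0 => g gr gm g0 e.
suff [l lg le] : exists2 l, (l < g.*2)%N & edge b chi l = 1.
  by exists l => //; apply: leq_trans lg _; rewrite leq_double.
have gltm : (g < m)%N := leq_ltn_trans gr rm.
have e1 := walk_om h e (om b); have e2 := walk_om h e (om (~~ b)).
have co_omN' : co b (om (~~ b)) = 0 by rewrite -{1}(negbK b) co_omN.
rewrite co_om co_omN in e1; rewrite co_om co_omN' in e2.
have u0 := char_neq0 h (al b); have v0 := char_neq0 h (al (~~ b)).
have eE n : edge b chi n = let pr := plane_word (ca b) (ca (~~ b)) n
    (if odd n then (0, 1) else (1, 0)) in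
    chi (al b) ^ pr.1 * chi (al (~~ b)) ^ pr.2.
  rewrite /edge.
  have -> : al (letter b n) = if odd n then plane b 0 1 else plane b 1 0.
    by rewrite /letter /plane; case: (odd n); rewrite ?addbT ?addbF mulr0z mulr1z
      ?add0r ?addr0.
  rewrite -(fun_if (fun z : int * int => plane b z.1 z.2) (odd n) (0, 1) (1, 0)).
  by rewrite walk_plane -surjective_pairing /plane charD // !charMz.
move: (eE 0%N) (eE 1%N) (eE 2%N) e1 e2 (m_coxeter b) (cartanP' b); rewrite /rot.
move: (chi (al b)) (chi (al (~~ b))) u0 v0 => u v u0 v0.
rewrite !inE !xpair_eqE => eE0 eE1 eE2 e1 e2 mE.
case/or4P=> [|||/or3P[||]] /andP[/eqP ca1 /eqP ca2]; move: eE0 eE1 eE2 e1 e2 mE.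
all: rewrite ca1 ca2 /= /coxeter_of /= => eE0 eE1 eE2 e1 e2 mE.
all: move: gm gltm eE0 eE1 eE2 e1 e2; rewrite mE.
all: case: g {gr e} g0 => [|[|[|[|[|[|g]]]]]] // _ _ _ /=.
all: move=> eE0 eE1 eE2 e1 e2.
all: have inv1 (x y : K) : x^-1 * y^-1 = 1 -> x * y = 1
  by rewrite -invfM => /eqP; rewrite invr_eq1 => /eqP.
all: try by exists 0%N => //; rewrite eE0 -[LHS]/(u * 1);
  apply: inv1; rewrite invr1; exact: e1.
- by exists 1%N => //; rewrite eE1 -[LHS]/(u ^+ 2 * v); apply: inv1; exact: e1.
- exists 0%N => //; rewrite eE0 -[LHS]/(u * 1) mulr1.
  have {}e1 : u ^+ 2 * v ^+ 2 = 1 by apply: inv1; exact: e1.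
  have {}e2 : u * v ^+ 2 = 1 by apply: inv1; exact: e2.
  by rewrite -e1 expr2 -mulrA e2 mulr1.
- by exists 1%N => //; rewrite eE1 -[LHS]/(u ^+ 3 * v); apply: inv1; exact: e1.
(* The half turn of G2, which acts as -1: u and v are both signs, and whichever they are, one of the
   edges u, u^3 v, u^2 v has value 1. *)
- have {}e1 : u ^+ 4 * v ^+ 2 = 1 by apply: inv1; exact: e1.
  have {}e2 : u ^+ 6 * v ^+ 4 = 1 by apply: inv1; exact: e2.
  have u2 : u ^+ 2 = 1.
    by rewrite -[LHS]mulr1 -{1}e2 -[RHS]mulr1 -{2}e1 -{1}e1; ring.
  have v2 : v ^+ 2 = 1.
    by rewrite -e1 (exprM u 2 2) u2 expr1n mul1r.
  move: u2 v2 => /eqP; rewrite sqrf_eq1 => /orP[/eqP uE _|/eqP uE /eqP].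
    by exists 0%N => //; rewrite eE0 -[LHS]/(u * 1) uE mulr1.
  rewrite sqrf_eq1 => /orP[] /eqP vE.
    by exists 2%N => //; rewrite eE2 -[LHS]/(u ^+ 2 * v) uE vE; ring.
  by exists 1%N => //; rewrite eE1 -[LHS]/(u ^+ 3 * v) uE vE; ring.
- exists 0%N => //; rewrite eE0 -[LHS]/(u * 1) mulr1.
  have {}e1 : u ^+ 3 * v ^+ 3 = 1 by apply: inv1; exact: e1.
  have {}e2 : u ^+ 2 * v ^+ 3 = 1 by apply: inv1; exact: e2.
  by rewrite -e1 exprS -mulrA e2 mulr1.
- have {}e1 : u ^+ 4 * v ^+ 6 = 1 by apply: inv1; exact: e1.
  have {}e2 : u ^+ 2 * v ^+ 4 = 1 by apply: inv1; exact: e2.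
  have v2 : v ^+ 2 = 1.
    by rewrite -[LHS]mulr1 -{1}e1 -[RHS]mulr1 -{2}e2 -{1}e2; ring.
  have u2 : u ^+ 2 = 1.
    by rewrite -e2 (exprM v 2 2) v2 expr1n mulr1.
  move: u2 v2 => /eqP; rewrite sqrf_eq1 => /orP[/eqP uE _|/eqP uE /eqP].
    by exists 0%N => //; rewrite eE0 -[LHS]/(u * 1) uE mulr1.
  rewrite sqrf_eq1 => /orP[] /eqP vE.
    by exists 2%N => //; rewrite eE2 -[LHS]/(u ^+ 2 * v ^+ 3) uE vE; ring.
  by exists 1%N => //; rewrite eE1 -[LHS]/(u * v) uE vE; ring.
Qed.

Lemma walk_neq b chi N : character chi -> (0 < N)%N -> (N < m.*2)%N ->
  (forall l, (l < N)%N -> edge b chi l <> 1) -> walk b chi N <> chi.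
Proof.
move=> h N0 Nm reg; have := odd_double_half N; case: (odd N) => /= NE e.
  by apply: (reg N./2); [lia|apply: fold_walk => //; rewrite -add1n NE].
have [||l ll] := @rotation_walk b chi N./2 h.
- by apply/andP; split; lia.
- by rewrite -[_.*2]add0n NE.
by apply: reg; lia.
Qed.

(** With equal first letters the longer walk continues the shorter one. With different ones,
    retracing the first walk and then following the second is a single alternating walk of n + n' <
    2 m steps; this is why one of the two lengths must be strictly below m. *)
Lemma walk_sep b n b' n' chi : character chi -> (n < m)%N -> (n' <= m)%N ->
    (forall l, (l < n)%N -> edge b chi l <> 1) ->
    (forall l, (l < n')%N -> edge b' chi l <> 1) ->
    (if b == b' then n != n' else (0 < n + n')%N) ->
  walk b' chi n' <> walk b chi n.
Proof.
move=> h nm n'm reg reg'; have [bb'|bb'] := eqVneq b b'.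
  rewrite -{b'}bb' in reg' *; rewrite neq_ltn => /orP[lt|lt].
    have -> : n' = (n + (n' - n))%N by lia.
    rewrite walkD; apply: walk_neq; [exact: character_walk|lia|lia|].
    by move=> l ll; rewrite -edgeD; apply: reg'; lia.
  move=> /esym; have -> : n = (n' + (n - n'))%N by lia.
  rewrite walkD; apply: walk_neq; [exact: character_walk|lia|lia|].
  by move=> l ll; rewrite -edgeD; apply: reg; lia.
have b'E : b' = ~~ b by move: bb'; case: (b); case: (b').
rewrite {}b'E in reg' *; move=> nn'; have w0 : walk (letter (~~ b) n) (walk b chi n) n = chi.
  by rewrite walk_rev // subnn.
have -> : walk (~~ b) chi n' = walk (letter (~~ b) n) (walk b chi n) (n + n').
  by rewrite walkD w0 letterK.
apply: walk_neq; [exact: character_walk|exact: nn'|lia|].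
move=> l ll; have [ln|nl] := ltnP l n.
  by rewrite edge_rev // => /(congr1 GRing.inv); rewrite invrK invr1; apply: reg; lia.
have -> : l = (n + (l - n))%N by lia.
by rewrite edgeD w0 letterK; apply: reg'; lia.
Qed.

(** * Transfer of the braid relation out of a calibrated module *)

Section Transfer.

Variable q : K.
Hypothesis q0 : q != 0.

(** With x = (wt)(X^alpha_i), [cf x] is (T_i)_ww, [gf x] is the coefficient of v_(s_i w), and
    [wall x] says that the root between w and s_i w belongs to P(t). *)
Definition cf (x : K) : K := (q - q^-1) / (1 - x^-1).
Definition gf (x : K) : K := q^-1 + cf x.
Definition wall (x : K) : bool := (x == q ^+ 2) || (x == q ^- 2).

Lemma invr_eq1' (x : K) : (1 - x^-1 == 0) = (x == 1).
Proof. by rewrite subr_eq0 eq_sym invr_eq1. Qed.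

Lemma cfD x : x != 0 -> x != 1 -> cf x + cf x^-1 = q - q^-1.
Proof.
move=> x0 x1; rewrite /cf invrK; field.
by rewrite q0 x0 !subr_eq0 x1 eq_sym x1.
Qed.

(** Together with [cfD] this is the quadratic relation on two neighbouring v's: T has trace q - q^-1
    and determinant -1 on their span. *)
Lemma gfM x : x != 0 -> x != 1 -> gf x * gf x^-1 = 1 + cf x * cf x^-1.
Proof.
move=> x0 x1; rewrite /gf; have e := cfD x0 x1.
move: (cf x) (cf x^-1) e => c d e.
have -> : (q^-1 + c) * (q^-1 + d) = q^-1 * q^-1 + q^-1 * (c + d) + c * d by ring.
by rewrite e; field.
Qed.

Lemma gfE x : x != 1 -> gf x = (q - q^-1 * x^-1) / (1 - x^-1).
Proof.
rewrite -invr_eq1 => x1; rewrite /gf /cf; move: x^-1 x1 => y y1.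
by field; rewrite q0 subr_eq0 eq_sym y1.
Qed.

Lemma gf_neq0 x : x != 0 -> ~~ wall x -> gf x != 0.
Proof.
move=> x0; rewrite negb_or => /andP[_ xq].
(* At 1 the convention 1/0 = 0 gives gf = q^-1. *)
have [->|x1] := eqVneq x 1.
  by rewrite /gf /cf invr1 subrr invr0 mulr0 addr0 invr_eq0.
rewrite gfE // mulf_neq0 ?invr_eq0 ?invr_eq1' //.
apply: contra xq; rewrite subr_eq0 => /eqP e.
have -> : x = q^-1 * (q * x) by rewrite mulKf.
have qx : q * x = q^-1 by rewrite {1}e mulfVK.
by rewrite qx -invfM expr2.
Qed.

Lemma gfM_wall x : x != 1 -> wall x -> gf x * gf x^-1 = 0.
Proof.
move=> x1 /orP[] /eqP xE.
  by rewrite (@gfE x^-1) ?invr_eq1 // invrK xE expr2 mulKf // subrr mul0r mulr0.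
by rewrite gfE // xE invrK expr2 mulKf // subrr !mul0r.
Qed.

Section Modules.

Variables (M : lmodType K) (X : P -> {linear M -> M}) (T : bool -> {linear M -> M}).
Hypothesis quadT : forall b y, T b (T b y) = (q - q^-1) *: T b y + y.
Hypothesis wallM : forall b chi y, character chi -> weight_vec X chi y ->
  chi (al b) = 1 -> y = 0.
Hypothesis tauM : forall b chi y, character chi -> weight_vec X chi y ->
  chi (al b) != 1 -> weight_vec X (chi_refl b chi) (T b y - cf (chi (al b)) *: y).

Hypothesis braidM : forall y, word T true m y = word T false m y.

Variables (chi : P -> K) (y0 : M).
Hypothesis hchi : character chi.
Hypothesis y0_weight : weight_vec X chi y0.
Hypothesis y0_neq0 : y0 != 0.

Definition tau b x (y : M) : M := T b y - cf x *: y.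

(* The intertwiners applied to y0, normalized so that T acts on them as on the
   v_w; where the normalizing factor gf vanishes, the walk crosses the boundary
   of the local region and 1 takes its place. *)
Fixpoint orbit b k : M :=
  if k is j.+1 then
    (if wall (edge b chi j) then 1 else (gf (edge b chi j))^-1) *:
      tau (letter b j) (edge b chi j) (orbit b j)
  else y0.

Lemma edge_neq0 b k : edge b chi k != 0.
Proof. exact: char_neq0 (character_walk b k hchi) _. Qed.

Lemma orbit_weight b k : weight_vec X (walk b chi k) (orbit b k).
Proof.
elim: k => [|k IH] //=; apply: weight_vecZ; rewrite /tau.
have [e1|] := eqVneq (edge b chi k) 1; last by apply: tauM => //; exact: character_walk.
rewrite (wallM (character_walk b k hchi) IH e1) linear0 scaler0 subrr.
exact: weight_vec0.
Qed.

Lemma orbit_wall b k : edge b chi k = 1 -> orbit b k = 0.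
Proof. exact: wallM (character_walk b k hchi) (orbit_weight b k). Qed.

Lemma tau_tau b x (y : M) : x != 0 -> x != 1 ->
  tau b x^-1 (tau b x y) = (gf x * gf x^-1) *: y.
Proof.
move=> x0 x1; rewrite gfM // /tau linearB linearZ /= quadT scalerBr scalerA.
have -> : q - q^-1 = cf x + cf x^-1 by rewrite cfD.
rewrite !scalerDl scale1r (mulrC (cf x)) opprB.
move: (_ *: T b y) (_ *: T b y) (_ *: y) => u v w.
by rewrite (AC (3*1*2) (1*4*(2*6)*(3*5))) /= !subrr !add0r.
Qed.

Lemma tauZ b x c (y : M) : tau b x (c *: y) = c *: tau b x y.
Proof. by rewrite /tau linearZ /= scalerBr !scalerA (mulrC c). Qed.

Lemma orbit_out b k : T (letter b k) (orbit b k) =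
  cf (edge b chi k) *: orbit b k +
  (if wall (edge b chi k) then 1 else gf (edge b chi k)) *: orbit b k.+1.
Proof.
rewrite /= scalerA /tau; case: ifPn => [_|nw].
  by rewrite mulr1 scale1r addrC subrK.
by rewrite divff ?gf_neq0 ?edge_neq0 // scale1r addrC subrK.
Qed.

(** Going back composes two intertwiners into the scalar gf x * gf x^-1. It vanishes at a wall, so
    nothing returns from beyond. *)
Lemma orbit_in b k : T (letter b k) (orbit b k.+1) =
  cf (edge b chi k)^-1 *: orbit b k.+1 +
  (if wall (edge b chi k) then 0 else gf (edge b chi k)^-1) *: orbit b k.
Proof.
have [e1|ne1] := eqVneq (edge b chi k) 1.
  by rewrite /= orbit_wall // /tau linear0 scaler0 subrr !scaler0 linear0 addr0.
apply/eqP; rewrite addrC -subr_eq -/(tau _ _ _); apply/eqP.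
rewrite -[LHS]/(tau (letter b k) (edge b chi k)^-1 (orbit b k.+1)) /=.
rewrite tauZ tau_tau ?edge_neq0 // scalerA.
case: ifPn => w; first by rewrite mul1r gfM_wall.
by rewrite mulKf ?gf_neq0 ?edge_neq0.
Qed.

Definition clear b k := all (fun j => ~~ wall (edge b chi j)) (iota 0 k).

Lemma clearS b k : clear b k.+1 = clear b k && ~~ wall (edge b chi k).
Proof. by rewrite /clear -addn1 iotaD all_cat /= andbT. Qed.

Lemma clear_orbit b k : clear b k -> orbit b k != 0.
Proof.
elim: k => [|k IH] //; rewrite clearS => /andP[/IH ok nw].
have ne1 : edge b chi k != 1 by apply: contraNneq ok => /orbit_wall ->.
have := tau_tau (letter b k) (orbit b k) (edge_neq0 b k) ne1.
apply: contra_eq_neq => /= /eqP; rewrite (negPf nw) scaler_eq0 invr_eq0.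
rewrite (negPf (gf_neq0 (edge_neq0 b k) nw)) /= => /eqP ->.
rewrite /tau linear0 scaler0 subrr eq_sym scaler_eq0 (negPf ok) orbF mulf_neq0 //.
  exact: gf_neq0 (edge_neq0 b k) nw.
apply: gf_neq0; first by rewrite invr_eq0 edge_neq0.
by move: nw; rewrite /wall !(inv_eq invrK) invrK orbC.
Qed.

(** An edge of value 1 kills the vector there and all later ones, so a nonzero vector certifies the
    regularity that [walk_sep] asks for. *)
Lemma orbit_regular b k : orbit b k != 0 -> forall l, (l < k)%N -> edge b chi l <> 1.
Proof.
elim: k => [|k IH] ok l; first by rewrite ltn0.
have ok' : orbit b k != 0.
  by apply: contraNneq ok => /= ->; rewrite /tau linear0 scaler0 subrr scaler0.
rewrite ltnS leq_eqVlt => /orP[/eqP->|]; last exact: IH.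
by apply/eqP; apply: contraNneq ok' => /orbit_wall ->.
Qed.

Local Notation node := (bool * nat)%type.

(* Both walks start at the node (true, 0); (false, 0) is a junk node.  The end
   nodes (true, m) and (false, m) are kept apart: that [orbit] takes the same
   value there is not known in advance. *)
Definition key b k : node := if k is 0 then (true, 0%N) else (b, k).
Definition ev b k : {malg K[node]} := << key b k >>.
Definition out_coef (x : K) : K := if wall x then 1 else gf x.
Definition in_coef (x : K) : K := if wall x then 0 else gf x^-1.

(** The coefficients suit both targets. At a wall the outgoing 1 fits M by the normalization of
    [orbit] and is harmless for [psi], which is 0 beyond; the returning 0 is forced in M and is
    needed for [psi]. *)
Definition node_op (l : bool) (p : node) : {malg K[node]} :=
  let: (b, k) := p in
  if k is j.+1 then
    if l == letter b k then
      cf (edge b chi k) *: ev b k + out_coef (edge b chi k) *: ev b k.+1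
    else cf (edge b chi j)^-1 *: ev b k + in_coef (edge b chi j) *: ev b j
  else cf (edge l chi 0) *: ev l 0 + out_coef (edge l chi 0) *: ev l 1.

Definition opE l : {malg K[node]} -> {malg K[node]} := mlift (node_op l).

Definition low r (g : {malg K[node]}) :=
  forall b k, (r <= k)%N || ((b, k) == (false, 0%N)) -> g@_(b, k) = 0.

Lemma lowD r g h : low r g -> low r h -> low r (g + h).
Proof. by move=> hg hh b k rk; rewrite mcoeffD hg ?hh ?addr0. Qed.

Lemma lowZ r c g : low r g -> low r (c *: g).
Proof. by move=> hg b k rk; rewrite mcoeffZ hg ?mulr0. Qed.

Lemma lowW r r' g : (r <= r')%N -> low r g -> low r' g.
Proof.
move=> rr' hg b k /orP[rk|rk]; apply: hg; last by rewrite rk orbT.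
by rewrite (leq_trans rr' rk).
Qed.

Lemma low_ev r b k : (k < r)%N -> low r (ev b k).
Proof.
move=> kr c j rj; rewrite mcoeffU; case: eqP => // e; exfalso.
case: k kr e => [|k] kr [e1 e2]; move: rj; rewrite -{}e1 -{}e2 xpair_eqE /=.
  by rewrite orbF leqNgt kr.
by rewrite andbF orbF leqNgt kr.
Qed.

Lemma low_node l b k : low k.+2 (node_op l (b, k)).
Proof.
rewrite /node_op; case: k => [|k]; last case: ifP => _;
  apply: lowD; apply: lowZ; apply: low_ev; lia.
Qed.

Lemma low_op r l g : low r g -> low r.+1 (opE l g).
Proof.
move=> hg b k rk; rewrite raddf_sum /= big1_seq // => -[c j] /andP[_].
rewrite -mcoeff_neq0 => gcj; rewrite mcoeffZ.
have jr : (j < r)%N by rewrite ltnNge; apply: contraNN gcj => rj; rewrite hg ?rj.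
have lw : low r.+1 (node_op l (c, j)) by apply: lowW (@low_node l c j).
by rewrite lw ?mulr0.
Qed.

Definition top b r : K := \prod_(j < r) out_coef (edge b chi j).

(** A letter raises the level of a node by at most one, so the leading term only collects outgoing
    coefficients. *)
Lemma word_top b r :
  low r (word opE b r (ev b 0) - top b r *: ev b r).
Proof.
elim: r => [|r IH].
  by rewrite /top big_ord0 scale1r subrr => c k _; rewrite mcoeff0.
set g := word opE b r (ev b 0) in IH.
have -> : word opE b r.+1 (ev b 0) - top b r.+1 *: ev b r.+1 =
    opE (letter b r) (g - top b r *: ev b r) +
    (top b r * cf (edge b chi r)) *: ev b r.
  have -> : opE (letter b r) (g - top b r *: ev b r) =
      opE (letter b r) g - top b r *: node_op (letter b r) (key b r).
    by rewrite /opE linearB; congr (_ - _); rewrite linearZ /= mliftU.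
  rewrite /= -/g -addrA; congr (_ + _).
  have -> : node_op (letter b r) (key b r) =
      cf (edge b chi r) *: ev b r + out_coef (edge b chi r) *: ev b r.+1.
    by case: r {IH g} => [|r] /=; rewrite ?letter0 ?eqxx.
  by rewrite scalerDr !scalerA opprD addrAC addNr add0r /top big_ord_recr.
apply: lowD; first exact: low_op.
by apply: lowZ; exact: low_ev.
Qed.

Lemma top_side : top true m = top false m.
Proof.
rewrite /top (reindex_inj rev_ord_inj); apply: eq_bigr => j _ /=.
by rewrite edge_side.
Qed.

Lemma clear_side : clear true m = clear false m.
Proof.
have in_m k : (k < m)%N -> (m - k.+1)%N \in iota 0 m.
  by move=> km; rewrite mem_iota /=; lia.
apply/allP/allP => h j; rewrite mem_iota /= add0n => jm.
  by rewrite edge_side // h // in_m.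
have -> : j = (m - (m - j.+1).+1)%N by lia.
by rewrite -edge_side ?h ?in_m //; lia.
Qed.

Definition phi (p : node) : M := orbit p.1 p.2.

Lemma phi_key b k : phi (key b k) = orbit b k.
Proof. by case: k. Qed.

Lemma mlift_ev2 (U : lmodType K) (f : node -> U) c b k c' b' k' :
  mlift f (c *: ev b k + c' *: ev b' k') = c *: f (key b k) + c' *: f (key b' k').
Proof. by rewrite linearD !linearZ /= !mliftU. Qed.

Lemma phi_op l g : mlift phi (opE l g) = T l (mlift phi g).
Proof.
apply: (eq_malg_linear (f1 := fun g => mlift phi (opE l g))
  (f2 := fun g => T l (mlift phi g))) => [c x y|c x y|[b k]].
- by rewrite /opE !linearP.
- by rewrite !linearP.
rewrite /opE !mliftU; case: k => [|k].
  rewrite mlift_ev2 !phi_key; have := orbit_out l 0; rewrite [in T _]letter0.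
  by move=> /esym e; exact: e.
rewrite /node_op; case: eqP => [->|/eqP lb]; rewrite mlift_ev2 !phi_key.
  exact: (esym (orbit_out b k.+1)).
have -> : l = letter b k by move: lb; rewrite letterS; case: l; case: letter.
exact: (esym (orbit_in b k)).
Qed.

Section Target.

Variables (N : lmodType K) (S : bool -> {linear N -> N}) (v : bool -> nat -> N).
Hypothesis v0 : v true 0 = v false 0.
Hypothesis vm : v true m = v false m.
Hypothesis S_out : forall b k, clear b k -> S (letter b k) (v b k) =
  cf (edge b chi k) *: v b k +
  (if wall (edge b chi k) then 0 else gf (edge b chi k)) *: v b k.+1.
Hypothesis S_in : forall b k, clear b k.+1 -> S (letter b k) (v b k.+1) =
  cf (edge b chi k)^-1 *: v b k.+1 + gf (edge b chi k)^-1 *: v b k.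

Definition psi (p : node) : N := if clear p.1 p.2 then v p.1 p.2 else 0.

Lemma psi_key b k : psi (key b k) = if clear b k then v b k else 0.
Proof. by case: k => [|k] //=; case: b. Qed.

Lemma psi_out b k : S (letter b k) (psi (key b k)) =
  cf (edge b chi k) *: psi (key b k) + out_coef (edge b chi k) *: psi (key b k.+1).
Proof.
rewrite !psi_key clearS /out_coef; case: ifP => [ok|_] /=; last first.
  by rewrite linear0 !scaler0 addr0.
by rewrite S_out //; case: ifP => _ /=; rewrite ?scaler0 ?scale0r.
Qed.

Lemma psi_in b k : S (letter b k) (psi (key b k.+1)) =
  cf (edge b chi k)^-1 *: psi (key b k.+1) + in_coef (edge b chi k) *: psi (key b k).
Proof.
rewrite !psi_key clearS /in_coef; case: ifP => [/andP[ok nw]|].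
  by rewrite S_in ?clearS ?ok //= (negPf nw).
case: (clear b k) => /=; last by rewrite linear0 !scaler0 addr0.
by move=> /negbT; rewrite negbK => ->; rewrite linear0 scaler0 scale0r addr0.
Qed.

Lemma psi_op l g : mlift psi (opE l g) = S l (mlift psi g).
Proof.
apply: (eq_malg_linear (f1 := fun g => mlift psi (opE l g))
  (f2 := fun g => S l (mlift psi g))) => [c x y|c x y|[b k]].
- by rewrite /opE !linearP.
- by rewrite !linearP.
rewrite /opE !mliftU; case: k => [|k].
  rewrite mlift_ev2; have := psi_out l 0; rewrite [in S _]letter0 => <-.
  by congr (S l _); rewrite /psi /=; case: b.
rewrite [in RHS](_ : (b, k.+1) = key b k.+1) //.
rewrite /node_op; case: eqP => [->|/eqP lb]; rewrite mlift_ev2.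
  exact: (esym (psi_out b k.+1)).
have -> : l = letter b k by move: lb; rewrite letterS; case: l; case: letter.
exact: (esym (psi_in b k)).
Qed.

Lemma word_mlift (U : lmodType K) (f : node -> U) (F : bool -> U -> U) b r g :
    (forall l g, mlift f (opE l g) = F l (mlift f g)) ->
  mlift f (word opE b r g) = word F b r (mlift f g).
Proof. by move=> h; elim: r => //= r <-. Qed.

(* The difference of the two sides of the braid relation, computed in the
   formal walk module, vanishes in M; its components on the nodes not separated
   from the origin by a wall then vanish because these have distinct weights in
   M, and the top components are equal. *)
Lemma braid_transfer : word S true m (v true 0) = word S false m (v true 0).
Proof.
pose d := word opE true m (ev true 0) - word opE false m (ev true 0).
have wphi b g : mlift phi (word opE b m g) = word (fun l => T l : M -> M) b m (mlift phi g).
  exact: word_mlift phi_op.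
have wpsi b g : mlift psi (word opE b m g) = word (fun l => S l : N -> N) b m (mlift psi g).
  exact: word_mlift psi_op.
have phid : mlift phi d = 0.
  by rewrite [LHS]linearB /= !wphi mliftU braidM subrr.
have psi0 : mlift psi (ev true 0) = v true 0 by rewrite mliftU /psi.
apply/eqP; rewrite -subr_eq0; apply/eqP.
rewrite -psi0 -!wpsi -[LHS](linearB (mlift psi)) /= -/d.
(* The part of d below the end nodes; by [top_side] the end nodes have opposite coefficients in
   d. *)
pose L := d - top true m *: (ev true m - ev false m).
have lowL : low m L.
  have -> : L = (word opE true m (ev true 0) - top true m *: ev true m) -
      (word opE false m (ev false 0) - top false m *: ev false m).
    by rewrite /L /d top_side scalerBr !opprB [LHS](AC (2*2) (1*4*(3*2))).
  apply: lowD; first exact: word_top.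
  by rewrite -scaleN1r; apply: lowZ; exact: word_top.
have lowd : low m.+1 d.
  have -> : d = L + top true m *: (ev true m + (-1) *: ev false m).
    by rewrite scaleN1r subrK.
  apply: lowD; first exact: lowW lowL.
  by apply: lowZ; apply: lowD; [|apply: lowZ]; exact: low_ev.
have LE : L = d - top true m *: (ev true m - ev false m) by [].
clearbody L; clearbody d; have -> : d = L + top true m *: (ev true m - ev false m).
  by rewrite LE subrK.
rewrite linearD [X in _ + X]linearZ /= [mlift psi (_ - _)]linearB /= !mliftU.
rewrite !psi_key clear_side vm subrr scaler0 addr0.
rewrite /mlift big1_seq // => -[b k] /andP[_ Lk].
have [cl|/negPf ncl] := boolP (clear b k); last by rewrite /psi /= ncl scaler0.
exfalso; move: Lk; rewrite -mcoeff_neq0 => Lk.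
have km : (k < m)%N by rewrite ltnNge; apply: contraNN Lk => mk; rewrite lowL ?mk.
have nk0 : (b, k) != (false, 0%N).
  by apply: contraNN Lk => e; rewrite lowL // e orbT.
have dL : d@_(b, k) = L@_(b, k).
  have low_m c : (ev c m)@_(b, k) = 0.
    rewrite mcoeffU /key; case: m km => // m' km; case: eqP => // -[_ e].
    by move: km; rewrite -e ltnn.
  by rewrite LE mcoeffB mcoeffZ mcoeffB !low_m subr0 mulr0 subr0.
rewrite -dL in Lk; suff : d@_(b, k) *: phi (b, k) = 0.
  by apply/eqP; rewrite scaler_eq0 negb_or Lk clear_orbit.
(* The node singled out has level below m, but the end nodes, of level m, remain among the terms to
   be separated from it. *)
pose chis (p : node) := walk p.1 chi p.2.
apply: (@weight_component P K M X (fun u => u = 0) _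
  [seq p <- msupp d | p != (b, k)] (fun p => d@_p *: phi p) chis (walk b chi k)).
- by move=> u u' -> ->; rewrite addr0.
- by move=> c u ->; rewrite scaler0.
- by move=> l u ->; rewrite linear0.
- by move=> p; apply: weight_vecZ; exact: orbit_weight.
- by apply: weight_vecZ; exact: orbit_weight.
- apply/allP => -[b' k']; rewrite mem_filter => /andP[pk dk'].
  rewrite -mcoeff_neq0 in dk'; apply/asboolP => yk.
  have ok' : orbit b' k' != 0.
    by apply/eqP => e; apply: yk; rewrite /phi /= e scaler0.
  have k'm : (k' <= m)%N.
    by rewrite leqNgt; apply: contraNN dk' => mk; rewrite lowd ?mk.
  have nk0' : (b', k') != (false, 0%N).
    by apply: contraNN dk' => e; rewrite lowd // e orbT.
  apply: walk_sep => //.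
  + exact/orbit_regular/clear_orbit.
  + exact: orbit_regular.
  + move: pk nk0 nk0'; rewrite !xpair_eqE; case: (b); case: (b') => //=; lia.
rewrite addrC big_filter; have := phid.
by rewrite /mlift (bigD1_seq (b, k)) ?fset_uniq -?mcoeff_neq0.
Qed.

End Target.

End Modules.

End Transfer.

End Walks.

End RankTwoLattice.

(** * Chambers of a local region *)

Section Chambers.

Variables (R : realType) (V : vectType R) (n : nat) (D : root_datum V n).
Variable q : R[i].

Local Notation f := (ip D).
Local Notation rts := (Defs.roots D).
Local Notation alpha := (tnth (simple D)).
Local Notation omega := (tnth (fund D)).
Local Notation sr := (srefl D).
Local Notation cor := (coroot (ip D)).
Local Notation rho := (rho D).

#[local] Hint Resolve weyl_srefl weylV weyl_comp weyl_root : core.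

Definition cow i (l : weight D) : int := Num.floor (f (val l) (cor (alpha i))).

Lemma cowE i l : (cow i l)%:~R = f (val l) (cor (alpha i)).
Proof. by rewrite floorK //; have /weightP := valP l. Qed.

Lemma cowD i l k : cow i (l + k) = cow i l + cow i k.
Proof. by apply: (@intr_inj R); rewrite intrD !cowE ipDl. Qed.

Lemma val_simple_wt i : val (simple_wt D i) = alpha i.
Proof. by rewrite val_to_weight // root_weight // simple_root. Qed.

Definition fund_wt i : weight D := to_weight D (omega i).

Lemma val_fund_wt i : val (fund_wt i) = omega i.
Proof. by rewrite val_to_weight // fund_weight. Qed.

Lemma cow_simple i : cow i (simple_wt D i) = 2.
Proof.
by apply: (@intr_inj R); rewrite cowE val_simple_wt ip_coroot_self ?simple_neq0.
Qed.

Lemma cow_fund i j : cow i (fund_wt j) = (j == i).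
Proof. by apply: (@intr_inj R); rewrite cowE val_fund_wt fund_dual; case: eqP. Qed.

Lemma val_wact_srefl i (l : weight D) : val (wact (sr i) l) = sr i (val l).
Proof. by rewrite val_wact. Qed.

Lemma wact_srefl i (l : weight D) : wact (sr i) l = l - simple_wt D i *~ cow i l.
Proof.
apply: val_inj; rewrite val_wact_srefl sreflE raddfB /= weightMz val_simple_wt.
by rewrite -cowE scaler_int.
Qed.

Lemma wact_comp u w (l : weight D) : weyl D u -> weyl D w ->
  wact (u \o w)%VF l = wact u (wact w l).
Proof.
move=> Wu Ww; apply: val_inj; by rewrite !val_wact ?comp_lfunE //; auto.
Qed.

Lemma torus_act_comp u w (t : weight D -> R[i]) : weyl D u -> weyl D w ->
  torus_act (u \o w)%VF t = torus_act u (torus_act w t).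
Proof.
move=> Wu Ww; apply/funext => l; rewrite /torus_act -wact_comp; auto.
congr (t (wact _ l)); apply: (@weyl_invE _ _ _ D); first exact: weyl_comp.
by move=> x; rewrite !comp_lfunE (weylK Wu) (weylK Ww).
Qed.

Lemma srefl_inv i : ((sr i)^-1)%VF = sr i.
Proof. by apply: (@weyl_invE _ _ _ D); [exact: weyl_srefl|exact: sreflK]. Qed.

Lemma torus_act_srefl i w (t : weight D -> R[i]) l : weyl D w ->
  torus_act (sr i \o w)%VF t l = torus_act w t (wact (sr i) l).
Proof.
by move=> Ww; rewrite torus_act_comp // {1}/torus_act srefl_inv.
Qed.

Lemma torus_act_character w (t : weight D -> R[i]) : weyl D w -> character t ->
  character (torus_act w t).
Proof.
move=> Ww ht; split=> [l|l k]; first exact: (char_neq0 ht).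
rewrite /torus_act -(charD ht); congr t; apply: val_inj.
by rewrite weightD !(val_wact _ (weylV Ww)) weightD linearD.
Qed.

Lemma inversionsE w a : weyl D w ->
  inversions D w a <-> [/\ a \in rts, 0 < f rho a & f rho (w a) < 0].
Proof.
move=> Ww; rewrite /inversions /= pos_rootE neg_rootE.
split=> [[[ra pa] [_ na]]//|[ra pa na]]; do !split=> //.
exact: weyl_root.
Qed.

Variables (t : weight D -> R[i]) (J : set V).
Hypothesis ht : character t.

Local Notation F := (chambers q t J).

Lemma chamber_weyl w : F w -> weyl D w. Proof. by case. Qed.

Lemma chamber_Z w a : F w -> Zset t a -> 0 < f rho (w a).
Proof.
move=> [Ww FZ _] Za; have [/pos_rootE[ra pa] _] := Za.
rewrite ltNge le_eqVlt (negPf (root_sign (weyl_root Ww ra))) /=; apply/negP => na.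
have : (inversions D w `&` Zset t) a by split=> //; apply/inversionsE.
by rewrite FZ.
Qed.

Lemma chamber_P w w' a : F w -> F w' -> Pset q t a ->
  (f rho (w a) < 0) = (f rho (w' a) < 0).
Proof.
move=> [Ww _ FJ] [Ww' _ FJ'] Pa; have [/pos_rootE[ra pa] _] := Pa.
apply/idP/idP => na.
  have : (inversions D w `&` Pset q t) a by split=> //; apply/inversionsE.
  by rewrite FJ -FJ' => -[/inversionsE[]].
have : (inversions D w' `&` Pset q t) a by split=> //; apply/inversionsE.
by rewrite FJ' -FJ => -[/inversionsE[]].
Qed.

(* The positive root orthogonal to the wall between w and s_i w. *)
Definition wall_root w i : V :=
  let a := (w^-1)%VF (alpha i) in if 0 < f rho a then a else - a.

Lemma wall_root_pos w i : weyl D w ->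
  wall_root w i \in rts /\ 0 < f rho (wall_root w i).
Proof.
move=> Ww; have ra : (w^-1)%VF (alpha i) \in rts.
  by apply: weyl_root; [exact: weylV|exact: simple_root].
rewrite /wall_root /=; case: ifPn => // na; split; first exact: root_opp.
by rewrite ipNr oppr_gt0 lt_neqAle root_sign // leNgt.
Qed.

(** s_i changes the sign only of alpha_i and its opposite, and w takes just one positive root, the
    wall root, to one of these. *)
Lemma srefl_sign w i a : weyl D w -> a \in rts -> 0 < f rho a ->
  a != wall_root w i -> (f rho (sr i (w a)) < 0) = (f rho (w a) < 0).
Proof.
move=> Ww ra pa ne; have rwa := weyl_root Ww ra.
have inv b : w a = b -> a = (w^-1)%VF b by move=> <-; rewrite (weylK Ww).
have ne1 : w a != alpha i.
  apply: contraNneq ne => /inv aE; rewrite /wall_root /= -aE pa //.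
have ne2 : - w a != alpha i.
  apply: contraNneq ne => /(canRL (@opprK _)) /inv aE.
  have wa : (w^-1)%VF (alpha i) = - a by rewrite aE linearN opprK.
  by rewrite /wall_root /= wa ipNr oppr_gt0 ltNge ltW // opprK.
have [p|] := ltP 0 (f rho (w a)).
  by rewrite !ltNge !ltW // srefl_pos.
rewrite le_eqVlt (negPf (root_sign rwa)) /= => na.
have := srefl_pos (root_opp rwa); rewrite ipNr oppr_gt0 => /(_ _ na ne2).
by rewrite linearN ipNr oppr_gt0 na => ->.
Qed.

Lemma srefl_sign_wall w i : weyl D w ->
  (f rho (sr i (w (wall_root w i))) < 0) = ~~ (f rho (w (wall_root w i)) < 0).
Proof.
move=> Ww; rewrite /wall_root /=; case: ifP => _; rewrite ?linearN /= (weylVK Ww) //.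
  by rewrite reflection_self ?simple_neq0 // ipNr oppr_lt0 -leNgt ltW ?pos_simple.
rewrite reflection_self ?simple_neq0 // !ipNr opprK oppr_lt0.
by rewrite pos_simple ltNge ltW ?pos_simple.
Qed.

Lemma char_wall_root w i : weyl D w ->
  t (to_weight D (wall_root w i)) = torus_act w t (simple_wt D i) \/
  t (to_weight D (wall_root w i)) = (torus_act w t (simple_wt D i))^-1.
Proof.
move=> Ww; have e : wact (w^-1)%VF (simple_wt D i) = to_weight D ((w^-1)%VF (alpha i)).
  by rewrite /wact val_simple_wt.
rewrite /torus_act e /wall_root /=; case: ifP => _; [by left|right].
rewrite -charN //; congr t; apply: val_inj; rewrite raddfN /=.
have ra : (w^-1)%VF (alpha i) \in rts by apply: weyl_root; [exact: weylV|exact: simple_root].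
by rewrite !val_to_weight // root_weight // root_opp.
Qed.

Lemma chamber_srefl w i : F w -> ~ Zset t (wall_root w i) ->
  ~ Pset q t (wall_root w i) -> F (sr i \o w)%VF.
Proof.
move=> Fw nZ nP; have [Ww FZ FJ] := Fw; have Wsw := weyl_comp (weyl_srefl D i) Ww.
have same S : ~ S (wall_root w i) -> (forall a, S a -> pos_root D a) ->
    inversions D (sr i \o w)%VF `&` S = inversions D w `&` S.
  move=> nS Spos; apply/seteqP; split=> a [ia Sa]; split=> //; move: ia.
    have /pos_rootE[ra pa] := Spos _ Sa.
    move=> /(inversionsE _ Wsw)[_ _]; rewrite comp_lfunE srefl_sign //.
      by move=> na; apply/inversionsE.
    by apply/eqP => aE; apply: nS; rewrite -aE.
  have /pos_rootE[ra pa] := Spos _ Sa.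
  move=> /(inversionsE _ Ww)[_ _] na; apply/(inversionsE _ Wsw).
  split=> //; rewrite comp_lfunE srefl_sign //.
  by apply/eqP => aE; apply: nS; rewrite -aE.
by split=> //; rewrite same // => a [].
Qed.

Lemma chamber_srefl_wall w i : F w -> Pset q t (wall_root w i) ->
  ~ F (sr i \o w)%VF.
Proof.
move=> Fw Pa Fsw; have := chamber_P Fw Fsw Pa.
rewrite comp_lfunE srefl_sign_wall; last exact: chamber_weyl Fw.
by case: (_ < _).
Qed.

Lemma wall_inv (x : R[i]) : wall q x^-1 = wall q x.
Proof. by rewrite /wall !(inv_eq invrK) invrK orbC. Qed.

Lemma chamber_sreflE w i : F w -> torus_act w t (simple_wt D i) <> 1 ->
  F (sr i \o w)%VF <-> ~~ wall q (torus_act w t (simple_wt D i)).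
Proof.
move=> Fw x1; have Ww := chamber_weyl Fw; have pr := wall_root_pos i Ww.
have wallE : Pset q t (wall_root w i) <-> wall q (torus_act w t (simple_wt D i)).
  have -> : wall q (torus_act w t (simple_wt D i)) =
      wall q (t (to_weight D (wall_root w i))).
    by case: (char_wall_root i Ww) => ->; rewrite ?wall_inv.
  split=> [[_ [->|->]]|/orP[] /eqP e]; rewrite /wall ?eqxx ?orbT //.
    by split; [apply/pos_rootE|left].
  by split; [apply/pos_rootE|right].
split=> [Fs|nw].
  by apply/negP => /wallE /(chamber_srefl_wall Fw).
apply: chamber_srefl => //; last by move/wallE; rewrite (negPf nw).
move=> [_ e]; case: (char_wall_root i Ww); rewrite e => xE; apply: x1 => //.
by rewrite -[LHS]invrK -xE invr1.
Qed.

(** A shortest gallery from w to w' stays in the region: each wall it crosses separates the two,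
    whereas both are on the same side of every wall from Z(t) or P(t). *)
Lemma chamber_connected (Q : 'End(V) -> Prop) w : F w -> Q w ->
    (forall u i, F u -> Q u -> F (sr i \o u)%VF -> Q (sr i \o u)%VF) ->
  forall w', F w' -> Q w'.
Proof.
move=> Fw Qw Qs w' Fw'; have Ww' := chamber_weyl Fw'.
have [N] := ubnP (npos D (fun a => f rho (w' ((w^-1)%VF a)) < 0)).
elim: N => // N IHN in w Fw Qw *; rewrite ltnS => hN.
have Ww := chamber_weyl Fw; have WV := weylV Ww.
have [h|/existsNP[i hi]] :=
    pselect (forall i, 0 < f rho (w' ((w^-1)%VF (alpha i)))).
  suff -> : w' = w by [].
  have e : (w' \o w^-1)%VF = \1%VF.
    by apply: weyl_pos_id => [|i]; rewrite ?comp_lfunE //; exact: weyl_comp.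
  apply/lfunP => x; have := congr1 (fun g : 'End(V) => g (w x)) e.
  by rewrite comp_lfunE id_lfunE (weylK Ww).
have ri : w' ((w^-1)%VF (alpha i)) \in rts.
  by do 2![apply: weyl_root => //]; exact: simple_root.
have {}hi : f rho (w' ((w^-1)%VF (alpha i))) < 0.
  by rewrite lt_neqAle root_sign //= leNgt; apply/negP.
have flip : (f rho (w' (wall_root w i)) < 0) = ~~ (f rho (w (wall_root w i)) < 0).
  rewrite /wall_root /=; case: ifP => _; rewrite ?[w (- _)]linearN ?[w' (- _)]linearN /= (weylVK Ww) //.
    by rewrite hi -leNgt ltW // pos_simple.
  by rewrite !ipNr !oppr_lt0 pos_simple ltNge ltW.
have Fs : F (sr i \o w)%VF.
  apply: chamber_srefl => //.
    move=> Za; move: flip; rewrite !ltNge !ltW //; exact: chamber_Z Za.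
  by move=> Pa; move: flip; rewrite (chamber_P Fw Fw' Pa); case: (_ < _).
apply: (IHN (sr i \o w)%VF) => //; first exact: Qs.
apply: leq_trans hN.
have invE : ((sr i \o w)^-1)%VF = (w^-1 \o sr i)%VF.
  apply: (@weyl_invE _ _ _ D); first exact: chamber_weyl Fs.
  by move=> x; rewrite !comp_lfunE sreflK (weylK Ww).
rewrite invE; set phi := fun a => f rho (w' ((w^-1)%VF a)) < 0.
have -> : npos D (fun a => f rho (w' ((w^-1 \o sr i)%VF a)) < 0) = npos D (phi \o sr i).
  by apply: eq_count => a; rewrite comp_lfunE.
apply: npos_srefl => // a ra; rewrite /phi [(w^-1)%VF (- _)]linearN [w' (- _)]linearN /= ipNr oppr_lt0.
have rwa : w' ((w^-1)%VF a) \in rts by do 2![apply: weyl_root => //].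
by rewrite -leNgt le_eqVlt eq_sym (negPf (root_sign rwa)).
Qed.

(** z = w^-1 w' fixes t. If it made some a in Z(t) negative, then -z a would lie in Z(t) and w would
    map it to -w' a, which is negative, against the definition of the region for w. *)
Lemma chamber_char_inj w w' : F w -> F w' -> torus_act w t = torus_act w' t ->
  w = w'.
Proof.
move=> Fw Fw' e; have Ww := chamber_weyl Fw; have Ww' := chamber_weyl Fw'.
have WV := weylV Ww; have Wz := weyl_comp WV Ww'.
have tz l : t (wact (w^-1 \o w')%VF l) = t l.
  rewrite wact_comp //; have := congr1 (fun g => g (wact w' l)) e.
  rewrite /torus_act => ->; rewrite -wact_comp; auto; congr t.
  apply: val_inj; rewrite val_wact; last by apply: weyl_comp => //; exact: weylV.
  by rewrite comp_lfunE (weylK Ww').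
suff z1 : (w^-1 \o w')%VF = \1%VF.
  apply/lfunP => x; have := congr1 (fun g : 'End(V) => w (g x)) z1.
  by rewrite comp_lfunE id_lfunE (weylVK Ww).
apply: (char_stabilizer ht) => // a Za; have [/pos_rootE[ra pa] ta] := Za.
have rza := weyl_root Wz ra.
rewrite lt_neqAle eq_sym root_sign //= leNgt; apply/negP => na.
set z := (w^-1 \o w')%VF in rza na tz.
have Zz : Zset t (- z a).
  split; first by apply/pos_rootE; rewrite ipNr oppr_gt0 root_opp.
  have -> : to_weight D (- z a) = - wact z (to_weight D a).
    apply: val_inj; rewrite raddfN /= val_wact // !val_to_weight ?root_weight //.
    exact: root_opp.
  by rewrite charN // tz ta invr1.
have := chamber_Z Fw Zz; rewrite linearN /= comp_lfunE (weylVK Ww) ipNr oppr_gt0.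
by rewrite ltNge ltW // chamber_Z.
Qed.

End Chambers.

(** * Modules over the affine Hecke algebra *)

Lemma weightN (R : realType) (V : vectType R) (n : nat) (D : root_datum V n)
    (k : weight D) :
  val (- k) = - val k.
Proof. by []. Qed.

(** * Bernstein relation, weight vectors and intertwiners *)

Section HeckeRelations.

Variables (R : realType) (V : vectType R) (n : nat) (D : root_datum V n).
Variable q : R[i].

Local Notation alpha := (simple_wt D).
Local Notation hpi := (presented_pi (hecke_rel (D := D) q)).
Local Notation hT := (@Defs.hT R V n D q).
Local Notation hX := (@Defs.hX R V n D q).
Local Notation sr := (srefl D).

Lemma hpi_rel x y : hecke_rel q x y -> hpi x = hpi y.
Proof.
move=> r; apply/presented_eqP/ideal_predP.
by have := ideal_add 1 1 r (ideal0 _); rewrite mul1r mulr1 addr0.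
Qed.

Lemma hpiM x y : hpi (x * y) = hpi x * hpi y :> hecke D q.
Proof. by rewrite -presented_piM. Qed.

Lemma hpiD x y : hpi (x + y) = hpi x + hpi y :> hecke D q.
Proof. exact: presented_piD. Qed.

Lemma hpiZ c x : hpi (c *: x) = c *: (hpi x : hecke D q).
Proof. by rewrite -presented_piZ. Qed.

Lemma hpi1 : hpi 1 = 1 :> hecke D q.
Proof. by []. Qed.

Lemma hT_quadratic i : hT i * hT i = (q - q^-1) *: hT i + 1.
Proof.
rewrite -hpiM -hpiZ -hpi1 -hpiD; apply: hpi_rel.
by rewrite -expr2; exact: rel_quadratic.
Qed.

Lemma hX0 : hX 0 = 1. Proof. by rewrite -hpi1; apply: hpi_rel; exact: rel_X0. Qed.

Lemma hXD l k : hX (l + k) = hX l * hX k.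
Proof. by rewrite -hpiM; apply/esym/hpi_rel; exact: rel_XD. Qed.

Lemma hT_braid i j m : i != j -> cox_order D i j m ->
  \prod_(k < m) hT (if odd k then j else i) = \prod_(k < m) hT (if odd k then i else j).
Proof.
move=> ij co; have pE r (F : nat -> free_hecke D) :
    \prod_(k < r) (hpi (F k) : hecke D q) = hpi (\prod_(k < r) F k).
  elim: r => [|r IH]; first by rewrite !big_ord0.
  by rewrite !big_ord_recr /= IH hpiM.
have e := hpi_rel (rel_braid q ij co).
rewrite /Defs.hT (pE m (fun k => fT D (if odd k then j else i))).
by rewrite (pE m (fun k => fT D (if odd k then i else j))).
Qed.

Lemma ga_mulE (g h : {malg R[i][weight D]}) :
  ga_mul g h = mlift (fun k => mlift (fun l => << k + l >> : {malg R[i][weight D]}) h) g.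
Proof.
apply: eq_bigr => k _; rewrite scaler_sumr; apply: eq_bigr => l _.
by rewrite malgUZ -scalerA.
Qed.

(** The Bernstein quotient is made explicit only for pairing 0, where it is 0, and for pairing 1,
    where it is X^l. By [weight_gen] the weights of pairing 0 and one of pairing 1 generate the
    lattice. *)
Lemma hX_hT_fixed i l : cow i l = 0 -> hX l * hT i = hT i * hX l.
Proof.
move=> l0; rewrite -!hpiM; apply: etrans (hpi_rel (@rel_bernstein _ _ _ _ q l i 0 _)) _.
  by rewrite ga_mulE linear0 wact_srefl l0 mulr0z subr0 subrr.
by rewrite wact_srefl l0 mulr0z subr0 msupp0 big_nil scaler0 addr0.
Qed.

Lemma hX_hT_simple i l : cow i l = 1 ->
  hX l * hT i = hT i * hX (l - alpha i) + (q - q^-1) *: hX l.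
Proof.
move=> l1; rewrite -!hpiM -hpiZ -hpiD.
apply: etrans (hpi_rel (@rel_bernstein _ _ _ _ q l i << l >> _)) _.
  by rewrite ga_mulE wact_srefl l1 mulr1z mliftU linearB /= !mliftU addr0.
rewrite wact_srefl l1 mulr1z msuppU oner_eq0 big_seq_fset1 mcoeffUU scale1r.
by [].
Qed.

Lemma mlift_ga_mul (K := R[i]) (chi : weight D -> R[i]) g h : character chi ->
  mlift (fun l => chi l : R[i]^o) (ga_mul g h) =
  mlift (fun l => chi l : R[i]^o) g * mlift (fun l => chi l : R[i]^o) h.
Proof.
move=> hchi; rewrite ga_mulE mlift_mlift /mlift mulr_suml; apply: eq_bigr => k _.
rewrite -scalerAl mulr_sumr -/(mlift _ _) mlift_mlift; congr (_ *: _).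
by apply: eq_bigr => l _; rewrite mliftU charD // scalerAr.
Qed.

Section BernsteinModule.

Variables (M : lmodType R[i]) (i : 'I_n).
Variables (actX : weight D -> {linear M -> M}) (actT : {linear M -> M}).
Hypothesis actX0 : forall y, actX 0 y = y.
Hypothesis actXD : forall l k y, actX (l + k) y = actX l (actX k y).
Hypothesis actXT_fixed : forall l y, cow i l = 0 ->
  actX l (actT y) = actT (actX l y).
Hypothesis actXT_simple : forall l y, cow i l = 1 ->
  actX l (actT y) = actT (actX (l - alpha i) y) + (q - q^-1) *: actX l y.

Lemma actXNK l y : actX (- l) (actX l y) = y.
Proof. by rewrite -actXD addNr actX0. Qed.

Lemma weight_gen (S : weight D -> Prop) :
    (forall l, cow i l = 0 -> S l) -> S (fund_wt D i) ->
    (forall l k, S l -> S k -> S (l + k)) -> (forall l, S l -> S (- l)) ->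
  forall l, S l.
Proof.
move=> S0 S1 SD SN l.
have cowB : cow i (l - fund_wt D i *~ cow i l) = 0.
  apply: (@intr_inj R); rewrite cowE raddfB /= weightMz val_fund_wt ipBl -cowE.
  by rewrite -scaler_int ipZl fund_dual eqxx mulr1 subrr.
have Sn k : S (fund_wt D i *+ k).
  elim: k => [|k IH]; last by rewrite mulrS; exact: SD.
  by rewrite mulr0n -(addNr (fund_wt D i)); apply: (SD) => //; exact: SN.
rewrite -[l](subrK (fund_wt D i *~ cow i l)); apply: SD; first exact: S0.
by case: (cow i l) => k; [exact: Sn|rewrite NegzE mulrNz; apply/SN/Sn].
Qed.

Variables (chi : weight D -> R[i]) (y : M).
Hypotheses (hchi : character chi) (hy : weight_vec actX chi y).

(** The property is multiplicative in l, so it is enough to check the generators. At omega_i the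
    extra multiple of y left by the Bernstein relation is what determines [cf]. *)
Lemma tau_weight : chi (alpha i) != 1 ->
  forall l, actX l (actT y - cf q (chi (alpha i)) *: y) =
    chi (wact (sr i) l) *: (actT y - cf q (chi (alpha i)) *: y).
Proof.
move=> x1; set c := cf _ _; set z := _ - _; apply: weight_gen.
- move=> l l0; rewrite /z linearB linearZ /=.
  rewrite actXT_fixed // !hy linearZ /= wact_srefl l0 mulr0z subr0.
  by rewrite scalerBr !scalerA mulrC.
- have w1 : cow i (fund_wt D i) = 1 by rewrite cow_fund eqxx.
  rewrite wact_srefl w1 mulr1z /z linearB linearZ [actX _ (actT _)]actXT_simple // !hy.
  rewrite [actT _]linearZ /= scalerBr -addrA; congr (_ + _).
  rewrite !scalerA -scalerBl -scaleNr; congr (_ *: _).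
  rewrite charD // charN // /c /cf; move: (chi (alpha i)) x1 (char_neq0 hchi (alpha i)).
  move=> x x1 x0; move: (q - q^-1) => k; field.
  by rewrite x0 subr_eq0.
- move=> l k hl hk; rewrite actXD hk linearZ /= hl scalerA.
  have -> : wact (sr i) (l + k) = wact (sr i) l + wact (sr i) k.
    by rewrite !wact_srefl cowD mulrzDr opprD addrACA.
  by rewrite charD // mulrC.
- move=> l hl; have := actXNK l z; rewrite hl linearZ /= => e.
  have -> : wact (sr i) (- l) = - wact (sr i) l.
    by apply: val_inj; rewrite weightN !val_wact_srefl weightN linearN.
  by rewrite charN // -[in RHS]e scalerK // char_neq0.
Qed.

Lemma wall_fund : chi (alpha i) = 1 -> actX (fund_wt D i) (actT y) =
  chi (fund_wt D i) *: actT y + ((q - q^-1) * chi (fund_wt D i)) *: y.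
Proof.
move=> x1; have w1 : cow i (fund_wt D i) = 1 by rewrite cow_fund eqxx.
rewrite actXT_simple // !hy linearZ /= charD // charN // x1 invr1 mulr1.
by rewrite scalerA.
Qed.

(* If chi kills the simple root, X acts on the span of y and T y by nontrivial
   Jordan blocks, which a calibrated module excludes. *)
Lemma wall_jordan : chi (alpha i) = 1 ->
  forall l, exists c, actX l (actT y) = chi l *: actT y + c *: y.
Proof.
move=> x1; set z := actT y; apply: weight_gen.
- move=> l l0; exists 0; rewrite scale0r addr0 /z actXT_fixed // hy linearZ.
  by [].
- by eexists; exact: wall_fund.
- move=> l k [c hc] [c' hc']; exists (chi k * c + c' * chi l).
  rewrite actXD hc' linearD !linearZ /= hc hy charD // scalerDl.
  by rewrite scalerDr !scalerA addrA (mulrC (chi k)).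
(* d is the off-diagonal entry of the inverse Jordan block. *)
- move=> l [c hc]; pose d := - ((chi l)^-1 * c * (chi l)^-1); exists d.
  have := actXNK l z; rewrite hc linearD !linearZ /= hy charN //.
  set X := actX _ _ => e; have : chi l *: X = z - (c / chi l) *: y.
    by rewrite -[in RHS]e scalerA addrK.
  move/(congr1 (fun u => (chi l)^-1 *: u)); rewrite scalerK ?char_neq0 // => ->.
  by rewrite scalerBr scalerA /d scaleNr mulrA.
Qed.

End BernsteinModule.

Section Modules.

Variables (A : set (hecke D q)) (M : lmodType R[i]) (act : hecke D q -> M -> M).
Hypotheses (subA : is_subalgebra A) (modA : is_module A act).
Hypothesis AX : forall l, A (hX l).

Lemma act_linear a : A a -> linear (act a). Proof. by case: modA => h _ _ _ _; apply: h. Qed.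

Definition actL a (Aa : A a) : {linear M -> M} :=
  HB.pack (act a) (GRing.isLinear.Build _ _ _ _ (act a) (act_linear Aa)).

Definition actX l : {linear M -> M} := actL (AX l).
#[local] Arguments actX : simpl never.

Lemma actX0 y : actX 0 y = y.
Proof. rewrite -[LHS]/(act (hX 0) y) hX0; case: modA => _ h _ _ _; exact: h. Qed.

Lemma actXD l k y : actX (l + k) y = actX l (actX k y).
Proof. rewrite -[LHS]/(act (hX (l + k)) y) hXD; case: modA => _ _ _ _ h; exact: h. Qed.

Variable i : 'I_n.
Hypothesis AT : A (hT i).

Definition actT : {linear M -> M} := actL AT.
#[local] Arguments actT : simpl never.

Lemma actM a b u : A a -> A b -> act (a * b) u = act a (act b u).
Proof. by case: modA => _ _ _ _ h; exact: h. Qed.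

Lemma actT_quadratic y : actT (actT y) = (q - q^-1) *: actT y + y.
Proof.
transitivity (act (hT i * hT i) y); first by rewrite actM.
case: modA => h1 h2 h3 h4 h5; case: subA => s1 sD sZ sM.
by rewrite hT_quadratic h3 ?h4 ?h2 //; exact: sZ.
Qed.

Lemma actXT_fixed l y : cow i l = 0 -> actX l (actT y) = actT (actX l y).
Proof.
move=> l0; transitivity (act (hX l * hT i) y); first by rewrite actM.
by rewrite hX_hT_fixed // actM.
Qed.

Lemma actXT_simple l y : cow i l = 1 ->
  actX l (actT y) = actT (actX (l - alpha i) y) + (q - q^-1) *: actX l y.
Proof.
move=> l1; transitivity (act (hX l * hT i) y); first by rewrite actM.
case: modA => h1 h2 h3 h4 h5; case: subA => s1 sD sZ sM.
rewrite hX_hT_simple // h3 ?h4 ?actM //; [exact: sM|exact: sZ].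
Qed.

Lemma act_tau chi y : character chi -> weight_vec actX chi y -> chi (alpha i) != 1 ->
  forall l, actX l (actT y - cf q (chi (alpha i)) *: y) =
    chi (wact (sr i) l) *: (actT y - cf q (chi (alpha i)) *: y).
Proof.
exact: (tau_weight actX0 actXD actXT_fixed actXT_simple).
Qed.

(** T y is a generalized weight vector, hence a weight vector by calibration; comparison with
    [wall_fund] leaves (q - q^-1) y = 0. *)
Lemma act_wall chi y : q ^+ 2 != 1 -> q != 0 -> calibrated act ->
  character chi -> weight_vec actX chi y -> chi (alpha i) = 1 -> y = 0.
Proof.
move=> q2 q0 cal hchi hy x1.
have Xz := wall_jordan actX0 actXD actXT_fixed actXT_simple hchi hy x1.
case: subA => s1 sD sZ sM; case: modA => h1 h2 h3 h4 h5.
have gz : gen_weight_space act chi (actT y).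
  move=> l; exists 2%N => //; pose h := hX l - chi l *: (1 : hecke D q).
  have hE : h = hX l + (- chi l) *: (1 : hecke D q) by rewrite scaleNr.
  have A1 : A ((- chi l) *: (1 : hecke D q)) by exact: sZ.
  have Ah : A h by rewrite hE; apply: sD.
  have acth u : act h u = actX l u - chi l *: u.
    by rewrite hE h3 // h4 // h2 scaleNr.
  rewrite -/h expr2 h5 // !acth; have [c ->] := Xz l.
  rewrite addrAC subrr add0r.
  have -> : actX l (c *: y) = c *: actX l y by rewrite linearZ.
  by rewrite hy !scalerA mulrC subrr.
rewrite cal // in gz; have := gz (fund_wt D i).
rewrite -[act _ _]/(actX (fund_wt D i) (actT y)).
rewrite (wall_fund actXT_simple hchi hy x1) => /eqP.
rewrite -subr_eq0 addrAC subrr add0r scaler_eq0 mulf_eq0 (negPf (char_neq0 hchi _)) orbF.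
case/orP => [|/eqP//]; rewrite subr_eq0 => /eqP qq.
by case/negP: q2; rewrite expr2 {2}qq divff.
Qed.

End Modules.

End HeckeRelations.

(** * Actions of algebras given by generators and relations *)

Section FreeAlgebraAction.

Variables (K : fieldType) (I : choiceType) (C : lmodType K).
Variable op : I -> {linear C -> C}.

Definition monom_act (s : seq I) (y : C) : C := foldr (fun g z => op g z) y s.

Definition free_act (a : {malg K[{fmonom I}]}) (y : C) : C :=
  mlift (fun s : {fmonom I} => monom_act s y) a.

Lemma monom_act_linear s : linear (monom_act s).
Proof. by elim: s => // g s IH c u v; rewrite [LHS](congr1 (op g) (IH c u v)) linearP. Qed.

Lemma free_act_linear a : linear (free_act a).
Proof.
move=> c u v; rewrite /free_act /mlift scaler_sumr -big_split; apply: eq_bigr => s _.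
by rewrite /= monom_act_linear scalerDr !scalerA mulrC.
Qed.

Lemma free_actP c a b y : free_act (c *: a + b) y = c *: free_act a y + free_act b y.
Proof. exact: linearP. Qed.

Lemma free_actD a b y : free_act (a + b) y = free_act a y + free_act b y.
Proof. exact: linearD. Qed.

Lemma free_actB a b y : free_act (a - b) y = free_act a y - free_act b y.
Proof. exact: linearB. Qed.

Lemma free_actZ c a y : free_act (c *: a) y = c *: free_act a y.
Proof. exact: linearZ_LR. Qed.

Lemma free_act_sum (T : Type) (s : seq T) (a : T -> {malg K[{fmonom I}]}) y :
  free_act (\sum_(k <- s) a k) y = \sum_(k <- s) free_act (a k) y.
Proof. exact: linear_sum. Qed.

Lemma free_actU (s : {fmonom I}) y : free_act << s >> y = monom_act s y.
Proof. exact: mliftU. Qed.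

Lemma free_act_gen g y : free_act << fmu g >> y = op g y.
Proof. by rewrite free_actU fmuE. Qed.

Lemma free_act1 y : free_act 1 y = y.
Proof. by rewrite free_actU fm1. Qed.

Lemma free_act0l y : free_act 0 y = 0.
Proof. exact: linear0. Qed.

Lemma free_act0r a : free_act a 0 = 0.
Proof.
by rewrite -[in LHS](subrr 0) -scaleN1r addrC free_act_linear scaleN1r addNr.
Qed.

Lemma free_actM a b y : free_act (a * b) y = free_act a (free_act b y).
Proof.
have l1 : linear (fun a => free_act (a * b) y).
  by move=> c u v; rewrite mulrDl -scalerAl free_actP.
have l2 : linear (fun a => free_act a (free_act b y)).
  by move=> c u v; rewrite free_actP.
apply: (eq_malg_linear l1 l2) => s {a l1 l2}; rewrite free_actU.
rewrite malgM_def fgmulUg free_act_sum.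
pose L : {linear C -> C} :=
  HB.pack (monom_act s) (GRing.isLinear.Build _ _ _ _ _ (monom_act_linear s)).
rewrite -[monom_act s]/(L : _ -> _) [X in L X]/free_act [X in L X]/mlift linear_sum.
apply: eq_bigr => k _; rewrite mul1r malgUZ free_actZ free_actU linearZ_LR.
by congr (_ *: _); rewrite fmM /monom_act foldr_cat.
Qed.

Variable rel : {malg K[{fmonom I}]} -> {malg K[{fmonom I}]} -> Prop.
Hypothesis op_rel : forall a b y, rel a b -> free_act a y = free_act b y.

Lemma free_act_ideal a y : ideal_of rel a -> free_act a y = 0.
Proof.
elim=> [|c u v d z uv _ IH]; first exact: free_act0l.
rewrite free_actD IH addr0 -mulrA free_actM free_actM free_actB (op_rel _ uv) subrr.
exact: free_act0r.
Qed.

Definition presented_act (u : presented rel) (y : C) : C := free_act (repr u) y.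

Lemma presented_act_pi a y : presented_act (presented_pi rel a) y = free_act a y.
Proof.
apply/eqP; rewrite -subr_eq0 -free_actB; apply/eqP/free_act_ideal.
by apply/ideal_predP/presented_eqP; exact: presented_piK.
Qed.

Lemma presented_act_linear u : linear (presented_act u).
Proof. exact: free_act_linear. Qed.

Lemma presented_act1 y : presented_act 1 y = y.
Proof. by rewrite [LHS](presented_act_pi 1) free_act1. Qed.

Lemma presented_actD u v y :
  presented_act (u + v) y = presented_act u y + presented_act v y.
Proof.
by rewrite -[in LHS](presented_piK u) -[in LHS](presented_piK v) -presented_piD
  presented_act_pi free_actD.
Qed.

Lemma presented_actZ c u y : presented_act (c *: u) y = c *: presented_act u y.
Proof.
by rewrite [LHS](presented_act_pi (c *: repr u)) free_actZ.
Qed.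

Lemma presented_actM u v y :
  presented_act (u * v) y = presented_act u (presented_act v y).
Proof.
by rewrite [LHS](presented_act_pi (repr u * repr v)) free_actM.
Qed.

End FreeAlgebraAction.

(** * The rank two system of two simple roots *)

Section RankTwoSubsystem.

Variables (R : realType) (V : vectType R) (n : nat) (D : root_datum V n).
Variables (i j : 'I_n).
Hypothesis ij : i != j.

Local Notation f := (ip D).
Local Notation alpha := (tnth (simple D)).
Local Notation cor := (coroot (ip D)).
Local Notation sr := (srefl D).

Definition pick2 (b : bool) : 'I_n := if b then i else j.
Definition al2 b := simple_wt D (pick2 b).
Definition om2 b := fund_wt D (pick2 b).
Definition co2 b := @cow _ _ _ D (pick2 b).

Lemma co2D b l k : co2 b (l + k) = co2 b l + co2 b k. Proof. exact: cowD. Qed.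

Lemma co2_al b : co2 b (al2 b) = 2. Proof. exact: cow_simple. Qed.

Lemma co2_om b : co2 b (om2 b) = 1. Proof. by rewrite /co2 cow_fund eqxx. Qed.

Lemma co2_omN b : co2 (~~ b) (om2 b) = 0.
Proof.
by rewrite /co2 cow_fund /pick2; case: b => /=; rewrite ?(negPf ij) // eq_sym (negPf ij).
Qed.

Lemma sl2E b l : sl al2 co2 b l = wact (sr (pick2 b)) l.
Proof. by rewrite wact_srefl. Qed.

(** Two integers that are nonpositive, vanish together and have product below 4. *)
Lemma cartan2P : (co2 false (al2 true), co2 true (al2 false)) \in cartan_pairs.
Proof.
have e1 : (co2 false (al2 true))%:~R = f (alpha i) (cor (alpha j)).
  by rewrite cowE val_simple_wt.
have e2 : (co2 true (al2 false))%:~R = f (alpha j) (cor (alpha i)).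
  by rewrite cowE val_simple_wt.
have := cartan_le0 D ij; have := cartan_le0 D (i := j) (j := i).
rewrite eq_sym => /(_ ij); have := cartan_prod_lt4 D ij.
have := @cartan_eq0 _ _ _ D i j; have := @cartan_eq0 _ _ _ D j i.
rewrite -e1 -e2; move: (co2 false _) (co2 true _) => a b {e1 e2}.
rewrite -intrM !lerz0 -[X in _ < X]/(4%:~R) ltr_int.
have i0 (c : int) : c%:~R = 0 :> R <-> c = 0.
  by split=> [/eqP|->//]; rewrite intr_eq0 => /eqP.
rewrite !i0 => ba ab lt4 b0 a0.
have [a_0|an0] := eqVneq a 0; first by rewrite a_0 (ab a_0).
have bn0 : b != 0 by apply: contraNneq an0 => /ba ->.
have a4 : -4 < a by nia.
have b4 : -4 < b by nia.
have : a = -1 \/ a = -2 \/ a = -3 by lia.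
have : b = -1 \/ b = -2 \/ b = -3 by lia.
move=> bE aE; move: lt4.
by case: aE => [|[|]] ->; case: bE => [|[|]] ->.
Qed.

Lemma val_iter_sl k l :
  val (iter k (sl al2 co2 true \o sl al2 co2 false) l) =
  iter k (sr i \o sr j) (val l).
Proof.
elim: k => // k IH.
transitivity (sr i (sr j (val (iter k (sl al2 co2 true \o sl al2 co2 false) l)))).
  by rewrite iterS /comp !sl2E !val_wact_srefl.
by rewrite IH.
Qed.

Lemma order2 m : cox_order D i j m ->
  iter m (sl al2 co2 true \o sl al2 co2 false) =1 id.
Proof. by move=> [_ h _] l; apply: val_inj; rewrite val_iter_sl h. Qed.

(** [cox_order] speaks of all vectors and the lattice statement only of weights; the fundamental
    weights span V, so linearity bridges the two. *)
Lemma order2_min m : cox_order D i j m -> forall k, (0 < k < m)%N ->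
  ~ iter k (sl al2 co2 true \o sl al2 co2 false) =1 id.
Proof.
move=> [_ _ hmin] k km h; apply: (hmin _ km) => x.
have itD c y z : iter k (sr i \o sr j) (c *: y + z) =
    c *: iter k (sr i \o sr j) y + iter k (sr i \o sr j) z.
  by elim: (k) => //= k' ->; rewrite !linearP.
have it0 : iter k (sr i \o sr j) 0 = 0.
  by elim: (k) => //= k' ->; rewrite !linear0.
rewrite (fund_expansion D x); elim: (index_enum _) => [|a s IH].
  by rewrite big_nil it0.
rewrite big_cons itD IH; congr (_ *: _ + _).
by rewrite -val_fund_wt -val_iter_sl h.
Qed.

End RankTwoSubsystem.

Section Scalars.

Variables (K : fieldType) (U : lmodType K).
Implicit Types (p c x a b m : K) (u v : U).

Lemma scalerCA (p c : K) (u : U) :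
  p *: (c *: u) = c *: (p *: u).
Proof. by rewrite !scalerA mulrC. Qed.

Lemma scale_add_comb (p c : K) (u v u' v' : U) :
  p *: (c *: u + v) + (c *: u' + v') = c *: (p *: u + u') + (p *: v + v').
Proof. by rewrite !scalerDr !scalerA (mulrC p) addrACA. Qed.

Lemma quadratic_wall (p x : K) (v : U) :
    p != 0 -> x != 0 -> x != 1 -> wall p x ->
  cf p x *: (cf p x *: v) = (p - p^-1) *: (cf p x *: v) + v.
Proof.
move=> p0 x0 x1 wx; rewrite !scalerA -[X in _ + X]scale1r -scalerDl; congr (_ *: _).
have := gfM p0 x0 x1; rewrite (gfM_wall p0 x1 wx) => /eqP.
rewrite eq_sym addr_eq0 => /eqP e.
by rewrite -(cfD p0 x0 x1) mulrDl e [cf p x^-1 * _]mulrC; ring.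
Qed.

Lemma quadratic_open (p x : K) (v v' : U) :
    p != 0 -> x != 0 -> x != 1 ->
  cf p x *: (cf p x *: v + gf p x *: v') +
      gf p x *: (cf p x^-1 *: v' + gf p x^-1 *: v) =
    (p - p^-1) *: (cf p x *: v + gf p x *: v') + v.
Proof.
move=> p0 x0 x1.
rewrite !scalerDr !scalerA [X in _ + X = _]addrC addrACA -!scalerDl.
rewrite -[X in _ = _ + X]scale1r [RHS]addrAC -scalerDl.
rewrite -(cfD p0 x0 x1) (gfM p0 x0 x1).
by congr (_ *: _ + _ *: _); ring.
Qed.

Lemma bernstein_scalars (p x a b m c : K) (v v' : U) :
    x != 1 -> m * (1 - x^-1) = a - b ->
  cf p x *: (a *: v) + c *: (b *: v') =
    b *: (cf p x *: v + c *: v') + (p - p^-1) *: (m *: v).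
Proof.
move=> x1 e; have mE : m = (a - b) / (1 - x^-1) by rewrite -e mulfK // invr_eq1'.
rewrite scalerDr !scalerA addrAC -scalerDl; congr (_ *: _ + _ *: _); last by rewrite mulrC.
by rewrite mE /cf; ring.
Qed.

End Scalars.

(** * Relations and irreducibility on a skew local region *)

Section SkewRegion.

Variables (R : realType) (V : vectType R) (n : nat) (D : root_datum V n).
Variable q : R[i].
Hypotheses (q0 : q != 0) (q2 : q ^+ 2 != 1).
Variables (t : weight D -> R[i]) (J : set V).
Hypothesis ht : character t.
Hypothesis skew : skew_region q t J.

Local Notation F := (chambers q t J).
Local Notation alpha := (simple_wt D).
Local Notation sr := (srefl D).
Local Notation hT := (@Defs.hT R V n D q).
Local Notation hX := (@Defs.hX R V n D q).

Lemma rank2_subalgebraP i j : is_subalgebra (@rank2_subalgebra _ _ _ D q i j).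
Proof.
by split=> [|a b ha hb|c a ha|a b ha hb] B sB BS; have [B1 BD BZ BM] := sB;
  [exact: B1|apply: BD; [exact: ha|exact: hb]|apply: BZ; exact: ha|
   apply: BM; [exact: ha|exact: hb]].
Qed.

Lemma rank2_X i j l : @rank2_subalgebra _ _ _ D q i j (hX l).
Proof. by move=> B _; apply; right; exists l. Qed.

Lemma rank2_T i j b : @rank2_subalgebra _ _ _ D q i j (hT (pick2 i j b)).
Proof. by move=> B _; apply; left; case: b; [left|right]. Qed.

Lemma chamber_char w : F w -> character (torus_act w t).
Proof. by move=> /chamber_weyl Ww; exact: torus_act_character. Qed.

(** Calibratability for the pair (i, i) supplies a calibrated module with a nonzero vector of weight
    wt, which [act_wall] would force to vanish. *)
Lemma skew_neq1 w i : F w -> torus_act w t (alpha i) <> 1.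
Proof.
move=> Fw x1; have [M [act [modA cal [y yw y0]]]] := skew Fw i i.
have := act_wall (rank2_subalgebraP i i) (modA := modA) (AX := @rank2_X i i)
  (@rank2_T i i true) q2 q0 cal (chamber_char Fw) yw x1.
by move=> yE; rewrite yE eqxx in y0.
Qed.

Lemma TcoefE w i : F w -> Tcoef q t w i = cf q (torus_act w t (alpha i)).
Proof. by move=> Fw; rewrite /Tcoef (charN (chamber_char Fw)). Qed.

Lemma srefl_wall w i : F w ->
  F (sr i \o w)%VF <-> ~~ wall q (torus_act w t (alpha i)).
Proof. by move=> Fw; apply: chamber_sreflE => //; exact: skew_neq1. Qed.

Lemma torus_srefl_simple w i : F w ->
  torus_act (sr i \o w)%VF t (alpha i) = (torus_act w t (alpha i))^-1.
Proof.
move=> Fw; rewrite torus_act_srefl; last exact: chamber_weyl Fw.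
rewrite -(charN (chamber_char Fw)).
congr (torus_act w t); apply: val_inj; rewrite val_wact_srefl val_simple_wt.
by rewrite reflection_self ?simple_neq0 // weightN val_simple_wt.
Qed.

Lemma srefl_comp2 i (w : 'End(V)) : (sr i \o (sr i \o w))%VF = w.
Proof. by apply/lfunP => x; rewrite !comp_lfunE sreflK. Qed.

Lemma chamberP (k : F) : F (val k).
Proof. by apply: set_mem; exact: valP. Qed.

Section Operators.

Variables (C : lmodType R[i]) (vs : 'End(V) -> C).
Hypothesis vs_out : forall w, ~ F w -> vs w = 0.
Hypothesis vs_neq0 : forall w, F w -> vs w != 0.
Hypothesis vs_span : forall y, exists (s : seq F) (c : F -> R[i]),
  uniq s /\ y = \sum_(k <- s) c k *: vs (val k).

Variables (opT : 'I_n -> {linear C -> C}) (opX : weight D -> {linear C -> C}).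
Hypothesis opT_vs : forall w i, F w -> opT i (vs w) =
  Tcoef q t w i *: vs w + (q^-1 + Tcoef q t w i) *: vs (sr i \o w)%VF.
Hypothesis opX_vs : forall w l, F w -> opX l (vs w) = torus_act w t l *: vs w.

Lemma vs_ext (f1 f2 : C -> C) : linear f1 -> linear f2 ->
  (forall w, F w -> f1 (vs w) = f2 (vs w)) -> f1 =1 f2.
Proof.
move=> l1 l2 e y.
pose F1 : {linear C -> C} := HB.pack f1 (GRing.isLinear.Build _ _ _ _ f1 l1).
pose F2 : {linear C -> C} := HB.pack f2 (GRing.isLinear.Build _ _ _ _ f2 l2).
rewrite -[f1]/(F1 : _ -> _) -[f2]/(F2 : _ -> _).
have [s [c [_ ->]]] := vs_span y; rewrite !linear_sum.
apply: eq_bigr => k _; rewrite !linearZ_LR; congr (_ *: _); apply: e; exact: chamberP.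
Qed.

Lemma opT_closed w i : F w -> wall q (torus_act w t (alpha i)) ->
  opT i (vs w) = cf q (torus_act w t (alpha i)) *: vs w.
Proof.
move=> Fw wx; rewrite (opT_vs i Fw) (TcoefE i Fw).
have -> : vs (sr i \o w)%VF = 0.
  by apply: vs_out => /(srefl_wall i Fw); rewrite wx.
by rewrite scaler0 addr0.
Qed.

Lemma opT_open w i : F w ->
  opT i (vs w) = cf q (torus_act w t (alpha i)) *: vs w +
    gf q (torus_act w t (alpha i)) *: vs (sr i \o w)%VF.
Proof. by move=> Fw; rewrite (opT_vs i Fw) (TcoefE i Fw). Qed.

Lemma opT_wall w i : F w -> let x := torus_act w t (alpha i) in
  opT i (vs w) = cf q x *: vs w + (if wall q x then 0 else gf q x) *: vs (sr i \o w)%VF.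
Proof.
move=> Fw x; case: ifPn => wx; last exact: opT_open.
by rewrite [X in _ + X]scale0r addr0; exact: opT_closed.
Qed.

Lemma opT_quadratic i y : opT i (opT i y) = (q - q^-1) *: opT i y + y.
Proof.
apply: (vs_ext (f1 := fun y => opT i (opT i y))
  (f2 := fun y => (q - q^-1) *: opT i y + y)) => [c u v|c u v|w Fw].
- by rewrite !linearP.
- by rewrite linearP; exact: scale_add_comb.
have x1 : torus_act w t (alpha i) != 1 by apply/eqP; exact: skew_neq1.
have x0 : torus_act w t (alpha i) != 0 := char_neq0 (chamber_char Fw) (alpha i).
case: (boolP (wall q (torus_act w t (alpha i)))) => wx.
  rewrite (opT_closed Fw wx) linearZ_LR (opT_closed Fw wx).
  exact: quadratic_wall.
have Fs : F (sr i \o w)%VF by apply/srefl_wall.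
have e := opT_open i Fs.
rewrite (srefl_comp2 i w) (torus_srefl_simple i Fw) in e.
rewrite (opT_open i Fw) linearP linearZ_LR (opT_open i Fw) e.
exact: quadratic_open.
Qed.

Lemma opX0 y : opX 0 y = y.
Proof.
apply: (vs_ext (f1 := opX 0) (f2 := id)) => [c u v|//|w Fw].
  by rewrite linearP.
by rewrite (opX_vs 0 Fw) (char0 (chamber_char Fw)) scale1r.
Qed.

Lemma opXD l k y : opX (l + k) y = opX l (opX k y).
Proof.
apply: (vs_ext (f1 := opX (l + k)) (f2 := fun y => opX l (opX k y)))
  => [c u v|c u v|w Fw].
- by rewrite linearP.
- by rewrite !linearP.
rewrite (opX_vs (l + k) Fw) (opX_vs k Fw) linearZ_LR (opX_vs l Fw).
by rewrite [RHS]scalerA (charD (chamber_char Fw) l k) [X in X *: _ = _]mulrC.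
Qed.

Lemma opX_comb (g : {malg R[i][weight D]}) w : F w ->
  \sum_(k <- msupp g) g@_k *: opX k (vs w) =
  mlift (fun l => torus_act w t l : R[i]^o) g *: vs w.
Proof.
move=> Fw; rewrite /mlift scaler_suml; apply: eq_bigr => k _.
by rewrite (opX_vs k Fw) scalerA.
Qed.

Lemma op_bernstein l i g y :
    ga_mul g (<< 0 >> - << - alpha i >>) = << l >> - << wact (sr i) l >> ->
  opX l (opT i y) = opT i (opX (wact (sr i) l) y) +
    (q - q^-1) *: \sum_(k <- msupp g) g@_k *: opX k y.
Proof.
move=> gE; apply: (vs_ext (f1 := fun y => opX l (opT i y))
  (f2 := fun y => opT i (opX (wact (sr i) l) y) +
    (q - q^-1) *: \sum_(k <- msupp g) g@_k *: opX k y)) => [c u v|c u v|w Fw].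
- by rewrite !linearP.
- have -> : \sum_(k <- msupp g) g@_k *: opX k (c *: u + v) =
      c *: (\sum_(k <- msupp g) g@_k *: opX k u) + \sum_(k <- msupp g) g@_k *: opX k v.
    rewrite scaler_sumr -big_split; apply: eq_bigr => k _.
    by rewrite linearP scalerDr; congr (_ + _); exact: scalerCA.
  rewrite (linearP (opX _)) (linearP (opT _)) [LHS]addrC scale_add_comb.
  by congr (_ *: _ + _); exact: addrC.
have hchi := chamber_char Fw.
have := congr1 (mlift (fun k => torus_act w t k : R[i]^o)) gE.
rewrite (mlift_ga_mul _ _ hchi) => e.
have x1 : torus_act w t (alpha i) != 1 by apply/eqP; exact: skew_neq1.
have {}e : mlift (fun k => torus_act w t k : R[i]^o) g * (1 - (torus_act w t (alpha i))^-1) =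
    torus_act w t l - torus_act w t (wact (sr i) l).
  rewrite -(charN hchi) -{1}(char0 hchi).
  have lE a b : mlift (fun k => torus_act w t k : R[i]^o) (<< a >> - << b >>) =
      torus_act w t a - torus_act w t b by rewrite [LHS](linearB (mlift _)) /= !mliftU.
  by rewrite -!lE.
rewrite (opX_comb _ Fw) (opX_vs (wact (sr i) l) Fw) linearZ_LR (opT_wall i Fw).
have tl : torus_act (sr i \o w)%VF t l = torus_act w t (wact (sr i) l).
  by apply: torus_act_srefl; exact: chamber_weyl Fw.
rewrite linearP linearZ_LR (opX_vs l Fw) -[RHS](bernstein_scalars _ _ _ _ x1 e).
congr (_ + _); case: ifPn => wx; first by rewrite [LHS]scale0r [RHS]scale0r.
have Fs : F (sr i \o w)%VF by apply/srefl_wall.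
by rewrite (opX_vs l Fs) tl.
Qed.

Lemma op_braid i j m y : i != j -> cox_order D i j m ->
  word (fun b => opT (pick2 i j b)) true m y = word (fun b => opT (pick2 i j b)) false m y.
Proof.
move=> ij co; have linw b r : linear (word (fun b => opT (pick2 i j b) : C -> C) b r).
  by elim: r => //= r IH c u v; rewrite IH linearP.
apply: (vs_ext (linw true m) (linw false m)) => w Fw {y}.
have [M [act [modA cal [y yw y0]]]] := skew Fw i j.
have hchi := chamber_char Fw; set chi := torus_act w t in hchi yw.
pose T b := actT modA (@rank2_T i j b); pose X := actX modA (@rank2_X i j).
have sA := rank2_subalgebraP i j.
have [m0 _ _] := co.
(* The group elements met by the walk from w. Their characters are those of [walk], and they stay in
   the region as long as [clear] holds. *)
pose u b r := word (fun b (g : 'End(V)) => (sr (pick2 i j b) \o g)%VF) b r w.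
have uS b r : u b r.+1 = (sr (pick2 i j (letter b r)) \o u b r)%VF by [].
have u0 b : u b 0 = w by [].
clearbody u.
have uW b r : weyl D (u b r).
  elim: r => [|r IH]; first by rewrite u0; exact: chamber_weyl Fw.
  by rewrite uS; apply: weyl_comp => //; exact: weyl_srefl.
have uchi b r : torus_act (u b r) t = walk (al2 D i j) (co2 i j) b chi r.
  elim: r => [|r IH]; first by rewrite u0.
  apply/funext => l; rewrite uS (torus_act_srefl _ _ _ (uW b r)) IH.
  by rewrite [RHS]/= /chi_refl sl2E.
have uF b r : clear (al2 D i j) (co2 i j) q chi b r -> F (u b r).
  elim: r => [_|r IH]; first by rewrite u0.
  rewrite clearS => /andP[/IH Fu nw]; rewrite uS.
  by apply/srefl_wall => //; rewrite uchi.
have braidM z : word (fun b => T b : M -> M) true m z = word (fun b => T b : M -> M) false m z.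
  have wp b : act (\prod_(k < m) hT (pick2 i j (letter b k))) z =
      word (fun b => T b : M -> M) (~~ letter b m) m z.
    apply: (word_prod (A := hecke D q) (Q := rank2_subalgebra i j)
      (x := fun b => hT (pick2 i j b))) => //.
    - by case: sA.
    - by case: sA.
    - by move=> b'; exact: rank2_T.
    - by have [_ h1 _ _ _] := modA.
    - by move=> a c v Aa Ac; have [_ _ _ _ h] := modA; exact: h.
  have e : \prod_(k < m) hT (pick2 i j (letter true k)) =
      \prod_(k < m) hT (pick2 i j (letter false k)).
    have := hT_braid q ij co; congr (_ = _); apply: eq_bigr => k _;
      by rewrite /letter /pick2; case: (odd k).
  (* First letters of products and of words correspond only up to the parity of m, so the equation
     may come out with its sides exchanged. *)
  have := wp false; rewrite -e wp; rewrite -[false]/(~~ true) letterN negbK.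
  by case: (letter true m) => /= ->.
rewrite -(u0 true).
apply: (@braid_transfer _ (al2 D i j) (om2 D i j) (co2 i j)
  _ _ _ _ _ m _ _ _ _ q _ M X T _ _ _ _ chi y _ _ _ C (fun b => opT (pick2 i j b))
  (fun b r => vs (u b r))) => //.
- exact: co2D.
- exact: co2_al.
- exact: co2_om.
- exact: co2_omN.
- exact: cartan2P.
- exact: order2.
- exact: order2_min.
- by move=> b z; exact: (actT_quadratic sA).
- move=> b psi z hpsi zw; exact: (act_wall sA (@rank2_T i j b) q2 q0 cal hpsi zw).
- move=> b psi z hpsi zw x1 l; rewrite /chi_refl sl2E.
  exact: (act_tau sA (@rank2_T i j b) hpsi zw x1 l).
- by rewrite !u0.
- congr vs; apply/lfunP => z.
  have uE b r : u b r z = word (fun b => sr (pick2 i j b) : V -> V) b r (w z).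
    by elim: r => [|r IH]; rewrite ?u0 // uS comp_lfunE IH.
  rewrite !uE; apply: word_braid; first by move=> b; exact: sreflK.
  by case: co.
- move=> b r /uF Fu; have := opT_wall (pick2 i j (letter b r)) Fu.
  by rewrite uS uchi.
- move=> b r; rewrite clearS => /andP[/uF Fu nw].
  have Fs : F (sr (pick2 i j (letter b r)) \o u b r)%VF.
    by apply/srefl_wall => //; rewrite uchi.
  rewrite uS; have := opT_open (pick2 i j (letter b r)) Fs.
  by rewrite (srefl_comp2 _ (u b r)) (torus_srefl_simple _ Fu) uchi.
Qed.

Section Submodule.

Variable N : C -> Prop.
Hypothesis N0 : N 0.
Hypothesis ND : forall x y, N x -> N y -> N (x + y).
Hypothesis NZ : forall (c : R[i]) x, N x -> N (c *: x).
Hypothesis NT : forall i x, N x -> N (opT i x).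
Hypothesis NX : forall l x, N x -> N (opX l x).

Lemma submodule_vs y : N y -> y != 0 -> exists2 w, F w & N (vs w).
Proof.
have [s [c [us ->]]] := vs_span y; move=> Ny y0.
have [k ks ck] : exists2 k, k \in s & c k != 0.
  apply/hasP; apply: contraNT y0 => /hasPn h; apply/eqP.
  by apply: big1_seq => k /h; rewrite negbK => /eqP ->; exact: scale0r.
exists (val k); first exact: chamberP.
have wv p : weight_vec opX (torus_act (val p) t) (c p *: vs (val p)).
  by apply: weight_vecZ => l; exact: opX_vs (chamberP p).
suff /(NZ (c k)^-1) : N (c k *: vs (val k)) by rewrite (scalerK ck).
apply: (weight_component (s := [seq p <- s | p != k])
  (y := fun p => c p *: vs (val p)) ND NZ NX wv (wv k)).
  apply/allP => p; rewrite mem_filter => /andP[pk _]; apply/asboolP => _ e.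
  case/eqP: pk; apply: val_inj.
  exact: (chamber_char_inj ht (chamberP p) (chamberP k) e).
by move: Ny; rewrite (bigD1_seq k) //= addrC big_filter.
Qed.

Lemma submodule_full y : N y -> y != 0 -> forall z, N z.
Proof.
move=> Ny y0; have [w0 Fw0 Nw0] := submodule_vs Ny y0.
have Nvs w : F w -> N (vs w).
  apply: (chamber_connected (Q := fun w => N (vs w)) Fw0 Nw0) => u i Fu Nu Fs.
  have nw : ~~ wall q (torus_act u t (alpha i)) by apply/(srefl_wall i Fu).
  have g0 := gf_neq0 q0 (char_neq0 (chamber_char Fu) (alpha i)) nw.
  rewrite -(scalerK g0 (vs (sr i \o u)%VF)); apply: NZ.
  have -> : gf q (torus_act u t (alpha i)) *: vs (sr i \o u)%VF =
      opT i (vs u) + (- cf q (torus_act u t (alpha i))) *: vs u.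
    by rewrite (opT_open i Fu) scaleNr addrAC subrr add0r.
  by apply: ND; [exact: NT|exact: NZ].
move=> z; have [s [c [_ ->]]] := vs_span z.
elim: s => [|k s IH]; first by rewrite big_nil.
by rewrite big_cons; apply: ND => //; apply: NZ; exact/Nvs/chamberP.
Qed.

End Submodule.

Lemma skew_irreducible (act : hecke D q -> C -> C) :
    (exists w, F w) -> (forall i y, act (hT i) y = opT i y) ->
    (forall l y, act (hX l) y = opX l y) ->
  irreducible act.
Proof.
move=> [w Fw] aT aX; split; first by exists (vs w); exact: vs_neq0.
move=> N N0 ND NZ NA; have [[y Ny y0]|nN] := pselect (exists2 y, N y & y != 0).
  right; apply/seteqP; split=> // z _.
  apply: (submodule_full N0 ND NZ _ _ Ny y0) => [i x Nx|l x Nx].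
    by rewrite -aT; exact: NA.
  by rewrite -aX; exact: NA.
left; apply/seteqP; split=> [y Ny|y ->//].
by apply: contrapT => /eqP y0; apply: nN; exists y.
Qed.

End Operators.

End SkewRegion.

(** * From operators satisfying the relations to a Hecke module *)

Section HeckeModule.

Variables (R : realType) (V : vectType R) (n : nat) (D : root_datum V n).
Variable q : R[i].
Variables (C : lmodType R[i]).
Variables (opT : 'I_n -> {linear C -> C}) (opX : weight D -> {linear C -> C}).

Local Notation sr := (srefl D).

Hypothesis quadratic : forall i y, opT i (opT i y) = (q - q^-1) *: opT i y + y.
Hypothesis braid : forall i j m y, i != j -> cox_order D i j m ->
  word (fun b => opT (pick2 i j b)) true m y = word (fun b => opT (pick2 i j b)) false m y.
Hypothesis X0 : forall y, opX 0 y = y.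
Hypothesis XD : forall l k y, opX (l + k) y = opX l (opX k y).
Hypothesis bernstein : forall l i g y,
    ga_mul g (<< 0 >> - << - simple_wt D i >>) = << l >> - << wact (sr i) l >> ->
  opX l (opT i y) = opT i (opX (wact (sr i) l) y) +
    (q - q^-1) *: \sum_(k <- msupp g) g@_k *: opX k y.

Definition gen_op (g : hecke_gen D) : {linear C -> C} :=
  match g with inl i => opT i | inr l => opX l end.

Local Notation fact := (@free_act R[i] (hecke_gen D) C gen_op).

Lemma free_act_fT i y : fact (fT D i) y = opT i y.
Proof. exact: (free_act_gen gen_op (inl i)). Qed.

Lemma free_act_fX l y : fact (fX l) y = opX l y.
Proof. exact: (free_act_gen gen_op (inr l)). Qed.

Lemma free_act_braid i j m y : i != j -> cox_order D i j m ->
  fact (braid_word D i j m) y = fact (braid_word D j i m) y.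
Proof.
move=> ij co.
have wp b : fact (\prod_(k < m) fT D (pick2 i j (letter b k))) y =
    word (fun b => opT (pick2 i j b) : C -> C) (~~ letter b m) m y.
  apply: (word_prod (Q := fun _ => True)
    (x := fun b => fT D (pick2 i j b)) (act := fact)) => //.
  - exact: free_act1.
  - by move=> a c u _ _; exact: free_actM.
  - by move=> c u; exact: free_act_fT.
have eT : braid_word D i j m = \prod_(k < m) fT D (pick2 i j (letter true k)).
  by apply: eq_bigr => k _; rewrite /letter /pick2; case: (odd k).
have eF : braid_word D j i m = \prod_(k < m) fT D (pick2 i j (letter false k)).
  by apply: eq_bigr => k _; rewrite /letter /pick2; case: (odd k).
rewrite eT eF (wp true) (wp false) -[false]/(~~ true) letterN negbK.
by case: (letter true m) => /=; rewrite (braid _ ij co).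
Qed.

Lemma free_act_rel a b y : hecke_rel q a b -> fact a y = fact b y.
Proof.
case=> {a b} [i|i j m ij co||l k|l i g gE].
- by rewrite expr2 free_actM !free_act_fT quadratic free_actP free_act_fT free_act1.
- exact: free_act_braid.
- by rewrite free_act_fX X0 free_act1.
- by rewrite free_actM !free_act_fX XD.
- rewrite free_actM free_act_fT !free_act_fX (bernstein _ gE) free_actD free_actM.
  rewrite free_act_fT free_act_fX free_actZ free_act_sum.
  congr (_ + _ *: _); apply: eq_bigr => k _.
  by rewrite free_actZ free_act_fX.
Qed.

Definition hecke_act (h : hecke D q) (y : C) : C :=
  presented_act gen_op (h : presented (hecke_rel q)) y.

Lemma hecke_act_module : is_module setT hecke_act.
Proof.
split=> [h _|y|g h y _ _|c h y _|g h y _ _].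
- exact: presented_act_linear.
- exact: (presented_act1 free_act_rel).
- exact: (presented_actD free_act_rel).
- exact: (presented_actZ free_act_rel).
- exact: (presented_actM free_act_rel).
Qed.

Lemma hecke_act_hT i y : hecke_act (hT D q i) y = opT i y.
Proof. by rewrite -free_act_fT; exact: (presented_act_pi free_act_rel). Qed.

Lemma hecke_act_hX l y : hecke_act (hX q l) y = opX l y.
Proof. by rewrite -free_act_fX; exact: (presented_act_pi free_act_rel). Qed.

End HeckeModule.

Theorem theorem3p5 (R : realType) (V : vectType R) (n : nat)
    (D : root_datum V n) (q : R[i])
    (q0 : q != 0) (q2 : q ^+ 2 != 1) (q2' : q ^+ 2 != -1)
    (t : weight D -> R[i]) (J : set V) :
  local_region q t J -> skew_region q t J ->
  exists act : hecke D q -> calib_space q t J -> calib_space q t J,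
    [/\ is_module setT act,
        forall w, chambers q t J w -> forall l,
          act (hX q l) (vsym q t J w) =
            torus_act w t l *: vsym q t J w,
        forall w, chambers q t J w -> forall i,
          act (hT D q i) (vsym q t J w) =
            Tcoef q t w i *: vsym q t J w +
            (q^-1 + Tcoef q t w i) *: vsym q t J (srefl D i \o w)%VF &
        irreducible act].
Proof.
move=> [/torusE ht _ Fne] skew.
have vs_out w : ~ chambers q t J w -> vsym q t J w = 0.
  by move=> nF; rewrite /vsym insubN // notin_setE.
have vs_val (x : chambers q t J) : vsym q t J (val x) = << x >>.
  by rewrite /vsym valK.
have vs_sub w : chambers q t J w -> exists x : chambers q t J, val x = w.
  by move=> Fw; exists (SigSub (mem_set Fw)).
have vs_neq0 w : chambers q t J w -> vsym q t J w != 0.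
  move=> /vs_sub[x <-]; rewrite vs_val.
  by apply/eqP => /(congr1 (mcoeff x)); rewrite mcoeffUU mcoeff0; exact/eqP/oner_neq0.
have vs_span (y : calib_space q t J) : exists (s : seq (chambers q t J))
    (c : chambers q t J -> R[i]), uniq s /\ y = \sum_(k <- s) c k *: vsym q t J (val k).
  exists (msupp y), (fun k => y@_k); split; first exact: fset_uniq.
  by rewrite [LHS]malg_sumE; apply: eq_bigr => k _; rewrite vs_val.
pose opT i : {linear calib_space q t J -> calib_space q t J} :=
  mlift (fun x : chambers q t J => Tcoef q t (val x) i *: vsym q t J (val x) +
    (q^-1 + Tcoef q t (val x) i) *: vsym q t J (srefl D i \o val x)%VF).
pose opX l : {linear calib_space q t J -> calib_space q t J} :=
  mlift (fun x : chambers q t J => torus_act (val x) t l *: vsym q t J (val x)).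
have opT_vs w i : chambers q t J w -> opT i (vsym q t J w) =
    Tcoef q t w i *: vsym q t J w +
    (q^-1 + Tcoef q t w i) *: vsym q t J (srefl D i \o w)%VF.
  by move=> /vs_sub[x <-]; rewrite {1}vs_val [LHS]mliftU.
have opX_vs w l : chambers q t J w ->
    opX l (vsym q t J w) = torus_act w t l *: vsym q t J w.
  by move=> /vs_sub[x <-]; rewrite {1}vs_val [LHS]mliftU.
clearbody opT opX.
have rT := opT_quadratic q0 q2 ht skew vs_out vs_span opT_vs.
have rB := op_braid q0 q2 ht skew vs_out vs_span opT_vs.
have r0 := opX0 ht vs_span opX_vs.
have rD := opXD ht vs_span opX_vs.
have rX := op_bernstein q0 q2 ht skew vs_out vs_span opT_vs opX_vs.
have aT := hecke_act_hT rT rB r0 rD rX.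
have aX := hecke_act_hX rT rB r0 rD rX.
exists (hecke_act opT opX); split.
- exact: (hecke_act_module rT rB r0 rD rX).
- by move=> w Fw l; rewrite aX (opX_vs w l Fw).
- by move=> w Fw i; rewrite aT (opT_vs w i Fw).
- exact: (skew_irreducible q0 q2 ht skew vs_neq0 vs_span opT_vs opX_vs Fne aT aX).
Qed.
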